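(* Let $\alpha>1$ and $0<\theta<1$, and let $Y_{\alpha,\theta}(t)=X_{\alpha}(S_{\theta}(t))$, where $X_\alpha$ is the pseudo-process with pseudo-density $u_\alpha(x,t)=\frac{1}{\pi}\int_0^{+\infty}\cos(\gamma x+t\gamma^\alpha)\,d\gamma$ and $S_\theta$ is an independent stable subordinator of exponent $\theta$. Then, for all $t>0$ and $\gamma\in\mathbb{R}$, $$\mathbb{E}\left[e^{i\gamma Y_{\alpha,\theta}(t)}\right]=e^{-t|\gamma|^{\alpha\theta}\cos\frac{\pi\theta}{2}\left(1+i\tan\frac{\pi\theta}{2}\operatorname{sgn}\gamma\right)}.$$ Set $$\nu=\alpha\theta,\qquad \beta=-\frac{\tan\frac{\pi\theta}{2}}{\tan\frac{\pi\alpha\theta}{2}},\qquad \sigma=\left(\cos\frac{\pi\theta}{2}\right)^{\frac{1}{\nu}},\qquad \mu=0.$$ If $\nu\in(0,2)$, $\nu\ne 1$, and $\beta\in[-1,1]$, then for every $t>0$ the pseudo-density of $Y_{\alpha,\theta}(t)$ is a genuine probability density function, and it is the density of the stable process $S_{\nu}(\sigma,\beta,\mu;t)$ of exponent $\nu$, dispersion parameter $\sigma$, skewness parameter $\beta$ and location parameter $\mu=0$ at time $t$.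
   Context: The integral defining the signed pseudo-density $u_\alpha(x,t)$ is a conditionally convergent improper integral; the Fourier transform of $u_\alpha$ is $\int_{-\infty}^{+\infty} e^{i\gamma x}u_\alpha(x,t)\,dx=e^{-it\operatorname{sgn}(\gamma)|\gamma|^{\alpha}}$ (in the generalized sense). The stable subordinator $S_\theta(t)$ has characteristic function $\mathbb{E}[e^{i\gamma S_\theta(t)}]=e^{-t|\gamma|^{\theta}e^{-i\frac{\theta\pi}{2}\operatorname{sgn}\gamma}}$ and probability density $h_\theta(s,t)$ on $(0,\infty)$. The pseudo-density of $Y_{\alpha,\theta}(t)$ is by definition $w(x,t)=\int_0^{+\infty}u_{\alpha}(x,s)\,h_\theta(s,t)\,ds$, and $\mathbb{E}[e^{i\gamma Y_{\alpha,\theta}(t)}]$ denotes its Fourier transform $\int_{-\infty}^{+\infty}e^{i\gamma x}w(x,t)\,dx$. For $\nu\in(0,2)$, $\nu\neq1$, $\sigma>0$, $\beta\in[-1,1]$, the stable process $S_\nu(\sigma,\beta,0;t)$ has characteristic function $$\mathbb{E}\left[e^{i\gamma S_{\nu}(\sigma,\beta,0;t)}\right]=e^{-t\sigma^{\nu}|\gamma|^{\nu}\left(1-i\beta\operatorname{sgn}\gamma\tan\frac{\pi\nu}{2}\right)}.$$ *)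

(* Defs.v *)
From HB Require Import structures.
From mathcomp Require Import all_boot all_order all_algebra complex.
From mathcomp Require Import all_classical all_reals all_analysis.

Set Implicit Arguments.
Unset Strict Implicit.
Unset Printing Implicit Defensive.

Import Order.TTheory GRing.Theory Num.Theory.
Import numFieldNormedType.Exports.

Local Open Scope classical_set_scope.
Local Open Scope complex_scope.
Local Open Scope ring_scope.

Definition cexp (R : realType) (z : R[i]) : R[i] :=
  (expR (complex.Re z))%:C * (cos (complex.Im z) +i* sin (complex.Im z)).

Definition Cintegral d (T : measurableType d) (R : realType)
    (m : {measure set T -> \bar R}) (D : set T) (f : T -> R[i]) : R[i] :=
  (\int[m]_(x in D) complex.Re (f x)) +i* (\int[m]_(x in D) complex.Im (f x)).

(* E[e^{i g X}] *)
Definition char_fun d (T : measurableType d) (R : realType)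
    (P : probability T R) (X : T -> R) (g : R) : R[i] :=
  Cintegral P setT (fun w => cexp ('i%C * (g * X w)%:C)).

(* [integrable] is part of the predicate, because [Rintegral] has a junk value
   on non-integrable functions. *)
Definition has_fourier (R : realType) (f : R -> R) (phi : R -> R[i]) : Prop :=
  (@lebesgue_measure R).-integrable setT (EFin \o f) /\
  forall g, Cintegral (@lebesgue_measure R) setT
              (fun x => cexp ('i%C * (g * x)%:C) * (f x)%:C) = phi g.

Definition is_pdf (R : realType) (f : R -> R) : Prop :=
  [/\ measurable_fun setT f, forall x, 0 <= f x &
      (\int[@lebesgue_measure R]_x (f x)%:E = 1)%E].

(* The law of X has density f on D, and is carried by D. *)
Definition has_density d (T : measurableType d) (R : realType)
    (P : probability T R) (X : {RV P >-> R}) (D : set R) (f : R -> R) : Prop :=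
  [/\ measurable_fun D f, forall x, D x -> 0 <= f x &
      forall A : set R, measurable A ->
        distribution P X A
        = (\int[@lebesgue_measure R]_(x in A `&` D) (f x)%:E)%E].

(* Processes are indexed by R; only the times t >= 0 are constrained.
   No path regularity is required. *)
Definition stationary_increments d (T : measurableType d) (R : realType)
    (P : probability T R) (S : R -> {RV P >-> R}) : Prop :=
  forall (s t : R) (A : set R), 0 <= s -> 0 <= t -> measurable A ->
    P [set w | A (S (s + t) w - S s w)] = P [set w | A (S t w)].

Definition independent_increments d (T : measurableType d) (R : realType)
    (P : probability T R) (S : R -> {RV P >-> R}) : Prop :=
  forall (n : nat) (t : nat -> R) (A : nat -> set R),
    0 <= t 0%N -> (forall i, t i <= t i.+1) -> (forall i, measurable (A i)) ->
    P [set w | forall i : 'I_n, A i (S (t i.+1) w - S (t i) w)]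
    = (\prod_(i < n) P [set w | A i (S (t i.+1) w - S (t i) w)%R])%E.

Definition levy_process d (T : measurableType d) (R : realType)
    (P : probability T R) (S : R -> {RV P >-> R}) : Prop :=
  [/\ {ae P, forall w, S 0 w = 0},
      stationary_increments S & independent_increments S].

Definition stable_subordinator d (T : measurableType d) (R : realType)
    (P : probability T R) (theta : R) (S : R -> {RV P >-> R}) : Prop :=
  [/\ levy_process S,
      {ae P, forall w, forall s t : R, 0 <= s -> s <= t -> S s w <= S t w} &
      forall t g : R, 0 < t -> char_fun P (S t) g
        = cexp (- (t * `|g| `^ theta)%:C
                  * cexp (- 'i%C * (theta * pi / 2 * Num.sg g)%:C))].

Definition stable_char (R : realType) (nu sigma beta mu t g : R) : R[i] :=
  cexp ('i%C * (mu * t * g)%:C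
        - (t * sigma `^ nu * `|g| `^ nu)%:C
          * (1 - 'i%C * (beta * Num.sg g * tan (pi * nu / 2))%:C)).

Definition stable_process d (T : measurableType d) (R : realType)
    (P : probability T R) (nu sigma beta mu : R) (Z : R -> {RV P >-> R}) : Prop :=
  levy_process Z /\
  forall t g : R, 0 < t -> char_fun P (Z t) g = stable_char nu sigma beta mu t g.

(* u_alpha(x, t), as the conditionally convergent improper integral
   lim_{A -> +oo} (1/pi) \int_0^A. *)
Definition pseudo_density (R : realType) (alpha x t : R) : R :=
  pi^-1 * lim ((fun A : R => \int[@lebesgue_measure R]_(g in `[0, A])
                    cos (g * x + t * g `^ alpha)) @ +oo).

(* Pseudo-density w(x, t) of X(S(t)), where u is the pseudo-density of X and
   h s t the density in s of S(t); independence of X and S is expressed by the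
   product u x s * h s t. *)
Definition subordinated_density (R : realType) (u h : R -> R -> R)
    (x t : R) : R :=
  \int[@lebesgue_measure R]_(s in `]0, +oo[) (u x s * h s t).

(* Main.v *)
Require Import Defs.
From HB Require Import structures.
From mathcomp Require Import all_boot all_order all_algebra complex.
From mathcomp Require Import all_classical all_reals all_analysis.
From mathcomp Require Import measurable_realfun.
From mathcomp Require Import ring lra.

Set Implicit Arguments.
Unset Strict Implicit.
Unset Printing Implicit Defensive.

Import Order.TTheory GRing.Theory Num.Theory.
Import numFieldNormedType.Exports.

Local Open Scope classical_set_scope.
Local Open Scope complex_scope.
Local Open Scope ring_scope.

(* Put nu = alpha * theta, a = t cos(pi theta / 2), b = t sin(pi theta / 2), and let W be the
   inverse Fourier transform of phi(g) = exp(-a |g|^nu - i b sgn(g) |g|^nu).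

   w(., t) = W: by van der Corput, int_0^A cos(g x + s g^alpha) dg is at most
   K s^(-1/(alpha-1)) + 2 uniformly in A, and S_t has all negative moments because monotonicity
   and independence give P(S_t <= x) <= P(S_(t/n) <= x)^n = O(x^n); so the limit A -> oo can be
   taken under E, where Fubini and the characteristic function of S_t apply.

   W is integrable: two integrations by parts give W(x) = O(1/x^2) if nu >= 1; if nu < 1 then
   W >= 0, and Abel means of the integral of W are bounded.  Fourier inversion follows.

   W >= 0 when |beta| <= 1: the functions r exp(i g h), r, h real with r >= 0, preserve
   nonnegativity of the inverse transform when multiplied with a transform; so do their sums,
   products, limits and exponentials.  In the binomial series of (1 - z)^nu at z = r e^(i g h),
   r < 1, all coefficients but one (of degree 0 if nu < 1, of degree 1 if nu > 1) have the same
   sign.  As a constant only contributes a scalar factor to an exponential,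
   exp(-l (1 - z)^nu), resp. exp(l (1 - z)^nu / z), is in this class; letting r -> 1 and h -> 0
   and multiplying with the mirror image gives phi.

   A variable with transform phi has density W: pair its law with Poisson kernels, integrate in
   the centre of the kernel and let its width tend to 0. *)

(** * Integration lemmas *)

(** The claim on the transform covers every nu > 0, where W may change sign, so integrability of W
    needs its own argument. Integration by parts stops at nu = 1: below it g^(nu-1) blows up at 0
    and W decays in general no faster than |x|^(-1-nu). But there theta < nu < 1 forces |beta| <= 1,
    so positivity can replace decay.

    The exponential of -l (1 - z)^nu, with z = r e^(i g h), is up to a scalar the characteristic
    function of a compound Poisson law on a lattice of step h. With h = s / n and l = p n^nu, the
    relevant limit is that of n^nu (1 - e^(i y / n))^nu, namely (-i y)^nu. Its real part |y|^nu
    cos(nu pi / 2) is positive for nu < 1 and negative for 1 < nu < 2, hence the two signs in front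
    of l. This limit yields the stable exponent of skewness 1 and its mirror image that of skewness
    -1. When phi is written as a product of the two with weights p and q, the condition |beta| <= 1
    is exactly p, q >= 0. *)

Lemma integrable_patch d (T : measurableType d) (R : realType)
    (m : {measure set T -> \bar R}) (D : set T) (f : T -> R) :
  measurable D -> m.-integrable D (EFin \o f) ->
  m.-integrable setT (EFin \o (f \_ D)).
Proof.
by move=> mD fi; rewrite -restrict_EFin; apply/integrable_restrict; rewrite ?setTI.
Qed.

Lemma le_integrable_EFin d (T : measurableType d) (R : realType)
    (m : {measure set T -> \bar R}) (D : set T) (f g : T -> R) :
  measurable D -> measurable_fun D f -> m.-integrable D (EFin \o g) ->
  (forall x, D x -> `|f x| <= g x) -> m.-integrable D (EFin \o f).
Proof.
move=> mD mf ig fg; apply: (@le_integrable _ _ _ _ _ mD _ (EFin \o g)) => //.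
  exact/measurable_EFinP.
by move=> x Dx; rewrite /= lee_fin (le_trans (fg _ Dx))// ler_norm.
Qed.

Lemma integrable_scale d (T : measurableType d) (R : realType)
    (m : {measure set T -> \bar R}) (D : set T) (k : R) (f : T -> R) :
  measurable D -> m.-integrable D (EFin \o f) ->
  m.-integrable D (EFin \o (fun x => k * f x)).
Proof. by move=> mD fi; have := integrableZl mD k fi; apply: eq_integrable. Qed.

Lemma integrable_add d (T : measurableType d) (R : realType)
    (m : {measure set T -> \bar R}) (D : set T) (f g : T -> R) :
  measurable D -> m.-integrable D (EFin \o f) -> m.-integrable D (EFin \o g) ->
  m.-integrable D (EFin \o (fun x => f x + g x)).
Proof. by move=> mD fi gi; have := integrableD mD fi gi; apply: eq_integrable. Qed.

Lemma product_integrable d1 d2 (T1 : measurableType d1)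
    (T2 : measurableType d2) (R : realType)
    (m1 : {sigma_finite_measure set T1 -> \bar R})
    (m2 : {sigma_finite_measure set T2 -> \bar R})
    (F : T1 * T2 -> R) (g : T1 -> R) (h : T2 -> R) :
  measurable_fun setT F ->
  m1.-integrable setT (EFin \o g) -> m2.-integrable setT (EFin \o h) ->
  (forall z, `|F z| <= `|g z.1| * `|h z.2|) ->
  (m1 \x m2)%E.-integrable setT (EFin \o F).
Proof.
move=> mF ig ih Fgh.
have mg : measurable_fun setT g by apply/measurable_EFinP; exact: measurable_int ig.
have mh : measurable_fun setT h by apply/measurable_EFinP; exact: measurable_int ih.
have mng : measurable_fun setT (fun x => `|g x|%:E).
  by apply/measurable_EFinP; exact: measurableT_comp.
have mnh : measurable_fun setT (fun x => `|h x|%:E).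
  by apply/measurable_EFinP; exact: measurableT_comp.
apply/integrable12ltyP; first exact/measurable_EFinP.
set K := (\int[m2]_y (`|h y|)%:E)%E.
have Kfin : (K < +oo)%E by move/integrableP : ih => [_].
have K0 : (0 <= K)%E by apply: integral_ge0 => y _; rewrite lee_fin.
apply: (@le_lt_trans _ _ (\int[m1]_x ((`|g x|)%:E * K))%E); last first.
  rewrite ge0_integralZr//.
  rewrite lte_mul_pinfty//; first by apply: integral_ge0 => y _; rewrite lee_fin.
    rewrite ge0_fin_numE; first by move/integrableP : ig => [_].
    by apply: integral_ge0 => y _; rewrite lee_fin.
have mFE : measurable_fun setT (fun z => `|(F z)%:E|%E).
  by apply: measurableT_comp => //; exact/measurable_EFinP.
apply: ge0_le_integral => //.
- by move=> x _; apply: integral_ge0.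
- exact: (measurable_fun_fubini_tonelli_F (fun z => `|(F z)%:E|%E)).
- by apply: emeasurable_funM.
move=> x _.
rewrite -ge0_integralZl//.
apply: ge0_le_integral => //.
- exact: (measurableT_comp mFE (pair1_measurable x)).
- by apply: emeasurable_funM.
by move=> y _; rewrite /= -EFinM lee_fin; exact: (Fgh (x, y)).
Qed.

(** Domination by a product [g x * h y] makes the double integral absolutely convergent. Multiplying
    [f] by the indicators of [D1] and [D2] moves the question to the whole product space, where
    Fubini applies. *)
Lemma Rintegral_swap d1 d2 (T1 : measurableType d1) (T2 : measurableType d2)
    (R : realType) (m1 : {sigma_finite_measure set T1 -> \bar R})
    (m2 : {sigma_finite_measure set T2 -> \bar R}) (D1 : set T1) (D2 : set T2)
    (f : T1 -> T2 -> R) (g : T1 -> R) (h : T2 -> R) :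
  measurable D1 -> measurable D2 ->
  measurable_fun setT (fun z : T1 * T2 => f z.1 z.2) ->
  m1.-integrable D1 (EFin \o g) -> m2.-integrable D2 (EFin \o h) ->
  (forall x y, D1 x -> D2 y -> `|f x y| <= g x * h y) ->
  m1.-integrable D1 (EFin \o (fun x => \int[m2]_(y in D2) f x y)) /\
  \int[m1]_(x in D1) \int[m2]_(y in D2) f x y
  = \int[m2]_(y in D2) \int[m1]_(x in D1) f x y.
Proof.
move=> mD1 mD2 mf ig ih fgh.
pose F (z : T1 * T2) := f z.1 z.2 * \1_D1 z.1 * \1_D2 z.2.
have iF : (m1 \x m2)%E.-integrable setT (EFin \o F).
  apply: (@product_integrable _ _ _ _ _ _ _ _ (g \_ D1) (h \_ D2)).
  - apply: measurable_funM; first apply: measurable_funM => //.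
      by apply: measurableT_comp measurable_fst; exact: measurable_indic.
    by apply: measurableT_comp measurable_snd; exact: measurable_indic.
  - exact: integrable_patch.
  - exact: integrable_patch.
  - move=> [x y]; rewrite /F/= !patchE !indicE.
    case: (asboolP (D1 x)) => Dx.
      rewrite mem_set//; case: (asboolP (D2 y)) => Dy.
        by rewrite mem_set// !mulr1 -normrM (le_trans (fgh _ _ Dx Dy))// ler_norm.
      by rewrite memNset// mulr0 normr0 mulr0.
    by rewrite memNset// mulr0 mul0r normr0 mul0r.
have i1 x : D1 x -> m2.-integrable D2 (EFin \o f x).
  move=> Dx; apply: (@le_integrable_EFin _ _ _ _ _ _ (fun y => g x * h y)) => //.
  - apply: measurable_funTS.
    exact: (measurableT_comp mf (pair1_measurable x)).
  - exact: integrable_scale.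
  - by move=> y Dy; exact: fgh.
have i2 y : D2 y -> m1.-integrable D1 (EFin \o f^~ y).
  move=> Dy; apply: (@le_integrable_EFin _ _ _ _ _ _ (fun x => h y * g x)) => //.
  - apply: measurable_funTS.
    exact: (measurableT_comp mf (pair2_measurable y)).
  - exact: integrable_scale.
  - by move=> x Dx; rewrite mulrC; exact: fgh.
have E1 x : (\int[m2]_y (F (x, y))%:E)%E
            = (((fun x => \int[m2]_(y in D2) f x y) \_ D1) x)%:E.
  rewrite patchE; case: (asboolP (D1 x)) => Dx.
    rewrite mem_set// /Rintegral fineK; last exact: integrable_fin_num (i1 _ Dx).
    rewrite [RHS]integral_mkcond; apply: eq_integral => y _.
    rewrite /F/= patchE !indicE mem_set// mulr1.
    by case: (y \in D2); rewrite ?mulr1 ?mulr0.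
  rewrite memNset// integral0_eq// => y _.
  by rewrite /F/= indicE memNset// mulr0 mul0r.
have E2 y : (\int[m1]_x (F (x, y))%:E)%E
            = (((fun y => \int[m1]_(x in D1) f x y) \_ D2) y)%:E.
  rewrite patchE; case: (asboolP (D2 y)) => Dy.
    rewrite mem_set// /Rintegral fineK; last exact: integrable_fin_num (i2 _ Dy).
    rewrite [RHS]integral_mkcond; apply: eq_integral => x _.
    rewrite /F/= patchE !indicE (mem_set Dy) mulr1.
    by case: (x \in D1); rewrite ?mulr1 ?mulr0.
  rewrite memNset// integral0_eq// => x _.
  by rewrite /F/= [in X in _ * X]indicE memNset// mulr0.
split.
  have := integrable_fubini_F iF; rewrite /fubini_F.
  under eq_fun do rewrite E1.
  move=> H; apply: (@eq_integrable _ _ _ _ _ mD1 (EFin \o ((fun x => \int[m2]_(y in D2) f x y) \_ D1))).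
    by move=> x; rewrite inE => Dx; rewrite /= patchE mem_set.
  exact: integrableS H.
rewrite [LHS]Rintegral_mkcond [RHS]Rintegral_mkcond.
have := Fubini iF; rewrite /=.
under eq_integral do rewrite E1.
under [RHS]eq_integral do rewrite E2.
by move=> H; rewrite /Rintegral H.
Qed.

Lemma cvg_expRN_scale (R : realType) (e : R) : 0 < e ->
  expR (- (e * x)) @[x --> +oo] --> (0 : R).
Proof.
move=> e0.
apply: (@cvg_comp _ _ _ (fun x => e * x) (fun x => expR (- x)) _ (+oo : set_system R)).
  apply: gt0_cvgMry => //.
exact: cvgr_expR.
Qed.

Lemma integral0y_expRN (R : realType) (e : R) : 0 < e ->
  (\int[@lebesgue_measure R]_(x in `[0%R, +oo[) (expR (- (e * x)))%:E = e^-1%:E)%E.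
Proof.
move=> e0.
have en0 : e != 0 by rewrite gt_eqF.
pose F x := - (e^-1 * expR (- (e * x))).
have dF (x : R) : is_derive x (1 : R) F (expR (- (e * x))).
  by rewrite /F; apply: is_derive_eq; rewrite /GRing.scale/=; field.
have cF : continuous F.
  by move=> x; apply: differentiable_continuous; apply/derivable1_diffP.
rewrite (@ge0_continuous_FTC2y _ _ F _ 0).
- by rewrite -EFinB sub0r /F mulr0 oppr0 expR0 mulr1 opprK.
- by move=> x _; exact: expR_ge0.
- apply: continuous_subspaceT => x.
  apply: continuous_comp; last exact: continuous_expR.
  by apply: cvgN; apply: cvgM => //; exact: cvg_cst.
- rewrite /F -oppr0 -(mulr0 e^-1); apply: cvgN; apply: cvgM; first exact: cvg_cst.
  exact: cvg_expRN_scale.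
- by move=> x _; exact: ex_derive.
- exact/cvg_at_right_filter/cF.
- by move=> x _; rewrite derive1E derive_val.
Qed.

Lemma integrable0y_expRN (R : realType) (e : R) : 0 < e ->
  (@lebesgue_measure R).-integrable `[0, +oo[ (EFin \o (fun x => expR (- (e * x)))).
Proof.
move=> e0; apply/integrableP; split.
  apply/measurable_EFinP; apply: measurable_funTS; apply: measurableT_comp => //.
  by apply: measurableT_comp => //; exact: measurable_funM.
under eq_integral do rewrite /= ger0_norm ?expR_ge0//.
by rewrite integral0y_expRN// ltry.
Qed.

Lemma Rintegral_expR_cos (R : realType) (e y c : R) : 0 < e ->
  \int[@lebesgue_measure R]_(x in `[0, +oo[) (expR (- (e * x)) * cos (y * x + c))
  = (e * cos c - y * sin c) / (e ^+ 2 + y ^+ 2).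
Proof.
move=> e0.
have en0 : e != 0 by rewrite gt_eqF.
have d0 : e ^+ 2 + y ^+ 2 != 0 by rewrite gt_eqF// ltr_wpDr ?sqr_ge0// exprn_gt0.
pose h x := expR (- (e * x)) * cos (y * x + c).
pose G x := expR (- (e * x)) *
  ((y * sin (y * x + c) - e * cos (y * x + c)) / (e ^+ 2 + y ^+ 2)).
(* The improper fundamental theorem of calculus is applied to a nonnegative integrand:
   [expR (- (e * x))] is added to [h], and its integral is subtracted at the end. *)
pose F x := G x - e^-1 * expR (- (e * x)).
have dF (x : R) : is_derive x (1 : R) F (expR (- (e * x)) + h x).
  rewrite /F /G /h; apply: is_derive_eq; rewrite /GRing.scale/=; field.
  by rewrite d0 en0.
have cF : continuous F.
  by move=> x; apply: differentiable_continuous; apply/derivable1_diffP.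
have cE : continuous (fun x => expR (- (e * x))).
  move=> x; apply: continuous_comp; last exact: continuous_expR.
  by apply: cvgN; apply: cvgM => //; exact: cvg_cst.
have ch : continuous h.
  move=> x; apply: cvgM; first exact: cE.
  apply: continuous_comp; last exact: continuous_cos.
  by apply: cvgD; [apply: cvgM => //; exact: cvg_cst|exact: cvg_cst].
have mh : measurable_fun setT h by exact: continuous_measurable_fun.
have ih : (@lebesgue_measure R).-integrable `[0, +oo[ (EFin \o h).
  apply: le_integrable_EFin (integrable0y_expRN e0) _ => //.
    exact: measurable_funTS.
  by move=> x _; rewrite normrM ger0_norm ?expR_ge0// ler_piMr ?expR_ge0// cos_max.
have H : \int[@lebesgue_measure R]_(x in `[0, +oo[) (expR (- (e * x)) + h x) = 0 - F 0.
  apply: Rintegral_ge0_continuous_FTC2y.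
  - move=> x _; rewrite -[X in X + _]mulr1 /h -mulrDr mulr_ge0 ?expR_ge0//.
  - by apply: continuous_subspaceT => x; apply: cvgD; [exact: cE|exact: ch].
  - have -> : (0 : R) = 0 - e^-1 * 0 by rewrite mulr0 subr0.
    apply: cvgB; last by apply: cvgM; [exact: cvg_cst|exact: cvg_expRN_scale].
    apply/norm_cvg0P.
    apply: (@squeeze_cvgr _ _ _ _ (cst 0)
      (fun x => expR (- (e * x)) * ((`|y| + e) / (e ^+ 2 + y ^+ 2)))).
    + near=> x; rewrite normr_ge0/= /G normrM ger0_norm ?expR_ge0//.
      rewrite ler_wpM2l ?expR_ge0// normrM [X in _ * X]ger0_norm; last first.
        by rewrite invr_ge0 addr_ge0 ?sqr_ge0.
      rewrite ler_wpM2r ?invr_ge0 ?addr_ge0 ?sqr_ge0//.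
      rewrite (le_trans (ler_normB _ _))// !normrM lerD ?ler_piMr ?sin_max//.
      by rewrite (gtr0_norm e0) ler_piMr ?cos_max// ltW.
    + exact: cvg_cst.
    + rewrite -[X in _ --> X](mul0r ((`|y| + e) / (e ^+ 2 + y ^+ 2))).
      by apply: cvgM; [exact: cvg_expRN_scale|exact: cvg_cst].
  - by move=> x _; exact: ex_derive.
  - exact/cvg_at_right_filter/cF.
  - by move=> x _; rewrite derive1E derive_val.
rewrite RintegralD// in H; last exact: integrable0y_expRN.
move: H; rewrite {1}/Rintegral integral0y_expRN//= => /(canRL (addKr _)) ->.
rewrite /F /G !mulr0 oppr0 expR0 !add0r; field.
by rewrite d0 en0.
Unshelve. all: by end_near. Qed.

Lemma continuous_norm_powR (R : realType) (nu : R) : 0 < nu ->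
  continuous (fun x : R => `|x| `^ nu).
Proof.
move=> nu0 a; have [->|a0] := eqVneq a 0.
  rewrite /continuous_at normr0 powR0 ?gt_eqF//.
  apply/cvgr0Pnorm_lt => e e0.
  have d0 : 0 < e `^ nu^-1 by rewrite powR_gt0.
  near=> x.
  rewrite ger0_norm ?powR_ge0//.
  have -> : e = (e `^ nu^-1) `^ nu by rewrite -powRrM mulVf ?gt_eqF// powRr1// ltW.
  by rewrite gt0_ltr_powR// nnegrE powR_ge0.
have na0 : 0 < `|a| by rewrite normr_gt0.
apply: (@continuous_comp _ _ _ (fun x : R => `|x|) (fun y => y `^ nu)).
  exact: norm_continuous.
apply: differentiable_continuous; apply/derivable1_diffP.
by apply: derivable_powR; rewrite in_itv/= na0.
Unshelve. all: by end_near. Qed.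

Lemma sg_powR (R : realType) (nu x : R) :
  Num.sg x * `|x| `^ nu = x * `|x| `^ (nu - 1).
Proof.
have [->|x0] := eqVneq x 0; first by rewrite sgr0 !mul0r.
rewrite powRB; last by rewrite normr_eq0 x0 implybT.
rewrite powRr1 ?normr_ge0// [X in X * (_ / _)]numEsg -mulrA; congr (_ * _).
by rewrite mulrC divfK// normr_eq0.
Qed.

Lemma continuous_sg_powR (R : realType) (nu : R) : 0 < nu ->
  continuous (fun x : R => Num.sg x * `|x| `^ nu).
Proof.
move=> nu0 a; have [->|a0] := eqVneq a 0.
  rewrite /continuous_at sgr0 mul0r; apply/norm_cvg0P.
  have := @continuous_norm_powR _ _ nu0 (0 : R).
  rewrite /continuous_at normr0 powR0 ?gt_eqF// => H.
  apply: (@squeeze_cvgr _ _ _ _ (cst 0) (fun x : R => `|x| `^ nu)) => //; last exact: cvg_cst.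
  near=> x; rewrite /cst normr_ge0/= normrM (ger0_norm (powR_ge0 _ _)).
  by rewrite ler_piMl ?powR_ge0// normr_sg lern1 leq_b1.
have na0 : 0 < `|a| by rewrite normr_gt0.
under eq_fun do rewrite sg_powR.
apply: cvgM; first exact: cvg_id.
apply: (@continuous_comp _ _ _ (fun x : R => `|x|) (fun y => y `^ (nu - 1))).
  exact: norm_continuous.
apply: differentiable_continuous; apply/derivable1_diffP.
by apply: derivable_powR; rewrite in_itv/= na0.
Unshelve. all: by end_near. Qed.

Lemma expR_poly_bound (R : realType) (a : R) (n : nat) : 0 < a ->
  exists2 C : R, 0 < C & forall y, 0 <= y -> y ^+ n.+1 <= C * expR (a * y).
Proof.
move=> a0; exists (n.+1`!%:R / a ^+ n.+1).
  by rewrite divr_gt0 ?exprn_gt0// ltr0n fact_gt0.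
move=> y y0; have := @expR_ge1Dxn R (a * y) n (mulr_ge0 (ltW a0) y0).
rewrite exprMn => H.
have f0 : 0 < n.+1`!%:R :> R by rewrite ltr0n fact_gt0.
have an0 : 0 < a ^+ n.+1 by rewrite exprn_gt0.
rewrite mulrAC ler_pdivlMr// mulrC -ler_pdivrMl//.
by apply: le_trans H; rewrite -subr_ge0 (_ : _ - _ = 1)//; ring.
Qed.

Lemma expR_powR_bound (R : realType) (a nu : R) : 0 < a -> 0 < nu ->
  exists2 C : R, 0 < C &
    forall x, 0 <= x -> expR (- (a * x `^ nu)) <= C * (1 + x ^+ 2)^-1.
Proof.
(* Since n + 1 exceeds 2 / nu, x^2 is at most (x^nu)^(n+1) for x > 1, and a power of x^nu is
   absorbed by the exponential. *)
move=> a0 nu0; pose n := Num.truncn (2 / nu).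
have [C C0 HC] := @expR_poly_bound _ a n a0.
exists (2 + C); first by rewrite addr_gt0.
move=> x x0; have y0 := powR_ge0 x nu.
rewrite ler_pdivlMr; last by rewrite ltr_pwDl// sqr_ge0.
rewrite mulrC expRN ler_pdivrMr ?expR_gt0//.
have E1 : 1 <= expR (a * x `^ nu).
  by rewrite -expR0 ler_expR mulr_ge0// ltW.
have [x1|x1] := leP x 1.
  have : x ^+ 2 <= 1 by rewrite expr_le1.
  have := mulr_ge0 (ltW C0) (le_trans ler01 E1).
  rewrite mulrDl; nra.
have y1 : 1 <= x `^ nu.
  by rewrite -[leLHS](powRr0 x) ler_powR ?ltW.
have : x ^+ 2 <= (x `^ nu) ^+ n.+1.
  rewrite -[leRHS]powR_mulrn// -powR_mulrn// -powRrM ler_powR ?ltW//.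
  by rewrite mulrC -ltr_pdivrMr//; exact/truncnS_gt.
have := HC _ y0.
rewrite mulrDl; nra.
Qed.

Lemma integrableT_oneDsqrV (R : realType) :
  (@lebesgue_measure R).-integrable setT (EFin \o (fun x => (1 + x ^+ 2)^-1)).
Proof.
apply/integrableP; split.
  by apply/measurable_EFinP; apply: continuous_measurable_fun; exact: continuous_oneDsqrV.
under eq_integral do rewrite /= ger0_norm ?invr_ge0 ?addr_ge0 ?sqr_ge0//.
rewrite ge0_symfun_integralT//.
- by rewrite -set_itvcy integral0y_oneDsqr -EFinM ltry.
- by move=> x; rewrite invr_ge0 addr_ge0 ?sqr_ge0.
- exact: continuous_oneDsqrV.
- by move=> x /=; rewrite sqrrN.
Qed.

Lemma RintegralT_oneDsqrV (R : realType) :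
  \int[@lebesgue_measure R]_x (1 + x ^+ 2)^-1 = pi.
Proof.
rewrite /Rintegral ge0_symfun_integralT//.
- by rewrite -set_itvcy integral0y_oneDsqr -EFinM/= mulrC divfK.
- by move=> x; rewrite invr_ge0 addr_ge0 ?sqr_ge0.
- exact: continuous_oneDsqrV.
- by move=> x /=; rewrite sqrrN.
Qed.

Lemma integrable0y_expR_powR (R : realType) (a nu : R) : 0 < a -> 0 < nu ->
  (@lebesgue_measure R).-integrable `[0, +oo[
    (EFin \o (fun x => expR (- (a * x `^ nu)))).
Proof.
move=> a0 nu0; have [C C0 HC] := expR_powR_bound a0 nu0.
apply: (@le_integrable_EFin _ _ _ (@lebesgue_measure R) _ _ (fun x => C * (1 + x ^+ 2)^-1)) => //.
- apply: measurable_funTS; apply: measurableT_comp => //.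
  by apply: measurableT_comp => //; apply: measurable_funM => //.
- apply: integrable_scale => //.
  by apply: integrableS (@integrableT_oneDsqrV R) => //.
- move=> x; rewrite /= in_itv/= andbT => x0.
  by rewrite ger0_norm ?expR_ge0// HC.
Qed.

Lemma dominated_convergence_Rintegral d (T : measurableType d) (R : realType)
    (m : {measure set T -> \bar R}) (D : set T) (f_ : nat -> T -> R)
    (f g : T -> R) :
  measurable D -> (forall n, measurable_fun D (f_ n)) ->
  (forall x, D x -> f_ n x @[n --> \oo] --> f x) ->
  m.-integrable D (EFin \o g) ->
  (forall n x, D x -> `|f_ n x| <= g x) ->
  m.-integrable D (EFin \o f) /\
  \int[m]_(x in D) f_ n x @[n --> \oo] --> \int[m]_(x in D) f x.
Proof.
move=> mD mf ff ig fg.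
have mff : measurable_fun D f by exact: measurable_fun_cvg ff.
have [i1 _ c1] : [/\ m.-integrable D (EFin \o f),
    [sequence (\int[m]_(x in D) `|(f_ n x)%:E - (f x)%:E|)%E]_n @ \oo --> 0%E &
    [sequence (\int[m]_(x in D) (f_ n x)%:E)%E]_n @ \oo
      --> (\int[m]_(x in D) (f x)%:E)%E].
  apply: (@dominated_convergence _ _ _ m _ mD (fun n => EFin \o f_ n)
    (EFin \o f) (EFin \o g)) => //.
  - by move=> n; exact/measurable_EFinP.
  - exact/measurable_EFinP.
  - apply: aeW => x Dx; apply: cvg_EFin; last exact: ff.
    exact: nearW.
  - by apply: aeW => x n Dx; rewrite lee_fin; exact: fg.
split=> //; apply: fine_cvg; rewrite /Rintegral fineK//.
exact: integrable_fin_num.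
Qed.

Lemma ge0_integralT_fold (R : realType) (f : R -> \bar R) :
  measurable_fun setT f -> (forall x, 0 <= f x)%E ->
  (\int[@lebesgue_measure R]_x f x
   = \int[@lebesgue_measure R]_(x in `[0%R, +oo[) (f x + f (- x)%R))%E.
Proof.
move=> mf f0.
have mfN : measurable_fun setT (f \o -%R) by exact: measurableT_comp.
rewrite ge0_integralD//; [|exact: measurable_funTS..].
rewrite -(setUv `[0%R, +oo[%classic) ge0_integral_setU//=; last 3 first.
- exact: measurableC.
- exact: measurable_funTS.
- exact/disj_setPCl.
congr (_ + _)%E; rewrite setCitvr integral_itv_bndo_bndc; last exact: measurable_funTS.
rewrite (ge0_integration_by_substitution0 mfN); last by move=> r; exact: f0.
by apply: eq_integral => x _ /=; rewrite opprK.
Qed.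

Lemma integrable_half (R : realType) (f : R -> R) :
  (@lebesgue_measure R).-integrable setT (EFin \o f) ->
  (@lebesgue_measure R).-integrable `[0, +oo[ (EFin \o f) /\
  (@lebesgue_measure R).-integrable `[0, +oo[ (EFin \o (fun x => f (- x))).
Proof.
move=> fi; have mf : measurable_fun setT f by apply/measurable_EFinP; exact: measurable_int fi.
have mfN : measurable_fun setT (fun x : R => f (- x)) by exact: (measurableT_comp mf).
split; first exact: integrableS fi.
apply/integrableP; split; first exact/measurable_EFinP/measurable_funTS.
have /integrableP[_] := fi; rewrite ge0_integralT_fold//; last first.
  by apply: measurableT_comp => //; exact/measurable_EFinP.
apply: le_lt_trans; apply: ge0_le_integral => //.
- apply: measurable_funTS; apply: measurableT_comp => //; exact/measurable_EFinP.
- apply: measurable_funTS; apply: emeasurable_funD.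
    by apply: measurableT_comp => //; exact/measurable_EFinP.
  by apply: (@measurableT_comp _ _ _ _ _ _ abse) => //; exact/measurable_EFinP.
- by move=> x _ /=; rewrite leeDr.
Qed.

Lemma RintegralT_fold (R : realType) (f : R -> R) :
  (@lebesgue_measure R).-integrable setT (EFin \o f) ->
  \int[@lebesgue_measure R]_x f x
  = \int[@lebesgue_measure R]_(x in `[0, +oo[) (f x + f (- x)).
Proof.
have ge0 (g : R -> R) : measurable_fun setT g -> (forall x, 0 <= g x) ->
  \int[@lebesgue_measure R]_x g x
  = \int[@lebesgue_measure R]_(x in `[0, +oo[) (g x + g (- x)).
  move=> mg g0; rewrite /Rintegral ge0_integralT_fold//.
  exact/measurable_EFinP.
move=> fi; have mf : measurable_fun setT f by apply/measurable_EFinP; exact: measurable_int fi.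
have mnf : measurable_fun setT (fun x => `|f x|) by exact: measurableT_comp.
have nfi : (@lebesgue_measure R).-integrable setT (EFin \o (fun x => `|f x|)).
  exact: integrable_norm.
have [f1 f2] := integrable_half fi.
have [n1 n2] := integrable_half nfi.
(* The nonnegative case is applied to [f + |f|] and to [|f|]. *)
have E : \int[@lebesgue_measure R]_x f x = \int[@lebesgue_measure R]_x (f x + `|f x|)
   - \int[@lebesgue_measure R]_x `|f x|.
  by rewrite RintegralD// addrK.
rewrite E ge0; last 2 first.
- exact: measurable_funD.
- by move=> x; have := ler_norm (- f x); rewrite normrN; lra.
rewrite ge0// -RintegralB//.
- by apply: eq_Rintegral => x _ /=; ring.
- by do 2 apply: integrable_add => //.
- exact: integrable_add.
Qed.

(** * Stable densities and Fourier inversion *)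

(** The inverse Fourier transform of exp(- a |g|^nu - i b sg(g) |g|^nu). The half g < 0 contributes
    the complex conjugate of the half g >= 0, so the integral is folded onto g >= 0 and is real. *)
Definition stable_density (R : realType) (a b nu x : R) : R :=
  pi^-1 * \int[@lebesgue_measure R]_(g in `[0, +oo[)
    (expR (- (a * g `^ nu)) * cos (g * x + b * g `^ nu)).

(* Real part of [e^{ic}] times the conjugate-free transform of the density; the values
   [c = 0] and [c = - pi / 2] give its real and imaginary parts. *)
Definition stable_transform (R : realType) (a b nu c g : R) : R :=
  expR (- (a * `|g| `^ nu)) * cos (c - b * (Num.sg g * `|g| `^ nu)).

Lemma measurable_density_integrand (R : realType) (a b nu x : R) :
  measurable_fun setT (fun g : R => expR (- (a * g `^ nu)) * cos (g * x + b * g `^ nu)).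
Proof.
apply: measurable_funM.
  apply: measurableT_comp => //; apply: measurableT_comp => //.
  by apply: measurable_funM => //.
apply: (@measurableT_comp _ _ _ _ _ _ cos).
  by apply: continuous_measurable_fun; exact: continuous_cos.
by apply: measurable_funD; apply: measurable_funM => //.
Qed.

Lemma integrable_density_integrand (R : realType) (a b nu x : R) : 0 < a -> 0 < nu ->
  (@lebesgue_measure R).-integrable `[0, +oo[
    (EFin \o (fun g : R => expR (- (a * g `^ nu)) * cos (g * x + b * g `^ nu))).
Proof.
move=> a0 nu0.
apply: le_integrable_EFin (integrable0y_expR_powR a0 nu0) _ => //.
  by apply: measurable_funTS; exact: measurable_density_integrand.
by move=> g _; rewrite normrM ger0_norm ?expR_ge0// ler_piMr ?expR_ge0// cos_max.
Qed.

Lemma continuous_stable_density (R : realType) (a b nu : R) : 0 < a -> 0 < nu ->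
  continuous (stable_density a b nu).
Proof.
move=> a0 nu0 x; apply: cvgM; first exact: cvg_cst.
apply: (@continuity_under_integral _ _ _ (@lebesgue_measure R)
  (fun x g => expR (- (a * g `^ nu)) * cos (g * x + b * g `^ nu)) _ _ (x - 1) (x + 1)
  _ _ _ (integrable0y_expR_powR a0 nu0) _ x) => //.
- by move=> y _; exact: integrable_density_integrand.
- apply: aeW => g _ y _; apply: cvgM; first exact: cvg_cst.
  apply: continuous_comp; last exact: continuous_cos.
  by apply: cvgD; [apply: cvgM => //; exact: cvg_cst|exact: cvg_cst].
- move=> y _; apply: aeW => g _.
  by rewrite normrM ger0_norm ?expR_ge0// ler_piMr ?expR_ge0// cos_max.
- by rewrite inE/= in_itv/=; lra.
Qed.

Lemma measurable_stable_density (R : realType) (a b nu : R) : 0 < a -> 0 < nu ->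
  measurable_fun setT (stable_density a b nu).
Proof. by move=> a0 nu0; apply: continuous_measurable_fun; exact: continuous_stable_density. Qed.

Lemma stable_transform_le1 (R : realType) (a b nu c g : R) : 0 < a ->
  `|stable_transform a b nu c g| <= 1.
Proof.
move=> a0; rewrite normrM ger0_norm ?expR_ge0// mulr_ile1 ?expR_ge0 ?cos_max//.
by rewrite expR_le1 oppr_le0 mulr_ge0 ?powR_ge0// ltW.
Qed.

Lemma continuous_stable_transform (R : realType) (a b nu c : R) : 0 < nu ->
  continuous (stable_transform a b nu c).
Proof.
move=> nu0 x; apply: cvgM.
  apply: continuous_comp; last exact: continuous_expR.
  by apply: cvgN; apply: cvgM; [exact: cvg_cst|exact: continuous_norm_powR].
apply: continuous_comp; last exact: continuous_cos.
apply: cvgB; first exact: cvg_cst.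
by apply: cvgM; [exact: cvg_cst|exact: continuous_sg_powR].
Qed.

(** * Cauchy kernels as an approximate identity *)

Lemma cauchy_kernel_ge0 (R : realType) (e x : R) : 0 < e -> 0 <= e / (e ^+ 2 + x ^+ 2).
Proof. by move=> e0; rewrite divr_ge0 ?addr_ge0 ?sqr_ge0// ltW. Qed.

Lemma continuous_cauchy_kernel (R : realType) (e g : R) : 0 < e ->
  continuous (fun x : R => e / (e ^+ 2 + (x - g) ^+ 2)).
Proof.
move=> e0 x; apply: cvgM; first exact: cvg_cst.
apply: cvgV; first by rewrite gt_eqF// ltr_wpDr ?sqr_ge0// exprn_gt0.
apply: cvgD; first exact: cvg_cst.
apply: (@continuous_comp _ _ _ (fun y => y - g) (fun y => y ^+ 2)).
  by apply: cvgB => //; exact: cvg_cst.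
exact: exprn_continuous.
Qed.

Lemma integralT_affine (R : realType) (e g : R) (h : R -> R) : 0 < e ->
  continuous h -> (forall x, 0 <= h x) ->
  (\int[@lebesgue_measure R]_x (h x)%:E
   = \int[@lebesgue_measure R]_x (h (g + e * x) * e)%:E)%E.
Proof.
move=> e0 ch h0.
pose F x := g + e * x.
have dF (x : R) : is_derive x (1 : R) F e.
  by rewrite /F; apply: is_derive_eq; rewrite /GRing.scale/=; ring.
have F'E : derive1 F = cst e by apply/funext => x; rewrite derive1E derive_val.
rewrite (@increasing_ge0_integration_by_substitutionT _ F)//.
- by apply: eq_integral => x _; rewrite F'E.
- by move=> x y xy; rewrite /F ltrD2l ltr_pM2l.
- by rewrite F'E; exact: cst_continuous.
- by rewrite F'E; exact: is_cvg_cst.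
- by rewrite F'E; exact: is_cvg_cst.
- apply/cvgrNyPle => A; near=> x.
  have : x <= (A - g) / e by near: x; apply: nbhs_ninfty_le; rewrite num_real.
  by rewrite ler_pdivlMr// /F; lra.
- apply/cvgryPge => A; near=> x.
  have : (A - g) / e <= x by near: x; apply: nbhs_pinfty_ge; rewrite num_real.
  by rewrite ler_pdivrMr// /F; lra.
Unshelve. all: by end_near. Qed.

Lemma cauchy_kernel_scale (R : realType) (e v : R) : 0 < e ->
  e / (e ^+ 2 + (e * v) ^+ 2) * e = (1 + v ^+ 2)^-1.
Proof.
move=> e0; have : 1 + v ^+ 2 != 0 by rewrite gt_eqF// ltr_wpDr ?sqr_ge0.
have : e ^+ 2 + (e * v) ^+ 2 != 0 by rewrite gt_eqF// ltr_wpDr ?sqr_ge0 ?exprn_gt0.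
by move=> h1 h2; field; rewrite h1 h2.
Qed.

Lemma integrable_cauchy_kernel (R : realType) (e g : R) : 0 < e ->
  (@lebesgue_measure R).-integrable setT
    (EFin \o (fun x : R => e / (e ^+ 2 + (x - g) ^+ 2))).
Proof.
move=> e0; apply/integrableP; split.
  by apply/measurable_EFinP; apply: continuous_measurable_fun; exact: continuous_cauchy_kernel.
under eq_integral do rewrite /= ger0_norm ?cauchy_kernel_ge0//.
rewrite (integralT_affine g e0); last 2 first.
- exact: continuous_cauchy_kernel.
- by move=> x; exact: cauchy_kernel_ge0.
under eq_integral do rewrite [g + _]addrC addrK cauchy_kernel_scale//.
have /integrableP[_] := @integrableT_oneDsqrV R; apply: le_lt_trans.
by rewrite le_eqVlt; apply/orP; left; apply/eqP; apply: eq_integral => x _;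
   rewrite /= ger0_norm ?invr_ge0 ?addr_ge0 ?sqr_ge0.
Qed.

Lemma integrable_cauchy_kernelM (R : realType) (e g : R) (f : R -> R) : 0 < e ->
  measurable_fun setT f -> (forall x, `|f x| <= 1) ->
  (@lebesgue_measure R).-integrable setT
    (EFin \o (fun x : R => e / (e ^+ 2 + (x - g) ^+ 2) * f x)).
Proof.
move=> e0 mf f1; apply: le_integrable_EFin (integrable_cauchy_kernel g e0) _ => //.
  apply: measurable_funM => //.
  by apply: continuous_measurable_fun; exact: continuous_cauchy_kernel.
by move=> x _; rewrite normrM ger0_norm ?cauchy_kernel_ge0// ler_piMr ?cauchy_kernel_ge0.
Qed.

Lemma Rintegral_cauchy_kernel (R : realType) (e g : R) (f : R -> R) : 0 < e ->
  continuous f -> (forall x, `|f x| <= 1) ->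
  \int[@lebesgue_measure R]_x (e / (e ^+ 2 + (x - g) ^+ 2) * f x)
  = \int[@lebesgue_measure R]_x ((1 + x ^+ 2)^-1 * f (g + e * x)).
Proof.
move=> e0 cf f1.
have mf : measurable_fun setT f by exact: continuous_measurable_fun.
have caff : continuous (fun x : R => g + e * x).
  by move=> x; apply: cvgD; [exact: cvg_cst|apply: cvgM => //; exact: cvg_cst].
have cfa : continuous (fun x : R => f (g + e * x)).
  by move=> x; apply: continuous_comp; [exact: caff|exact: cf].
have mfa : measurable_fun setT (fun x : R => f (g + e * x)).
  exact: continuous_measurable_fun.
have iK := integrable_cauchy_kernel g e0.
have iKf := integrable_cauchy_kernelM g e0 mf f1.
have iV := @integrableT_oneDsqrV R.
have V0 (x : R) : 0 <= (1 + x ^+ 2)^-1 by rewrite invr_ge0 addr_ge0 ?sqr_ge0.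
have iVf : (@lebesgue_measure R).-integrable setT
    (EFin \o (fun x : R => (1 + x ^+ 2)^-1 * f (g + e * x))).
  apply: le_integrable_EFin iV _ => //.
    apply: measurable_funM => //.
    by apply: continuous_measurable_fun; exact: continuous_oneDsqrV.
  by move=> x _; rewrite normrM ger0_norm// ler_piMr.
have sub (h : R -> R) : continuous h -> (forall x, 0 <= h x) ->
    \int[@lebesgue_measure R]_x (e / (e ^+ 2 + (x - g) ^+ 2) * h x)
    = \int[@lebesgue_measure R]_x ((1 + x ^+ 2)^-1 * h (g + e * x)).
  move=> ch h0; rewrite /Rintegral (integralT_affine g e0); last 2 first.
  - by move=> x; apply: cvgM; [exact: continuous_cauchy_kernel|exact: ch].
  - by move=> x; rewrite mulr_ge0 ?cauchy_kernel_ge0.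
  congr fine; apply: eq_integral => x _.
  by rewrite [g + _]addrC addrK mulrAC cauchy_kernel_scale.
(* The change of variables is proved for nonnegative functions. As |f| <= 1, it applies to [f + 1]
   and to [1], whose difference is [f]. *)
have := sub (fun x => f x + 1); have := sub (fun=> 1).
rewrite (_ : (fun x => _ * 1) = (fun x => e / (e ^+ 2 + (x - g) ^+ 2))); last first.
  by apply/funext => x; rewrite mulr1.
move=> E1 E2.
have {}E1 := E1 (@cst_continuous _ _ _) (fun=> ler01).
have {}E2 : _ := E2 _ _.
have : \int[@lebesgue_measure R]_x (e / (e ^+ 2 + (x - g) ^+ 2) * (f x + 1))
    = \int[@lebesgue_measure R]_x (e / (e ^+ 2 + (x - g) ^+ 2) * f x)
      + \int[@lebesgue_measure R]_x (e / (e ^+ 2 + (x - g) ^+ 2)).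
  by rewrite -RintegralD//; apply: eq_Rintegral => x _; rewrite mulrDr mulr1.
rewrite E2; last 2 first.
- by move=> x; apply: cvgD; [exact: cf|exact: cvg_cst].
- by move=> x; have := f1 x; rewrite ler_norml; lra.
have -> : \int[@lebesgue_measure R]_x ((1 + x ^+ 2)^-1 * (f (g + e * x) + 1))
    = \int[@lebesgue_measure R]_x ((1 + x ^+ 2)^-1 * f (g + e * x))
      + \int[@lebesgue_measure R]_x (1 + x ^+ 2)^-1.
  by rewrite -RintegralD//; apply: eq_Rintegral => x _; rewrite mulrDr mulr1.
rewrite E1; under [X in _ = _ + X -> _]eq_Rintegral do rewrite mulr1.
by move=> /addIr ->.
Qed.

(** After the substitution the kernel no longer depends on the width, and dominated convergence acts
    on [f (g + harmonic n * x)] alone. The factor pi is the total mass of 1 / (1 + x^2). *)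
Lemma cvg_cauchy_kernel (R : realType) (g : R) (f : R -> R) :
  continuous f -> (forall x, `|f x| <= 1) ->
  \int[@lebesgue_measure R]_x (harmonic n / (harmonic n ^+ 2 + (x - g) ^+ 2) * f x)
    @[n --> \oo] --> pi * f g.
Proof.
move=> cf f1.
have mfa n : measurable_fun setT (fun x : R => (1 + x ^+ 2)^-1 * f (g + harmonic n * x)).
  apply: measurable_funM.
    by apply: continuous_measurable_fun; exact: continuous_oneDsqrV.
  apply: continuous_measurable_fun => x; apply: continuous_comp; last exact: cf.
  by apply: cvgD; [exact: cvg_cst|apply: cvgM => //; exact: cvg_cst].
under eq_fun do rewrite Rintegral_cauchy_kernel ?harmonic_gt0//.
rewrite -(@RintegralT_oneDsqrV R) -RintegralZr//; last exact: integrableT_oneDsqrV.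
apply: (@dominated_convergence_Rintegral _ _ _ (@lebesgue_measure R) setT
  (fun n x => (1 + x ^+ 2)^-1 * f (g + harmonic n * x))
  (fun x => (1 + x ^+ 2)^-1 * f g) (fun x => (1 + x ^+ 2)^-1) measurableT mfa _
  (@integrableT_oneDsqrV R) _).2.
  move=> x _; apply: cvgM; first exact: cvg_cst.
  apply: continuous_cvg; first exact: cf.
  rewrite -[X in _ --> X]addr0 -(mul0r x).
  by apply: cvgD; [exact: cvg_cst|apply: cvgM; [exact: cvg_harmonic|exact: cvg_cst]].
move=> n x _.
have V0 : 0 <= (1 + x ^+ 2)^-1 by rewrite invr_ge0 addr_ge0 ?sqr_ge0.
by rewrite normrM (ger0_norm V0) ler_piMr.
Qed.

(** * Abel means and Fourier inversion *)

Lemma Rintegral_comb d (T : measurableType d) (R : realType)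
    (m : {measure set T -> \bar R}) (D : set T) (k r s : R) (f g : T -> R) :
  measurable D -> m.-integrable D (EFin \o f) -> m.-integrable D (EFin \o g) ->
  \int[m]_(x in D) (k * (r * f x + s * g x))
  = k * (r * \int[m]_(x in D) f x + s * \int[m]_(x in D) g x).
Proof.
move=> mD fi gi; have i1 := integrable_scale r mD fi; have i2 := integrable_scale s mD gi.
rewrite (@RintegralZl _ _ _ _ _ (fun x => r * f x + s * g x))//; last exact: integrable_add.
by rewrite (@RintegralD _ _ _ _ _ (fun x => r * f x))// !RintegralZl.
Qed.

Lemma cvg_expRN_harmonic (R : realType) (x : R) :
  expR (- (harmonic n * x)) @[n --> \oo] --> (1 : R).
Proof.
rewrite -[X in _ --> X](@expR0 R); apply: continuous_cvg; first exact: continuous_expR.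
rewrite -[X in _ --> X](@oppr0 R) -[X in _ --> - X](mul0r x); apply: cvgN.
by apply: cvgM; [exact: cvg_harmonic|exact: cvg_cst].
Qed.

Lemma measurable_cos (R : realType) : measurable_fun setT (@cos R).
Proof. by apply: continuous_measurable_fun; exact: continuous_cos. Qed.

Lemma integrable_expRN_cos (R : realType) (e k c : R) : 0 < e ->
  (@lebesgue_measure R).-integrable `[0, +oo[
    (EFin \o (fun x => expR (- (e * x)) * cos (k * x + c))).
Proof.
move=> e0; apply: le_integrable_EFin (integrable0y_expRN e0) _ => //.
  apply: measurable_funTS; apply: measurable_funM.
    by apply: measurableT_comp => //; apply: measurableT_comp => //; exact: measurable_funM.
  by apply: (measurableT_comp (@measurable_cos R)); apply: measurable_funD => //; exact: measurable_funM.
by move=> x _; rewrite normrM ger0_norm ?expR_ge0// ler_piMr ?expR_ge0// cos_max.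
Qed.

(** With A = y x and B = g x, adding the values at x and - x cancels the odd parts: only cosines of
    (g + y) x and (g - y) x remain, and the phases q and c become constant factors. *)
Lemma cosM_fold (R : realType) (A B q c : R) :
  cos (A + q) * cos (B + c) + cos (- A + q) * cos (- B + c)
  = cos (c + q) * cos (B + A) + cos (c - q) * cos (B - A).
Proof. by rewrite !(cosD, sinD) !(cosN, sinN); ring. Qed.

(* Both sides are the pairing of the transform with the Cauchy kernel, which is the
   transform of [exp (- e |x|)]. *)
Lemma abel_mean_stable_density (R : realType) (a b nu c e g : R) :
  0 < a -> 0 < nu -> 0 < e ->
  \int[@lebesgue_measure R]_(x in `[0, +oo[)
    (expR (- (e * x)) * (stable_density a b nu x * cos (g * x + c)
                         + stable_density a b nu (- x) * cos (g * - x + c)))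
  = pi^-1 * \int[@lebesgue_measure R]_x
      (e / (e ^+ 2 + (x - g) ^+ 2) * stable_transform a b nu c x).
Proof.
move=> a0 nu0 e0.
pose F (x y : R) := expR (- (e * x)) * (expR (- (a * y `^ nu)) *
  (cos (y * x + b * y `^ nu) * cos (g * x + c)
   + cos (y * - x + b * y `^ nu) * cos (g * - x + c))).
have iD x := @integrable_density_integrand R a b nu x a0 nu0.
have LE x : expR (- (e * x)) * (stable_density a b nu x * cos (g * x + c)
                         + stable_density a b nu (- x) * cos (g * - x + c))
   = pi^-1 * \int[@lebesgue_measure R]_(y in `[0, +oo[) F x y.
  rewrite /stable_density.
  have -> : \int[@lebesgue_measure R]_(y in `[0, +oo[) F x y
    = expR (- (e * x)) * (cos (g * x + c) * \int[@lebesgue_measure R]_(y in `[0, +oo[)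
        (expR (- (a * y `^ nu)) * cos (y * x + b * y `^ nu))
      + cos (g * - x + c) * \int[@lebesgue_measure R]_(y in `[0, +oo[)
        (expR (- (a * y `^ nu)) * cos (y * - x + b * y `^ nu))).
    rewrite -Rintegral_comb//.
    by apply: eq_Rintegral => y _; rewrite /F; ring.
  ring.
under eq_Rintegral do rewrite LE.
have mF : measurable_fun setT (fun z : R * R => F z.1 z.2).
  have m1 : measurable_fun setT (fun z : R * R => z.1) by exact: measurable_fst.
  have m2 : measurable_fun setT (fun z : R * R => z.2) by exact: measurable_snd.
  have mp : measurable_fun setT (fun z : R * R => z.2 `^ nu).
    exact: (measurableT_comp (@measurable_powR R nu)).
  apply: measurable_funM.
    by apply: measurableT_comp => //; apply: measurableT_comp => //; exact: measurable_funM.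
  apply: measurable_funM.
    by apply: measurableT_comp => //; apply: measurableT_comp => //; exact: measurable_funM.
  apply: measurable_funD; apply: measurable_funM.
  - apply: (measurableT_comp (@measurable_cos R)); apply: measurable_funD; exact: measurable_funM.
  - apply: (measurableT_comp (@measurable_cos R)); apply: measurable_funD => //; exact: measurable_funM.
  - apply: (measurableT_comp (@measurable_cos R)); apply: measurable_funD; last exact: measurable_funM.
    by apply: measurable_funM => //; exact: measurableT_comp.
  - apply: (measurableT_comp (@measurable_cos R)); apply: measurable_funD => //.
    by apply: measurable_funM => //; exact: measurableT_comp.
have Fb x y : `|F x y| <= expR (- (e * x)) * (2 * expR (- (a * y `^ nu))).
  rewrite /F normrM ger0_norm ?expR_ge0// ler_wpM2l ?expR_ge0//.
  rewrite normrM ger0_norm ?expR_ge0// mulrC ler_wpM2r ?expR_ge0//.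
  rewrite (le_trans (ler_normD _ _))// !normrM.
  by rewrite [2]/(1 + 1) lerD// mulr_ile1// ?cos_max.
have iE2 : (@lebesgue_measure R).-integrable `[0, +oo[
    (EFin \o (fun y => 2 * expR (- (a * y `^ nu)))).
  by apply: integrable_scale => //; exact: integrable0y_expR_powR.
have [iF swF] := @Rintegral_swap _ _ _ _ _ (@lebesgue_measure R) (@lebesgue_measure R)
  `[0, +oo[%classic `[0, +oo[%classic F (fun x => expR (- (e * x)))
  (fun y => 2 * expR (- (a * y `^ nu)))
  (measurable_itv _) (measurable_itv _) mF (integrable0y_expRN e0)
  iE2
  (fun x y _ _ => Fb x y).
rewrite RintegralZl// swF; congr (_ * _).
clear iF swF mF Fb iD iE2 LE.
have mT : measurable_fun setT (stable_transform a b nu c).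
  by apply: continuous_measurable_fun; exact: continuous_stable_transform.
have T1 x := stable_transform_le1 b nu c x a0.
rewrite RintegralT_fold; last exact: integrable_cauchy_kernelM.
apply: eq_Rintegral => y; rewrite inE/= in_itv/= andbT => y0.
pose q := b * y `^ nu.
have iE k := integrable_expRN_cos k 0 e0.
(* The frequencies g - y and g + y give the kernel centred at g, evaluated at y and at - y: these
   are the two halves of the folded right-hand side. *)
have -> : \int[@lebesgue_measure R]_(x in `[0, +oo[) F x y
   = expR (- (a * y `^ nu)) *
     (cos (c + q) * \int[@lebesgue_measure R]_(x in `[0, +oo[) (expR (- (e * x)) * cos ((g + y) * x + 0))
     + cos (c - q) * \int[@lebesgue_measure R]_(x in `[0, +oo[) (expR (- (e * x)) * cos ((g - y) * x + 0))).
  rewrite -Rintegral_comb//.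
  by apply: eq_Rintegral => x _; rewrite /F -/q !addr0 !mulrN mulrDl mulrBl cosM_fold; ring.
rewrite !Rintegral_expR_cos// cos0 sin0 !mulr1 !mulr0 !subr0.
rewrite /stable_transform normrN sgrN (ger0_norm y0).
have qE : b * (Num.sg y * y `^ nu) = q.
  rewrite /q; move: y0; rewrite le_eqVlt => /predU1P[<-|y0]; last by rewrite gtr0_sg// mul1r.
  by rewrite sgr0 mul0r powR0 ?gt_eqF.
rewrite qE mulNr mulrN qE opprK.
rewrite -(sqrrN (g + y)) opprD addrC [- g - y]addrC.
by rewrite -(sqrrN (g - y)) opprB; ring.
Qed.

(** As [harmonic n] decreases to 0 the weights increase to 1, so monotone convergence carries the
    bound [C] from the Abel means to the integral of [f]. *)
Lemma integrable_ge0_bounded_abel (R : realType) (f : R -> R) (C : R) :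
  measurable_fun setT f -> (forall x, 0 <= f x) ->
  (forall n, (@lebesgue_measure R).-integrable `[0, +oo[
     (EFin \o (fun x => expR (- (harmonic n * x)) * f x))) ->
  (forall n, \int[@lebesgue_measure R]_(x in `[0, +oo[)
     (expR (- (harmonic n * x)) * f x) <= C) ->
  (@lebesgue_measure R).-integrable `[0, +oo[ (EFin \o f).
Proof.
move=> mf f0 fi fC.
have mE n : measurable_fun setT (fun x : R => expR (- (harmonic n * x)) * f x).
  apply: measurable_funM => //; apply: measurableT_comp => //.
  by apply: measurableT_comp => //; exact: measurable_funM.
apply/integrableP; split; first exact/measurable_EFinP/measurable_funTS.
have -> : (\int[@lebesgue_measure R]_(x in `[0%R, +oo[) `|(EFin \o f) x|
  = \int[@lebesgue_measure R]_(x in `[0%R, +oo[)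
     limn (fun n => (expR (- (harmonic n * x)) * f x)%:E))%E.
  apply: eq_integral => x _; rewrite /= ger0_norm//; apply/esym/cvg_lim => //.
  apply: cvg_EFin; first exact: nearW.
  rewrite -[X in _ --> X]mul1r; apply: cvgM; last exact: cvg_cst.
  exact: cvg_expRN_harmonic.
apply: (@le_lt_trans _ _ C%:E); last exact: ltry.
have := @cvg_monotone_convergence _ _ _ (@lebesgue_measure R) _ (measurable_itv `[0, +oo[)
  (fun n x => (expR (- (harmonic n * x)) * f x)%:E).
move=> /(_ _ _ _)/cvg_lim <-//.
- apply: lime_le; last first.
    apply: nearW => n; have := fC n.
    have : (\int[@lebesgue_measure R]_(x in `[0%R, +oo[)
        (expR (- (harmonic n * x)) * f x)%:E)%E \is a fin_num.
      exact: integrable_fin_num (fi n).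
    by rewrite /Rintegral -lee_fin => /fineK ->.
  apply: (@ereal_nondecreasing_is_cvgn) => n m nm.
  apply: ge0_le_integral => //.
  + by move=> x _; rewrite lee_fin mulr_ge0 ?expR_ge0.
  + by apply/measurable_EFinP; apply: measurable_funTS; exact: mE.
  + by apply/measurable_EFinP; apply: measurable_funTS; exact: mE.
  + move=> x; rewrite /= in_itv/= andbT => x0; rewrite lee_fin ler_wpM2r// ler_expR lerN2.
    by rewrite ler_wpM2r// lef_pV2 ?posrE// ler_nat.
- by move=> n; apply/measurable_EFinP; apply: measurable_funTS; exact: mE.
- by move=> n x _; rewrite lee_fin mulr_ge0 ?expR_ge0.
- move=> x; rewrite /= in_itv/= andbT => x0 n m nm; rewrite lee_fin ler_wpM2r// ler_expR lerN2.
  by rewrite ler_wpM2r// lef_pV2 ?posrE// ler_nat.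
Qed.

Lemma stable_density_bounded (R : realType) (a b nu : R) : 0 < a -> 0 < nu ->
  exists C, forall x, `|stable_density a b nu x| <= C.
Proof.
move=> a0 nu0.
exists (pi^-1 * \int[@lebesgue_measure R]_(g in `[0, +oo[) expR (- (a * g `^ nu))) => x.
rewrite normrM ger0_norm ?invr_ge0 ?pi_ge0// ler_wpM2l ?invr_ge0 ?pi_ge0//.
apply: (le_trans (le_normr_Rintegral _ (integrable_density_integrand b x a0 nu0))) => //.
apply: le_Rintegral => //.
- by apply: integrable_norm; exact: integrable_density_integrand.
- exact: integrable0y_expR_powR.
- by move=> g _; rewrite normrM ger0_norm ?expR_ge0// ler_piMr ?expR_ge0// cos_max.
Qed.

(** At frequency zero the Abel mean of W(x) + W(-x) is the average of a transform bounded by 1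
    against a kernel of mass pi, divided by pi; hence it is at most 1, and nonnegativity turns this
    bound into integrability. *)
Lemma integrable_stable_density_ge0 (R : realType) (a b nu : R) : 0 < a -> 0 < nu ->
  (forall x, 0 <= stable_density a b nu x) ->
  (@lebesgue_measure R).-integrable setT (EFin \o stable_density a b nu).
Proof.
move=> a0 nu0 W0; set W := stable_density a b nu.
have mW : measurable_fun setT W by exact: measurable_stable_density.
have mWN : measurable_fun setT (fun x : R => W (- x)) by exact: (measurableT_comp mW).
have mT : measurable_fun setT (stable_transform a b nu 0).
  by apply: continuous_measurable_fun; exact: continuous_stable_transform.
have [C WC] := stable_density_bounded b a0 nu0.
pose f (x : R) := W x + W (- x).
have fi : (@lebesgue_measure R).-integrable `[0, +oo[ (EFin \o f).
  apply: (@integrable_ge0_bounded_abel _ _ 1).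
  - exact: measurable_funD.
  - by move=> x; rewrite addr_ge0// W0.
  - move=> n; apply: (@le_integrable_EFin _ _ _ (@lebesgue_measure R) _ _
      (fun x => (C + C) * expR (- (harmonic n * x)))) => //.
    + apply: measurable_funTS; apply: measurable_funM; last exact: measurable_funD.
      by apply: measurableT_comp => //; apply: measurableT_comp => //; exact: measurable_funM.
    + by apply: integrable_scale => //; exact: integrable0y_expRN (harmonic_gt0 _).
    + move=> x _; rewrite normrM ger0_norm ?expR_ge0// mulrC ler_wpM2r ?expR_ge0//.
      by rewrite (le_trans (ler_normD _ _))// lerD// WC.
  - move=> n; have := @abel_mean_stable_density _ a b nu 0 (harmonic n) 0 a0 nu0 (harmonic_gt0 _).
    under eq_Rintegral do rewrite !mul0r addr0 cos0 !mulr1.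
    move=> ->; rewrite ler_pdivrMl ?pi_gt0// mulr1.
    rewrite Rintegral_cauchy_kernel ?harmonic_gt0//; last 2 first.
    + exact: continuous_stable_transform.
    + by move=> x; exact: stable_transform_le1.
    rewrite -[leRHS]RintegralT_oneDsqrV; apply: le_Rintegral => //.
    + apply: le_integrable_EFin (@integrableT_oneDsqrV R) _ => //.
        apply: measurable_funM.
          by apply: continuous_measurable_fun; exact: continuous_oneDsqrV.
        apply: (measurableT_comp mT); exact: measurable_funD.
      move=> x _; have V0 : 0 <= (1 + x ^+ 2)^-1 by rewrite invr_ge0 addr_ge0 ?sqr_ge0.
      by rewrite normrM (ger0_norm V0) ler_piMr// stable_transform_le1.
    + exact: integrableT_oneDsqrV.
    + move=> x _; have V0 : 0 <= (1 + x ^+ 2)^-1 by rewrite invr_ge0 addr_ge0 ?sqr_ge0.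
      by rewrite ler_piMr// (le_trans (ler_norm _))// stable_transform_le1.
apply/integrableP; split; first exact/measurable_EFinP.
rewrite ge0_integralT_fold//; last by apply: measurableT_comp => //; exact/measurable_EFinP.
have /integrableP[_] := fi; apply: le_lt_trans.
rewrite le_eqVlt; apply/orP; left; apply/eqP; apply: eq_integral => x _.
by rewrite /= !ger0_norm ?addr_ge0 ?W0.
Qed.

(** The Abel means have two limits that must agree: the integral itself, by dominated convergence,
    and the value of the continuous transform at [g], because the Cauchy kernels concentrate
    there. *)
Lemma Rintegral_stable_density_cos (R : realType) (a b nu c g : R) : 0 < a -> 0 < nu ->
  (@lebesgue_measure R).-integrable setT (EFin \o stable_density a b nu) ->
  \int[@lebesgue_measure R]_x (stable_density a b nu x * cos (g * x + c))
  = stable_transform a b nu c g.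
Proof.
move=> a0 nu0 iW; set W := stable_density a b nu.
have mW : measurable_fun setT W by exact: measurable_stable_density.
pose f (x : R) := W x * cos (g * x + c).
have mf : measurable_fun setT f.
  apply: measurable_funM => //; apply: (measurableT_comp (@measurable_cos R)).
  by apply: measurable_funD => //; exact: measurable_funM.
have iF : (@lebesgue_measure R).-integrable setT (EFin \o f).
  have iN : (@lebesgue_measure R).-integrable setT (EFin \o (fun x => `|W x|)).
    exact: integrable_norm.
  apply: le_integrable_EFin iN _ => //.
  by move=> x _; rewrite normrM ler_piMr// cos_max.
have [i1 i2] := integrable_half iF.
have iff : (@lebesgue_measure R).-integrable `[0, +oo[ (EFin \o (fun x => f x + f (- x))).
  exact: integrable_add.
have miff : measurable_fun `[(0 : R), +oo[%classic (fun x => f x + f (- x)).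
  by apply/measurable_EFinP; exact: measurable_int iff.
rewrite RintegralT_fold//.
pose J n := \int[@lebesgue_measure R]_(x in `[0, +oo[)
   (expR (- (harmonic n * x)) * (f x + f (- x))).
have J1 : J n @[n --> \oo] --> \int[@lebesgue_measure R]_(x in `[0, +oo[) (f x + f (- x)).
  apply: (@dominated_convergence_Rintegral _ _ _ (@lebesgue_measure R) `[0, +oo[%classic
    (fun n x => expR (- (harmonic n * x)) * (f x + f (- x)))
    (fun x => f x + f (- x)) (fun x => `|f x + f (- x)|) _ _ _ _ _).2 => //.
  - move=> n; apply: measurable_funM => //; apply: measurable_funTS.
    by apply: measurableT_comp => //; apply: measurableT_comp => //; exact: measurable_funM.
  - move=> x _; rewrite -[X in _ --> X]mul1r; apply: cvgM; last exact: cvg_cst.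
    exact: cvg_expRN_harmonic.
  - exact: integrable_norm.
  - move=> n x; rewrite /= in_itv/= andbT => x0; rewrite normrM ger0_norm ?expR_ge0//.
    by rewrite ler_piMl// expR_le1 oppr_le0 mulr_ge0// ltW// harmonic_gt0.
have J2 : J n @[n --> \oo] --> stable_transform a b nu c g.
  rewrite (_ : J = (fun n => pi^-1 * \int[@lebesgue_measure R]_x
      (harmonic n / (harmonic n ^+ 2 + (x - g) ^+ 2) * stable_transform a b nu c x))); last first.
    by apply/funext => n; rewrite -abel_mean_stable_density ?harmonic_gt0.
  rewrite -[X in _ --> X](mulKf (lt0r_neq0 (pi_gt0 R))).
  apply: cvgM; first exact: cvg_cst.
  apply: cvg_cauchy_kernel; first exact: continuous_stable_transform.
  by move=> x; exact: stable_transform_le1.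
exact: (cvg_unique _ J1 J2).
Qed.

(** * Complex exponential *)

Lemma Re_mulc (R : rcfType) (z w : R[i]) :
  complex.Re (z * w) = complex.Re z * complex.Re w - complex.Im z * complex.Im w.
Proof. by case: z w => [a b] [c d]. Qed.

Lemma Im_mulc (R : rcfType) (z w : R[i]) :
  complex.Im (z * w) = complex.Re z * complex.Im w + complex.Im z * complex.Re w.
Proof. by case: z w => [a b] [c d]. Qed.

Lemma Re_addc (R : rcfType) (z w : R[i]) :
  complex.Re (z + w) = complex.Re z + complex.Re w.
Proof. by case: z w => [a b] [c d]. Qed.

Lemma Im_addc (R : rcfType) (z w : R[i]) :
  complex.Im (z + w) = complex.Im z + complex.Im w.
Proof. by case: z w => [a b] [c d]. Qed.

Lemma Re_oppc (R : rcfType) (z : R[i]) : complex.Re (- z) = - complex.Re z.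
Proof. by case: z. Qed.

Lemma Im_oppc (R : rcfType) (z : R[i]) : complex.Im (- z) = - complex.Im z.
Proof. by case: z. Qed.

Definition cexpi (R : realType) (x : R) : R[i] := cos x +i* sin x.

Lemma cexpiD (R : realType) (x y : R) : cexpi (x + y) = cexpi x * cexpi y.
Proof.
apply/eqP; rewrite eq_complex Re_mulc Im_mulc /= cosD sinD eqxx/=; apply/eqP.
by rewrite addrC.
Qed.

Lemma cexpE (R : realType) (z : R[i]) :
  cexp z = (expR (complex.Re z))%:C * cexpi (complex.Im z).
Proof. by []. Qed.

Lemma cexpD (R : realType) (z w : R[i]) : cexp (z + w) = cexp z * cexp w.
Proof. by rewrite !cexpE Re_addc Im_addc expRD cexpiD rmorphM/= mulrACA. Qed.

Lemma cexp_real (R : realType) (x : R) : cexp x%:C = (expR x)%:C.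
Proof. by apply/eqP; rewrite eq_complex cexpE Re_mulc Im_mulc /= sin0 cos0 !mulr0 mul0r subr0 addr0 mulr1 !eqxx. Qed.

Lemma cexp0 (R : realType) : cexp (0 : R[i]) = 1.
Proof. by have := @cexp_real R 0; rewrite expR0. Qed.

Lemma cexpMn (R : realType) (z : R[i]) n : cexp (n%:R * z) = cexp z ^+ n.
Proof.
elim: n => [|n IH]; first by rewrite mul0r cexp0.
by rewrite -natr1 mulrDl mul1r cexpD IH exprSr.
Qed.


Lemma ler_Re_normc (R : rcfType) (z : R[i]) : `|complex.Re z| <= Normc.normc z.
Proof. by case: z => a b /=; rewrite -sqrtr_sqr ler_sqrt ?lerDl ?sqr_ge0// addr_ge0 ?sqr_ge0. Qed.

Lemma ler_Im_normc (R : rcfType) (z : R[i]) : `|complex.Im z| <= Normc.normc z.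
Proof. by case: z => a b /=; rewrite -sqrtr_sqr ler_sqrt ?lerDr ?sqr_ge0// addr_ge0 ?sqr_ge0. Qed.

Lemma normc_ge0 (R : rcfType) (z : R[i]) : 0 <= Normc.normc z.
Proof. by case: z => a b /=; exact: sqrtr_ge0. Qed.

Lemma ler_normcD (R : rcfType) (z w : R[i]) :
  Normc.normc (z + w) <= Normc.normc z + Normc.normc w.
Proof. exact: le_normcD. Qed.

Lemma ler_normc_ReIm (R : rcfType) (z : R[i]) :
  Normc.normc z <= `|complex.Re z| + `|complex.Im z|.
Proof.
case: z => a b /=; rewrite -[leRHS]ger0_norm ?addr_ge0// -[leRHS]sqrtr_sqr ler_sqrt ?sqr_ge0//.
by rewrite sqrrD !real_normK ?num_real// lerD2r lerDl mulrn_wge0// mulr_ge0.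
Qed.

Lemma normc_real (R : rcfType) (x : R) : Normc.normc x%:C = `|x|.
Proof. by rewrite /= expr0n addr0 sqrtr_sqr. Qed.

Lemma normcX (R : rcfType) (z : R[i]) n : Normc.normc (z ^+ n) = Normc.normc z ^+ n.
Proof.
elim: n => [|n IH]; first by rewrite Normc.normc1.
by rewrite !exprS Normc.normcM IH.
Qed.

Lemma normc_cexpi (R : realType) (x : R) : Normc.normc (cexpi x) = 1.
Proof. by rewrite /= cos2Dsin2 sqrtr1. Qed.

Lemma normc_cexp (R : realType) (z : R[i]) : Normc.normc (cexp z) = expR (complex.Re z).
Proof. by rewrite cexpE Normc.normcM normc_cexpi normc_real mulr1 ger0_norm ?expR_ge0. Qed.

Definition cvgc (R : realType) (u : nat -> R[i]) (l : R[i]) : Prop :=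
  complex.Re (u n) @[n --> \oo] --> complex.Re l /\
  complex.Im (u n) @[n --> \oo] --> complex.Im l.

Lemma cvgc_cst (R : realType) (l : R[i]) : cvgc (fun=> l) l.
Proof. by split; exact: cvg_cst. Qed.

Lemma cvgcD (R : realType) (u v : nat -> R[i]) (k l : R[i]) :
  cvgc u k -> cvgc v l -> cvgc (fun n => u n + v n) (k + l).
Proof.
move=> [u1 u2] [v1 v2]; split.
  by under eq_fun do rewrite Re_addc; rewrite Re_addc; exact: cvgD.
by under eq_fun do rewrite Im_addc; rewrite Im_addc; exact: cvgD.
Qed.

Lemma cvgcN (R : realType) (u : nat -> R[i]) (k : R[i]) :
  cvgc u k -> cvgc (fun n => - u n) (- k).
Proof.
move=> [u1 u2]; split.
  by under eq_fun do rewrite Re_oppc; rewrite Re_oppc; exact: cvgN.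
by under eq_fun do rewrite Im_oppc; rewrite Im_oppc; exact: cvgN.
Qed.

Lemma cvgcM (R : realType) (u v : nat -> R[i]) (k l : R[i]) :
  cvgc u k -> cvgc v l -> cvgc (fun n => u n * v n) (k * l).
Proof.
move=> [u1 u2] [v1 v2]; split.
  by under eq_fun do rewrite Re_mulc; rewrite Re_mulc; apply: cvgB; exact: cvgM.
by under eq_fun do rewrite Im_mulc; rewrite Im_mulc; apply: cvgD; exact: cvgM.
Qed.

Lemma cvgc_real (R : realType) (u : nat -> R) (l : R) :
  u n @[n --> \oo] --> l -> cvgc (fun n => (u n)%:C) l%:C.
Proof. by move=> ul; split => //=; exact: cvg_cst. Qed.

Lemma cvgc_cexp (R : realType) (u : nat -> R[i]) (l : R[i]) :
  cvgc u l -> cvgc (fun n => cexp (u n)) (cexp l).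
Proof.
move=> [ur ui]; apply: cvgcM.
  by apply: cvgc_real; apply: continuous_cvg => //; exact: continuous_expR.
split => /=; apply: continuous_cvg => //; [exact: continuous_cos|exact: continuous_sin].
Qed.

Lemma cvgc_normc (R : realType) (u : nat -> R[i]) (l : R[i]) :
  cvgc u l -> Normc.normc (u n) @[n --> \oo] --> Normc.normc l.
Proof.
move=> [ur ui].
have E z : Normc.normc z = Num.sqrt (complex.Re z ^+ 2 + complex.Im z ^+ 2) by case: z.
under eq_fun do rewrite E.
rewrite E; apply: continuous_cvg; first exact: sqrt_continuous.
by apply: cvgD; [exact: (cvgM ur ur)|exact: (cvgM ui ui)].
Qed.

Lemma cvgc_normc0 (R : realType) (u : nat -> R[i]) (l : R[i]) :
  Normc.normc (u n - l) @[n --> \oo] --> 0 -> cvgc u l.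
Proof.
move=> H; split.
  apply/subr_cvg0/norm_cvg0P.
  apply: (@squeeze_cvgr _ _ _ _ (cst 0) (fun n => Normc.normc (u n - l))) => //; last exact: cvg_cst.
  by near=> n; rewrite /cst normr_ge0/= -Re_oppc -Re_addc ler_Re_normc.
apply/subr_cvg0/norm_cvg0P.
apply: (@squeeze_cvgr _ _ _ _ (cst 0) (fun n => Normc.normc (u n - l))) => //; last exact: cvg_cst.
by near=> n; rewrite /cst normr_ge0/= -Im_oppc -Im_addc ler_Im_normc.
Unshelve. all: by end_near. Qed.

(** Once a - b is factored out, each of the n + 1 terms of the cofactor has modulus at most M^n. *)
Lemma normc_subrX (R : rcfType) (a b : R[i]) (M : R) n :
  0 <= M -> Normc.normc a <= M -> Normc.normc b <= M ->
  Normc.normc (a ^+ n.+1 - b ^+ n.+1) <= n.+1%:R * M ^+ n * Normc.normc (a - b).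
Proof.
move=> M0 aM bM; rewrite subrXX Normc.normcM mulrC ler_wpM2r ?normc_ge0//.
(* The subtraction [n - i] is truncated, so the bound on partial sums is meant for k <= n + 1 only;
   the disjunction carries this range through the induction. *)
have : forall k, Normc.normc (\sum_(i < k) a ^+ (n - i) * b ^+ i) <= k%:R * M ^+ n
  \/ (n.+1 < k)%N.
  elim=> [|k [IH|IH]]; [left|idtac|right]; last by rewrite ltnS ltnW.
    by rewrite big_ord0 Normc.normc0 mul0r.
  have [kn|kn] := leqP k n; last by right.
  left; rewrite big_ord_recr/= -natr1 mulrDl mul1r (le_trans (ler_normcD _ _))//.
  rewrite lerD// Normc.normcM !normcX -[in leRHS](subnK kn) exprD.
  by rewrite ler_pM ?exprn_ge0 ?normc_ge0 ?lerXn2r ?nnegrE ?normc_ge0.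
by move=> /(_ n.+1)[|]; rewrite ?ltnn// subSS.
Qed.

Lemma cvg_derive_harmonic (R : realType) (f : R -> R) (d : R) :
  is_derive (0 : R) (1 : R) f d ->
  n.+1%:R * (f n.+1%:R^-1 - f 0) @[n --> \oo] --> d.
Proof.
move=> [df <-]; have := df; rewrite /derivable => /cvg_ex[l Hl].
have -> : 'D_1 f 0 = l by exact: cvg_lim.
have H0 : (harmonic n : R) @[n --> \oo] --> (0 : R)^'.
  move=> A [e e0 eA].
  have : (harmonic n : R) @[n --> \oo] --> (0 : R) by exact: cvg_harmonic.
  move=> /cvgr0_norm_lt/(_ e e0); apply: filterS => n ne.
  apply: eA => /=; first by rewrite sub0r normrN.
  by rewrite gt_eqF// harmonic_gt0.
have := cvg_comp _ _ H0 Hl; apply: cvg_trans; apply: near_eq_cvg.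
by near=> n; rewrite /= /GRing.scale/= mulr1 addr0 invrK.
Unshelve. all: by end_near. Qed.

(** Both sides are (n+1)-th powers, since cexp w is the power of cexp (w / (n+1)). The telescoping
    bound with M = exp(|w| / (n+1)) costs at most a factor e^|w| and leaves n + 1 times the distance
    of the bases. That tends to 0 because e^(t w) - 1 - t w has derivative 0 at t = 0. *)
Lemma cvgc_exp_limit (R : realType) (w : R[i]) :
  cvgc (fun n => (1 + (n.+1%:R^-1)%:C * w) ^+ n.+1) (cexp w).
Proof.
apply: cvgc_normc0.
set u := complex.Re w; set v := complex.Im w; set k := Normc.normc w.
have k0 : 0 <= k by exact: normc_ge0.
pose d n := Normc.normc ((1 + (n.+1%:R^-1)%:C * w) - cexp ((n.+1%:R^-1)%:C * w)).
have dle n : Normc.normc ((1 + (n.+1%:R^-1)%:C * w) ^+ n.+1 - cexp w)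
    <= expR k * (n.+1%:R * d n).
  have wE : cexp w = cexp ((n.+1%:R^-1)%:C * w) ^+ n.+1.
    rewrite -cexpMn mulrA -[n.+1%:R]/(_%:R) -(rmorph_nat (real_complex R)) -rmorphM/= mulfV ?pnatr_eq0//.
    by rewrite rmorph1 mul1r.
  rewrite wE (le_trans (@normc_subrX _ _ _ (expR (n.+1%:R^-1 * k)) _ _ _ _)) ?expR_ge0//.
  - rewrite (le_trans (ler_normcD _ _))// Normc.normc1 Normc.normcM normc_real.
    by rewrite ger0_norm ?invr_ge0// expR_ge1Dx.
  - rewrite normc_cexp Re_mulc/= mul0r subr0 ler_expR ler_wpM2l ?invr_ge0//.
    by rewrite (le_trans (ler_norm _))// ler_Re_normc.
  rewrite -/(d n) [leRHS]mulrCA -mulrA ler_wpM2l ?ler0n// ler_wpM2r ?normc_ge0//.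
  rewrite -expRM_natl mulrA ler_expR -[leRHS]mul1r ler_wpM2r//.
  by rewrite ler_pdivrMr ?mul1r ?ler_nat.
have d1 : n.+1%:R * d n @[n --> \oo] --> 0.
  have E1 : n.+1%:R * (expR (u * n.+1%:R^-1) * cos (v * n.+1%:R^-1) - 1 - u * n.+1%:R^-1) @[n --> \oo] --> 0.
    pose f (x : R) := expR (u * x) * cos (v * x) - u * x.
    have df : is_derive (0 : R) (1 : R) f 0.
      rewrite /f; apply: is_derive_eq; rewrite /GRing.scale/= !mulr0 expR0 cos0 sin0; ring.
    have := cvg_derive_harmonic df; rewrite /f !mulr0 expR0 cos0 subr0 mulr1.
    by apply: cvg_trans; apply: near_eq_cvg; near=> n; ring.
  have E2 : n.+1%:R * (expR (u * n.+1%:R^-1) * sin (v * n.+1%:R^-1) - v * n.+1%:R^-1) @[n --> \oo] --> 0.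
    pose f (x : R) := expR (u * x) * sin (v * x) - v * x.
    have df : is_derive (0 : R) (1 : R) f 0.
      rewrite /f; apply: is_derive_eq; rewrite /GRing.scale/= !mulr0 expR0 cos0 sin0; ring.
    have := cvg_derive_harmonic df; rewrite /f !mulr0 expR0 sin0 subr0 mulr0.
    by apply: cvg_trans; apply: near_eq_cvg; near=> n; ring.
  apply: (@squeeze_cvgr _ _ _ _ (cst 0) (fun n =>
     `|n.+1%:R * (expR (u * n.+1%:R^-1) * cos (v * n.+1%:R^-1) - 1 - u * n.+1%:R^-1)|
   + `|n.+1%:R * (expR (u * n.+1%:R^-1) * sin (v * n.+1%:R^-1) - v * n.+1%:R^-1)|)).
  - near=> n; rewrite /cst mulr_ge0 ?normc_ge0//= !normrM -mulrDr (ger0_norm (ler0n _ _)) ler_wpM2l ?ler0n//.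
    rewrite (le_trans (ler_normc_ReIm _))// cexpE Re_addc Im_addc Re_oppc Im_oppc !Re_mulc !Im_mulc/=.
    rewrite [complex.Re (1 + _)]Re_addc [complex.Im (1 + _)]Im_addc !Re_mulc !Im_mulc /= -/u -/v.
    rewrite !mul0r subr0 addr0 add0r !(mulrC n.+1%:R^-1).
    rewrite subr0 addr0 lerD//; first by rewrite distrC opprD addrA.
    by rewrite distrC.
  - exact: cvg_cst.
  - rewrite -[X in _ --> X](addr0 (0 : R)); apply: cvgD.
      by rewrite -(@normr0 _ R); apply: cvg_norm.
    by rewrite -(@normr0 _ R); apply: cvg_norm.
apply: (@squeeze_cvgr _ _ _ _ (cst 0) (fun n => expR k * (n.+1%:R * d n))).
- by near=> n; rewrite /cst normc_ge0/=.
- exact: cvg_cst.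
- by rewrite -[X in _ --> X](mulr0 (expR k)); apply: cvgM => //; exact: cvg_cst.
Unshelve. all: by end_near. Qed.

(** * Positivity-preserving multipliers *)

(** These conditions make every integrand of [abel_transform] integrable, and they are preserved by
    sums and products. *)
Definition admissible (R : realType) (phi : R -> R[i]) : Prop :=
  [/\ measurable_fun setT (fun g => complex.Re (phi g)),
      measurable_fun setT (fun g => complex.Im (phi g)) &
      exists K, forall g, Normc.normc (phi g) <= K].

(* [e / (e^2 + x^2)] smoothed inverse transform of [phi], restricted to [g >= 0]:
   for the transform of a real function the other half contributes the same. *)
Definition abel_transform (R : realType) (phi : R -> R[i]) (e y : R) : R :=
  \int[@lebesgue_measure R]_(g in `[0, +oo[)
    (expR (- (e * g)) * complex.Re (phi g * cexpi (- (g * y)))).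

Definition transform_ge0 (R : realType) (phi : R -> R[i]) : Prop :=
  forall e y, 0 < e -> 0 <= abel_transform phi e y.

(* A substitute for "characteristic function of a finite measure" that needs no measure:
   multiplication by [m] preserves nonnegativity of the inverse transform. *)
Definition pos_multiplier (R : realType) (m : R -> R[i]) : Prop :=
  [/\ admissible m, complex.Im (m 0) = 0,
      forall g, Normc.normc (m g) <= complex.Re (m 0) &
      forall phi, admissible phi -> transform_ge0 phi ->
        transform_ge0 (fun g => m g * phi g)].

Lemma admissible_cexpi (R : realType) (b : R) : admissible (fun g : R => cexpi (g * b)).
Proof.
have mb : measurable_fun setT (fun g : R => g * b) by exact: measurable_funM.
split.
- exact: (measurableT_comp (@measurable_cos R)).
- apply: (@measurableT_comp _ _ _ _ _ _ sin) => //.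
  by apply: continuous_measurable_fun; exact: continuous_sin.
- by exists 1 => g; rewrite normc_cexpi.
Qed.

Lemma admissible_cst (R : realType) (z : R[i]) : admissible (fun=> z).
Proof. by split; [exact: measurable_cst|exact: measurable_cst|exists (Normc.normc z)]. Qed.

Lemma admissibleM (R : realType) (f g : R -> R[i]) :
  admissible f -> admissible g -> admissible (fun x => f x * g x).
Proof.
move=> [f1 f2 [K fK]] [g1 g2 [L gL]]; split.
- under eq_fun do rewrite Re_mulc.
  by apply: measurable_funB; exact: measurable_funM.
- under eq_fun do rewrite Im_mulc.
  by apply: measurable_funD; exact: measurable_funM.
- by exists (K * L) => x; rewrite Normc.normcM ler_pM ?normc_ge0.
Qed.

Lemma admissibleD (R : realType) (f g : R -> R[i]) :
  admissible f -> admissible g -> admissible (fun x => f x + g x).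
Proof.
move=> [f1 f2 [K fK]] [g1 g2 [L gL]]; split.
- by under eq_fun do rewrite Re_addc; exact: measurable_funD.
- by under eq_fun do rewrite Im_addc; exact: measurable_funD.
- by exists (K + L) => x; rewrite (le_trans (ler_normcD _ _))// lerD.
Qed.

Lemma measurable_abel_integrand (R : realType) (phi : R -> R[i]) (e y : R) :
  admissible phi ->
  measurable_fun setT (fun g => expR (- (e * g)) * complex.Re (phi g * cexpi (- (g * y)))).
Proof.
move=> aphi; apply: measurable_funM.
  by apply: measurableT_comp => //; apply: measurableT_comp => //; exact: measurable_funM.
have := admissibleM aphi (admissible_cexpi (- y)).
by under eq_fun do rewrite mulrN; case.
Qed.

Lemma integrable_abel_integrand (R : realType) (phi : R -> R[i]) (e y : R) :
  admissible phi -> 0 < e ->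
  (@lebesgue_measure R).-integrable `[0, +oo[
    (EFin \o (fun g => expR (- (e * g)) * complex.Re (phi g * cexpi (- (g * y))))).
Proof.
move=> aphi e0; have [_ _ [K phiK]] := aphi.
apply: (@le_integrable_EFin _ _ _ (@lebesgue_measure R) _ _ (fun g => K * expR (- (e * g)))) => //.
- by apply: measurable_funTS; exact: measurable_abel_integrand.
- by apply: integrable_scale => //; exact: integrable0y_expRN.
- move=> g _; rewrite normrM ger0_norm ?expR_ge0// mulrC ler_wpM2r ?expR_ge0//.
  by rewrite (le_trans (ler_Re_normc _))// Normc.normcM normc_cexpi mulr1.
Qed.

(** Multiplication by e^(i g b) translates the smoothed inverse transform by b, and [s] rescales
    it. *)
Lemma pos_multiplier_cexpi (R : realType) (s b : R) : 0 <= s ->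
  pos_multiplier (fun g : R => s%:C * cexpi (g * b)).
Proof.
move=> s0; split.
- exact: admissibleM (admissible_cst _) (admissible_cexpi _).
- by rewrite mul0r Im_mulc /= sin0 mulr0 mul0r addr0.
- move=> g; rewrite Normc.normcM normc_cexpi mulr1 normc_real ger0_norm//.
  by rewrite mul0r Re_mulc /= cos0 sin0 mulr0 subr0 mulr1.
move=> phi aphi phi0 e y e0.
have -> : abel_transform (fun g => s%:C * cexpi (g * b) * phi g) e y
    = s * abel_transform phi e (y - b).
  rewrite /abel_transform -RintegralZl//; last exact: integrable_abel_integrand.
  apply: eq_Rintegral => g _.
  have -> : - (g * (y - b)) = g * b + - (g * y) by ring.
  rewrite cexpiD [phi g * (_ * _)]mulrCA -!mulrA Re_mulc /=.
  by ring.
by rewrite mulr_ge0//; exact: phi0.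
Qed.

Lemma pos_multiplierM (R : realType) (m1 m2 : R -> R[i]) :
  pos_multiplier m1 -> pos_multiplier m2 -> pos_multiplier (fun g => m1 g * m2 g).
Proof.
move=> [a1 i1 n1 p1] [a2 i2 n2 p2]; split.
- exact: admissibleM.
- by rewrite Im_mulc i1 i2 mulr0 mul0r addr0.
- by move=> g; rewrite Normc.normcM Re_mulc i1 i2 mulr0 subr0 ler_pM ?normc_ge0.
- move=> phi aphi phi0.
  have := p1 (fun g => m2 g * phi g) (admissibleM a2 aphi) (p2 _ aphi phi0).
  by rewrite (_ : (fun g => m1 g * m2 g * phi g) = (fun g => m1 g * (m2 g * phi g)))//; apply/funext => g; rewrite mulrA.
Qed.

Lemma pos_multiplierD (R : realType) (m1 m2 : R -> R[i]) :
  pos_multiplier m1 -> pos_multiplier m2 -> pos_multiplier (fun g => m1 g + m2 g).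
Proof.
move=> [a1 i1 n1 p1] [a2 i2 n2 p2]; split.
- exact: admissibleD.
- by rewrite Im_addc i1 i2 addr0.
- by move=> g; rewrite (le_trans (ler_normcD _ _))// Re_addc lerD.
- move=> phi aphi phi0 e y e0.
  have -> : abel_transform (fun g => (m1 g + m2 g) * phi g) e y
    = abel_transform (fun g => m1 g * phi g) e y + abel_transform (fun g => m2 g * phi g) e y.
    rewrite /abel_transform -RintegralD//.
    + by apply: eq_Rintegral => g _; rewrite mulrDl mulrDl Re_addc mulrDr.
    + by apply: integrable_abel_integrand => //; exact: admissibleM.
    + by apply: integrable_abel_integrand => //; exact: admissibleM.
  by rewrite addr_ge0//; [exact: p1|exact: p2].
Qed.

Lemma pos_multiplier_real (R : realType) (s : R) : 0 <= s ->
  pos_multiplier (fun=> s%:C : R[i]).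
Proof.
move=> s0; have := pos_multiplier_cexpi 0 s0.
rewrite (_ : (fun g : R => s%:C * cexpi (g * 0)) = (fun=> s%:C : R[i]))//.
by apply/funext => g; rewrite mulr0 /cexpi cos0 sin0 mulr1.
Qed.

Lemma pos_multiplierX (R : realType) (m : R -> R[i]) n :
  pos_multiplier m -> pos_multiplier (fun g => m g ^+ n).
Proof.
move=> pm; elim: n => [|n IH]; first exact: (pos_multiplier_real ler01).
have := pos_multiplierM pm IH.
by rewrite (_ : (fun g => m g * m g ^+ n) = (fun g => m g ^+ n.+1))//; apply/funext => g; rewrite exprS.
Qed.

Lemma pos_multiplier_sum (R : realType) (m : nat -> R -> R[i]) n :
  (forall k, (k < n)%N -> pos_multiplier (m k)) ->
  pos_multiplier (fun g => \sum_(k < n) m k g).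
Proof.
elim: n => [|n IH] pm.
  have := @pos_multiplier_real R 0 (lexx 0).
  by rewrite (_ : (fun=> 0%:C) = (fun g => \sum_(k < 0) m k g))//; apply/funext => g; rewrite big_ord0.
have := pos_multiplierD (IH (fun k kn => pm k (ltnW kn))) (pm n (ltnSn n)).
rewrite (_ : (fun g => _ + m n g) = (fun g => \sum_(k < n.+1) m k g))//.
by apply/funext => g; rewrite big_ord_recr.
Qed.

(** The bound of a multiplier by its value at 0 pays off here: convergence at the single point 0
    bounds all the [m_ n] uniformly, which supplies the domination for passing to the limit in the
    Abel transform. *)
Lemma pos_multiplier_cvg (R : realType) (m_ : nat -> R -> R[i]) (m : R -> R[i]) :
  (forall n, pos_multiplier (m_ n)) -> (forall g, cvgc (fun n => m_ n g) (m g)) ->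
  pos_multiplier m.
Proof.
move=> pm mm.
have bnd g : Normc.normc (m g) <= complex.Re (m 0).
  have [c0 _] := mm 0; have := cvgc_normc (mm g).
  move=> /ler_cvg_to; apply; [exact: c0|].
  by apply: nearW => n; case: (pm n).
have am : admissible m.
  split; last by exists (complex.Re (m 0)).
  - apply: (@measurable_fun_cvg _ _ _ _ (fun n g => complex.Re (m_ n g))).
      by move=> n; case: (pm n) => [[]].
    by move=> g _; case: (mm g).
  - apply: (@measurable_fun_cvg _ _ _ _ (fun n g => complex.Im (m_ n g))).
      by move=> n; case: (pm n) => [[]].
    by move=> g _; case: (mm g).
split => //.
  have [_] := mm 0; rewrite (_ : (fun n => complex.Im (m_ n 0)) = cst 0); last first.
    by apply/funext => n; case: (pm n).
  by move=> /cvg_lim <-//; exact: lim_cst.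
move=> phi aphi phi0 e y e0.
have [K HK] : exists K, forall n g, Normc.normc (m_ n g) <= K.
  have [c0 _] := mm 0.
  have /cvg_seq_bounded[M [_ HM]] : cvgn (fun n => complex.Re (m_ n 0)) by apply/cvg_ex; exists (complex.Re (m 0)).
  exists (M + 1) => n g; case: (pm n) => _ _ /(_ g) /le_trans + _; apply.
  have : M < M + 1 by rewrite ltrDl.
  by move=> /HM /(_ n I); exact: le_trans (ler_norm _).
have [_ _ [L phiL]] := aphi.
have := @dominated_convergence_Rintegral _ _ _ (@lebesgue_measure R) `[0, +oo[%classic
  (fun n g => expR (- (e * g)) * complex.Re (m_ n g * phi g * cexpi (- (g * y))))
  (fun g => expR (- (e * g)) * complex.Re (m g * phi g * cexpi (- (g * y))))
  (fun g => K * L * expR (- (e * g))).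
case=> //.
- move=> n; apply: measurable_funTS; apply: measurable_abel_integrand.
  by apply: admissibleM => //; case: (pm n).
- move=> g _; apply: cvgM; first exact: cvg_cst.
  by have [] := cvgcM (cvgcM (mm g) (cvgc_cst (phi g))) (cvgc_cst (cexpi (- (g * y)))).
- by apply: integrable_scale => //; exact: integrable0y_expRN.
- move=> n g _; rewrite normrM ger0_norm ?expR_ge0// mulrC ler_wpM2r ?expR_ge0//.
  rewrite (le_trans (ler_Re_normc _))// !Normc.normcM normc_cexpi mulr1.
  by rewrite ler_pM ?normc_ge0.
move=> _ c; rewrite /abel_transform -(cvg_lim _ c)//; apply: limr_ge; first exact: cvgP c.
by apply: nearW => n; case: (pm n) => _ _ _ p; exact: (p phi aphi phi0 e y e0).
Qed.

(** The powers (1 + m / (n+1))^(n+1) are polynomials in m with nonnegative coefficients, hence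
    multipliers, and they converge to the exponential. *)
Lemma pos_multiplier_cexp (R : realType) (m : R -> R[i]) :
  pos_multiplier m -> pos_multiplier (fun g => cexp (m g)).
Proof.
move=> pm; apply: (@pos_multiplier_cvg _ (fun n g => (1 + (n.+1%:R^-1)%:C * m g) ^+ n.+1)).
  move=> n; apply: pos_multiplierX; apply: pos_multiplierD.
    exact: (pos_multiplier_real ler01).
  by apply: pos_multiplierM => //; apply: pos_multiplier_real; rewrite invr_ge0.
by move=> g; exact: cvgc_exp_limit.
Qed.

Lemma pos_multiplier_cexpB (R : realType) (m : R -> R[i]) (k l : R) : 0 <= l ->
  pos_multiplier m -> pos_multiplier (fun g => cexp (l%:C * (m g - k%:C))).
Proof.
move=> l0 pm.
have := pos_multiplierM (pos_multiplier_real (expR_ge0 (- (l * k))))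
  (pos_multiplier_cexp (pos_multiplierM (pos_multiplier_real l0) pm)).
rewrite (_ : (fun g => _ * _) = (fun g => cexp (l%:C * (m g - k%:C))))//.
apply/funext => g; rewrite -cexp_real -cexpD; congr cexp.
by rewrite rmorphN rmorphM/= addrC mulrBr.
Qed.

(** * The binomial series of (1 - z)^nu along rays *)

Definition is_cderive (R : realType) (f : R -> R[i]) (x : R) (d : R[i]) : Prop :=
  is_derive x (1 : R) (fun t => complex.Re (f t)) (complex.Re d) /\
  is_derive x (1 : R) (fun t => complex.Im (f t)) (complex.Im d).

Lemma is_cderive_cst (R : realType) (z : R[i]) (x : R) : is_cderive (fun=> z) x 0.
Proof. by split; exact: is_derive_cst. Qed.

Lemma is_cderive_id (R : realType) (x : R) : is_cderive (fun t : R => t%:C) x 1.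
Proof. by split; [exact: is_derive_id|exact: is_derive_cst]. Qed.

Lemma is_cderiveD (R : realType) (f g : R -> R[i]) (x : R) (a b : R[i]) :
  is_cderive f x a -> is_cderive g x b -> is_cderive (fun t => f t + g t) x (a + b).
Proof.
move=> [f1 f2] [g1 g2]; split.
  by under eq_fun do rewrite Re_addc; rewrite Re_addc; exact: is_deriveD.
by under eq_fun do rewrite Im_addc; rewrite Im_addc; exact: is_deriveD.
Qed.

Lemma is_cderiveM (R : realType) (f g : R -> R[i]) (x : R) (a b : R[i]) :
  is_cderive f x a -> is_cderive g x b ->
  is_cderive (fun t => f t * g t) x (a * g x + f x * b).
Proof.
move=> [f1 f2] [g1 g2]; split.
  under eq_fun do rewrite Re_mulc.
  by apply: is_derive_eq; rewrite /GRing.scale/= Re_addc !Re_mulc; ring.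
under eq_fun do rewrite Im_mulc.
by apply: is_derive_eq; rewrite /GRing.scale/= Im_addc !Im_mulc; ring.
Qed.

Lemma is_cderive_cexp (R : realType) (f : R -> R[i]) (x : R) (a : R[i]) :
  is_cderive f x a -> is_cderive (fun t => cexp (f t)) x (a * cexp (f x)).
Proof.
move=> [f1 f2]; split.
  under eq_fun do rewrite cexpE Re_mulc /= mul0r subr0.
  by apply: is_derive_eq; rewrite /GRing.scale/= !cexpE !(Re_mulc, Im_mulc)/=; ring.
under eq_fun do rewrite cexpE Im_mulc /= mul0r addr0.
by apply: is_derive_eq; rewrite /GRing.scale/= !cexpE !(Re_mulc, Im_mulc)/=; ring.
Qed.

Lemma is_cderiveX (R : realType) (u : R[i]) (x : R) n :
  is_cderive (fun t => (t%:C * u) ^+ n.+1) x (n.+1%:R * u * (x%:C * u) ^+ n).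
Proof.
have d1 : is_cderive (fun t => t%:C * u) x u.
  have := is_cderiveM (is_cderive_id x) (is_cderive_cst u x).
  by rewrite mulr0 addr0 mul1r.
elim: n => [|n IH]; first by under eq_fun do rewrite expr1; rewrite expr0 mulr1 mul1r.
under eq_fun do rewrite exprS.
have := is_cderiveM d1 IH.
rewrite (_ : u * _ + _ = n.+2%:R * u * (x%:C * u) ^+ n.+1)//.
by rewrite -[n.+2%:R]natr1 exprS; ring.
Qed.

(** The mean value theorem fails for complex values, so it is applied to the real and imaginary
    parts separately; this is the origin of the factor two. *)
Lemma is_cderive_le (R : realType) (f : R -> R[i]) (d : R -> R[i]) (r C : R) :
  0 < r -> (forall x, 0 <= x <= r -> is_cderive f x (d x)) ->
  (forall x, 0 <= x <= r -> Normc.normc (d x) <= C) ->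
  Normc.normc (f r - f 0) <= C * r + C * r.
Proof.
move=> r0 df dC; rewrite (le_trans (ler_normc_ReIm _))//.
have mvt (h d' : R -> R) : (forall x, 0 <= x <= r -> is_derive x (1 : R) h (d' x)) ->
    (forall x, 0 <= x <= r -> `|d' x| <= C) -> `|h r - h 0| <= C * r.
  move=> dh hC.
  have [||c cI ->] := @MVT _ h d' 0 r r0.
  - by move=> x; rewrite in_itv/= => /andP[x0 xr]; apply: dh; rewrite !ltW.
  - apply: derivable_within_continuous => x; rewrite in_itv/= => xI.
    by have := dh x xI => -[].
  rewrite subr0 normrM (gtr0_norm r0) ler_wpM2r ?(ltW r0)//.
  by apply: hC; move: cI; rewrite in_itv/= => /andP[/ltW -> /ltW ->].
rewrite Re_addc Re_oppc Im_addc Im_oppc lerD//.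
- apply: (mvt (fun x => complex.Re (f x)) (fun x => complex.Re (d x))) => x xI; first by have [] := df x xI.
  by rewrite (le_trans (ler_Re_normc _))// dC.
- apply: (mvt (fun x => complex.Im (f x)) (fun x => complex.Im (d x))) => x xI; first by have [] := df x xI.
  by rewrite (le_trans (ler_Im_normc _))// dC.
Qed.

(* Coefficients of [(1 - z)^nu]. *)
Fixpoint binc (R : realType) (nu : R) (k : nat) : R :=
  if k is j.+1 then binc nu j * (j%:R - nu) / j.+1%:R else 1.

Lemma bincS (R : realType) (nu : R) k :
  k.+1%:R * binc nu k.+1 = (k%:R - nu) * binc nu k.
Proof. by rewrite /= mulrC divfK ?pnatr_eq0// mulrC. Qed.

Lemma binc_le0 (R : realType) (nu : R) k : 0 < nu -> nu <= 1 -> binc nu k.+1 <= 0.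
Proof.
move=> nu0 nu1; elim: k => [|k IH]; first by rewrite /= !mul1r divr1; lra.
rewrite [binc _ _]/= -/(binc nu k.+1) pmulr_lle0 ?invr_gt0// mulr_le0_ge0//.
by rewrite subr_ge0 (le_trans nu1)// ler1n.
Qed.

Lemma binc_ge0 (R : realType) (nu : R) k : 1 <= nu -> nu <= 2 -> 0 <= binc nu k.+2.
Proof.
move=> nu0 nu1; elim: k => [|k IH]; first by rewrite /= !mul1r divr1; nra.
rewrite [binc _ _]/= -/(binc nu k.+2) divr_ge0// mulr_ge0//.
by rewrite subr_ge0 (le_trans nu1)// ler_nat.
Qed.

(** The coefficient of degree one has modulus nu < 2, and from there on the successive ratios |k -
    nu| / (k + 1) are at most 1. *)
Lemma binc_le2 (R : realType) (nu : R) k : 0 < nu -> nu < 2 -> `|binc nu k| <= 2.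
Proof.
move=> nu0 nu2; case: k => [|k]; first by rewrite /= normr1; lra.
elim: k => [|k IH]; first by rewrite /= mul1r divr1 sub0r normrN gtr0_norm// ltW.
rewrite [binc _ _]/= -/(binc nu k.+1) 2!normrM normfV [`|k.+2%:R|]ger0_norm//.
rewrite ler_pdivrMr// ler_pM//.
have k0 : 1 <= k.+1%:R :> R by rewrite ler1n.
have : k.+2%:R = k.+1%:R + 1 :> R by rewrite natr1.
by rewrite ler_norml; lra.
Qed.

Lemma cvg_nat_geometric (R : realType) (r : R) : 0 <= r < 1 ->
  (n%:R + 2) * r ^+ n @[n --> \oo] --> 0.
Proof.
move=> /andP[r0 r1]; move: r0; rewrite le_eqVlt => /predU1P[<-|r0].
  apply: (@cvg_trans _ ((fun=> 0 : R) @ \oo)); last exact: cvg_cst.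
  apply: near_eq_cvg; near=> n; rewrite expr0n gtn_eqF ?mulr0//.
  by near: n; exists 1%N.
(* With r = e^(-2a), one factor e^(-a n) absorbs the linear term and the other tends to 0. *)
pose a := - ln r / 2.
have a0 : 0 < a by rewrite divr_gt0// oppr_gt0 ln_lt0// r0.
have rE : r = expR (- a) * expR (- a).
  by rewrite -expRD /a -[LHS](@lnK R) ?posrE//; congr expR; field.
have [C C0 HC] := @expR_poly_bound R a 0 a0.
apply: (@squeeze_cvgr _ _ _ _ (cst 0) (fun n => C * expR (a * 2) * expR (- a) ^+ n)).
- near=> n; rewrite /cst mulr_ge0 ?exprn_ge0 ?addr_ge0 ?(ltW r0)//=.
  rewrite {1}rE exprMn mulrA ler_wpM2r ?exprn_ge0 ?expR_ge0//.
  have := HC (n%:R + 2); rewrite expr1 addr_ge0// => /(_ isT).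
  rewrite mulrDr expRD mulrA -expRM_natl => H.
  rewrite -ler_pdivlMr ?expR_gt0// -expRN mulrN opprK (le_trans H)//.
  by rewrite mulrAC mulrC (mulrC a) le_eqVlt; apply/orP; left; apply/eqP; ring.
- exact: cvg_cst.
- rewrite -[X in _ --> X](mulr0 (C * expR (a * 2))); apply: cvgM; first exact: cvg_cst.
  by apply: cvg_expr; rewrite ger0_norm ?expR_ge0// expR_lt1 oppr_lt0.
Unshelve. all: by end_near. Qed.

(** The squared modulus of 1 - r e^(ix). *)
Definition sqdist1 (R : realType) (r x : R) : R := 1 - 2 * r * cos x + r ^+ 2.

(* Principal logarithm of [1 - r e^{ix}] for [0 <= r < 1]. *)
Definition clog1m (R : realType) (x r : R) : R[i] :=
  (ln (sqdist1 r x) / 2) +i* (- atan (r * sin x / (1 - r * cos x))).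

(** The derivative in r of the logarithm, - e^(ix) / (1 - r e^(ix)), with its denominator made
    real. *)
Definition clog1m' (R : realType) (x r : R) : R[i] :=
  ((r - cos x) / sqdist1 r x) +i* (- (sin x / sqdist1 r x)).

Lemma sqdist1_ge (R : realType) (r x : R) : 0 <= r -> (1 - r) ^+ 2 <= sqdist1 r x.
Proof. by move=> r0; have := cos_le1 x; rewrite /sqdist1; nra. Qed.

Lemma sqdist1_gt0 (R : realType) (r x : R) : 0 <= r < 1 -> 0 < sqdist1 r x.
Proof.
move=> /andP[r0 r1]; rewrite (lt_le_trans _ (sqdist1_ge x r0))// exprn_gt0//.
by rewrite subr_gt0.
Qed.

Lemma rcos_lt1 (R : realType) (r x : R) : 0 <= r < 1 -> 0 < 1 - r * cos x.
Proof. by move=> /andP[r0 r1]; have := cos_le1 x; nra. Qed.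

Lemma is_cderive_clog1m (R : realType) (x r : R) : 0 <= r < 1 ->
  is_cderive (clog1m x) r (clog1m' x r).
Proof.
move=> r01; have D0 := sqdist1_gt0 x r01; have c0 := rcos_lt1 x r01.
have s2 := cos2Dsin2 x.
split => /=.
  have dD : is_derive r (1 : R) (fun t => sqdist1 t x) (2 * (r - cos x)).
    by rewrite /sqdist1; apply: is_derive_eq; rewrite /GRing.scale/=; ring.
  have dl := is_derive1_ln D0.
  apply: is_derive_eq; rewrite /GRing.scale/=.
  by field; rewrite gt_eqF.
have cn0 : 1 - r * cos x != 0 by rewrite gt_eqF.
have d1 : is_derive r (1 : R) (fun t => (1 - t * cos x)^-1) (cos x / (1 - r * cos x) ^+ 2).
  apply: is_derive_eq; rewrite /GRing.scale/=; field.
  by rewrite cn0.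
apply: is_derive_eq; rewrite /GRing.scale/=.
have : sqdist1 r x = (1 - r * cos x) ^+ 2 + (r * sin x) ^+ 2.
  by rewrite exprMn sin2cos2 /sqdist1; ring.
move=> E; rewrite E; field.
by rewrite cn0 -E gt_eqF//= gt_eqF//.
Qed.

Lemma clog1m'E (R : realType) (x r : R) : 0 <= r < 1 ->
  clog1m' x r * (1 - r%:C * cexpi x) = - cexpi x.
Proof.
move=> r01; have D0 := sqdist1_gt0 x r01; have s2 := cos2Dsin2 x.
apply/eqP; rewrite eq_complex !(Re_mulc, Im_mulc, Re_addc, Im_addc, Re_oppc, Im_oppc)/=.
apply/andP; split; apply/eqP; apply: (mulIf (lt0r_neq0 D0)).
  rewrite (_ : _ * sqdist1 r x = ((r - cos x) * (1 - r * cos x) - r * sin x ^+ 2)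
     / sqdist1 r x * sqdist1 r x); last by ring.
  by rewrite divfK ?gt_eqF// sin2cos2 /sqdist1; ring.
rewrite (_ : _ * sqdist1 r x = (- (r - cos x) * r * sin x - sin x * (1 - r * cos x))
   / sqdist1 r x * sqdist1 r x); last by ring.
by rewrite divfK ?gt_eqF// /sqdist1; ring.
Qed.

Lemma normc_subr1_ge (R : realType) (r x : R) : 0 <= r ->
  1 - r <= Normc.normc (1 - r%:C * cexpi x).
Proof.
move=> r0; rewrite lerBlDr.
have := ler_normcD (1 - r%:C * cexpi x) (r%:C * cexpi x).
by rewrite subrK Normc.normc1 Normc.normcM normc_cexpi normc_real mulr1 ger0_norm.
Qed.

Definition bin_sum (R : realType) (nu : R) (K : nat) (z : R[i]) : R[i] :=
  \sum_(k < K.+1) (binc nu k)%:C * z ^+ k.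

(** The derivative in t of the partial sum along the ray z = t u. *)
Definition bin_sum' (R : realType) (nu : R) (K : nat) (u z : R[i]) : R[i] :=
  \sum_(k < K) (binc nu k.+1)%:C * (k.+1%:R * u * z ^+ k).

Lemma is_cderive_bin_sum (R : realType) (nu : R) K (u : R[i]) (r : R) :
  is_cderive (fun t => bin_sum nu K (t%:C * u)) r (bin_sum' nu K u (r%:C * u)).
Proof.
elim: K => [|K IH].
  rewrite /bin_sum /bin_sum' big_ord0.
  under eq_fun do rewrite big_ord1 expr0.
  exact: is_cderive_cst.
rewrite /bin_sum /bin_sum' big_ord_recr/=.
under eq_fun do rewrite big_ord_recr.
apply: is_cderiveD => //.
have := is_cderiveM (is_cderive_cst (binc nu K.+1)%:C r) (is_cderiveX u r K).
by rewrite mul0r add0r.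
Qed.

(** The full series satisfies (1 - z) f' = - nu u f along the ray. Under the coefficient recurrence
    [bincS] all terms of the truncated identity cancel except the one in z^K. *)
Lemma bin_sum_ode (R : realType) (nu : R) K (u z : R[i]) :
  (1 - z) * bin_sum' nu K u z
  = u * (- nu%:C * bin_sum nu K z + ((nu - K%:R) * binc nu K)%:C * z ^+ K).
Proof.
elim: K => [|K IH].
  by rewrite /bin_sum /bin_sum' big_ord0 big_ord1 expr0 subr0 mulr0 !mulr1 addNr mulr0.
have E1 : bin_sum' nu K.+1 u z = bin_sum' nu K u z + (binc nu K.+1)%:C * (K.+1%:R * u * z ^+ K).
  by rewrite /bin_sum' big_ord_recr.
have E2 : bin_sum nu K.+1 z = bin_sum nu K z + (binc nu K.+1)%:C * z ^+ K.+1.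
  by rewrite /bin_sum big_ord_recr.
rewrite E1 E2 mulrDr IH.
have B : ((nu - K%:R) * binc nu K)%:C = - (K.+1%:R * (binc nu K.+1)%:C).
  by rewrite -[K.+1%:R](rmorph_nat (real_complex R)) -rmorphM/= bincS -rmorphN/= -mulNr opprB.
have B2 : ((nu - K.+1%:R) * binc nu K.+1)%:C = (nu%:C - K.+1%:R) * (binc nu K.+1)%:C.
  by rewrite rmorphM rmorphB/= rmorph_nat.
rewrite B B2 exprS; ring.
Qed.

(** The principal power (1 - r e^(ix))^nu. *)
Definition cpow1m (R : realType) (nu x r : R) : R[i] := cexp (nu%:C * clog1m x r).

Lemma clog1m0 (R : realType) (x : R) : clog1m x 0 = 0.
Proof.
by rewrite /clog1m /sqdist1 mulr0 !mul0r subr0 expr0n addr0 ln1 !mul0r atan0 oppr0.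
Qed.

(* [G (1 - z)^{-nu}] is constant along a ray when [G] is the full series, because both factors
   satisfy the same linear equation; for a partial sum the derivative is the single
   uncancelled top term, which tends to [0]. *)
Lemma cvgc_bin_sum (R : realType) (nu x r : R) : 0 < nu -> nu < 2 -> 0 < r < 1 ->
  cvgc (fun K => bin_sum nu K (r%:C * cexpi x)) (cpow1m nu x r).
Proof.
move=> nu0 nu2 /andP[r0 r1].
pose u := cexpi x.
pose H K t := bin_sum nu K (t%:C * u) * cexp (- nu%:C * clog1m x t).
pose H' K t := (bin_sum' nu K u (t%:C * u) + bin_sum nu K (t%:C * u) * (- nu%:C * clog1m' x t))
   * cexp (- nu%:C * clog1m x t).
have dH K t : 0 <= t <= r -> is_cderive (H K) t (H' K t).
  move=> /andP[t0 tr]; have t01 : 0 <= t < 1 by rewrite t0 (le_lt_trans tr).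
  have dl := is_cderiveM (is_cderive_cst (- nu%:C) t) (is_cderive_clog1m x t01).
  have := is_cderiveM (is_cderive_bin_sum nu K u t) (is_cderive_cexp dl).
  by rewrite mul0r add0r /H' mulrDl [_ * (_ * cexp _)]mulrA.
(* [M] is (1 - r)^(-nu), an upper bound of |1 - t e^(ix)|^(-nu) for 0 <= t <= r. *)
pose M := expR (- nu * (ln ((1 - r) ^+ 2) / 2)).
have bH K t : 0 <= t <= r -> Normc.normc (H' K t) <= M / (1 - r) * 2 * ((K%:R + 2) * r ^+ K).
  move=> /andP[t0 tr]; have t01 : 0 <= t < 1 by rewrite t0 (le_lt_trans tr).
  have n1 : 1 - r <= Normc.normc (1 - t%:C * u).
    by rewrite (le_trans _ (normc_subr1_ge x t0))// lerD2l lerN2.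
  have n0 : 0 < 1 - r by rewrite subr_gt0.
  have E : (1 - t%:C * u) * H' K t = u * ((nu - K%:R) * binc nu K)%:C * (t%:C * u) ^+ K
      * cexp (- nu%:C * clog1m x t).
    rewrite /H' mulrA mulrDr bin_sum_ode.
    rewrite (_ : (1 - t%:C * u) * (bin_sum nu K (t%:C * u) * (- nu%:C * clog1m' x t))
      = - nu%:C * bin_sum nu K (t%:C * u) * (clog1m' x t * (1 - t%:C * u))); last by ring.
    by rewrite clog1m'E// -/u; ring.
  have u1 : Normc.normc u = 1 by exact: normc_cexpi.
  have E2 : Normc.normc (u * ((nu - K%:R) * binc nu K)%:C * (t%:C * u) ^+ K)
      = `|nu - K%:R| * `|binc nu K| * t ^+ K.
    by rewrite 2!Normc.normcM normcX Normc.normcM u1 mul1r mulr1 !normc_real normrM (ger0_norm t0).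
  have E' : Normc.normc (1 - t%:C * u) * Normc.normc (H' K t)
      = `|nu - K%:R| * `|binc nu K| * t ^+ K * expR (complex.Re (- nu%:C * clog1m x t)).
    by rewrite -E2 -normc_cexp -Normc.normcM E Normc.normcM.
  have : (1 - r) * Normc.normc (H' K t) <= (K%:R + 2) * 2 * r ^+ K * M.
    apply: (@le_trans _ _ (Normc.normc (1 - t%:C * u) * Normc.normc (H' K t))).
      by rewrite ler_wpM2r ?normc_ge0.
    rewrite E'; rewrite ler_pM ?expR_ge0 ?mulr_ge0 ?exprn_ge0//.
      rewrite ler_pM ?mulr_ge0 ?exprn_ge0//; last by rewrite lerXn2r ?nnegrE ?(ltW r0).
      rewrite ler_pM ?binc_le2//; have K0 : 0 <= K%:R :> R by [].
      by rewrite ler_norml; lra.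
    rewrite -rmorphN Re_mulc /= mul0r subr0 /M ler_expR !mulNr lerN2 ler_wpM2l ?(ltW nu0)//.
    rewrite ler_wpM2r// ler_ln ?posrE ?exprn_gt0 ?sqdist1_gt0//.
    rewrite (le_trans _ (sqdist1_ge x t0))// lerXn2r ?nnegrE ?subr_ge0 ?lerD2l ?lerN2 ?(ltW r1)//.
    by rewrite (le_trans tr)// ltW.
  rewrite mulrC -ler_pdivlMr// => /le_trans; apply.
  by rewrite le_eqVlt; apply/orP; left; apply/eqP; ring.
have H0 K : H K 0 = 1.
  rewrite /H mul0r clog1m0 mulr0 cexp0 mulr1 /bin_sum big_ord_recl expr0 mulr1.
  by rewrite big1 ?addr0// => i _; rewrite expr0n mulr0.
have cH : cvgc (fun K => H K r) 1.
  apply: cvgc_normc0.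
  pose B K := M / (1 - r) * 2 * ((K%:R + 2) * r ^+ K).
  apply: (@squeeze_cvgr _ _ _ _ (cst 0) (fun K => B K * r + B K * r)).
  - near=> K; rewrite /cst normc_ge0/= -(H0 K).
    by apply: (@is_cderive_le _ (H K) (H' K)) => // t tI; [exact: dH|exact: bH].
  - exact: cvg_cst.
  - have cB : B K @[K --> \oo] --> 0.
      rewrite -[X in _ --> X](mulr0 (M / (1 - r) * 2)); apply: cvgM; first exact: cvg_cst.
      by apply: cvg_nat_geometric; rewrite (ltW r0) r1.
    rewrite -[X in _ --> X](addr0 (0 : R)) -[X in _ --> X + X](mul0r r).
    by apply: cvgD; apply: cvgM => //; exact: cvg_cst.
have := cvgcM cH (cvgc_cst (cpow1m nu x r)); rewrite mul1r.
rewrite (_ : (fun K => _) = (fun K => bin_sum nu K (r%:C * cexpi x)))//.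
apply/funext => K; rewrite /H /cpow1m -mulrA -cexpD -mulrDl addNr mul0r cexp0 mulr1.
by [].
Unshelve. all: by end_near. Qed.

(** * Stable exponents *)

Lemma cexpiX (R : realType) (x : R) k : cexpi x ^+ k = cexpi (k%:R * x).
Proof.
elim: k => [|k IH]; first by rewrite mul0r expr0 /cexpi cos0 sin0.
by rewrite exprS IH -cexpiD -natr1 mulrDl mul1r addrC.
Qed.

Lemma scaled_cexpiX (R : realType) (r x : R) k :
  (r%:C * cexpi x) ^+ k = (r ^+ k)%:C * cexpi (k%:R * x).
Proof. by rewrite exprMn cexpiX rmorphXn. Qed.

Lemma cvgcS (R : realType) (u : nat -> R[i]) (l : R[i]) :
  cvgc u l -> cvgc (fun n => u n.+1) l.
Proof.
have cS : (fun n => n.+1) @ \oo --> \oo.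
  by move=> A [N _ NA]; exists N => // n /= Nn; apply: NA => /=; exact: leqW.
move=> [u1 u2]; split; first exact: (cvg_comp _ _ cS u1).
exact: (cvg_comp _ _ cS u2).
Qed.

Lemma pos_multiplier_cpow_lt1 (R : realType) (nu h r l : R) :
  0 < nu -> nu < 1 -> 0 < r < 1 -> 0 <= l ->
  pos_multiplier (fun g => cexp (- (l%:C * cpow1m nu (g * h) r))).
Proof.
move=> nu0 nu1 r01 l0.
have pm : pos_multiplier (fun g => 1 - cpow1m nu (g * h) r).
  apply: (@pos_multiplier_cvg _ (fun K g => 1 - bin_sum nu K (r%:C * cexpi (g * h)))); last first.
    move=> g; apply: cvgcD; first exact: cvgc_cst.
    by apply: cvgcN; apply: cvgc_bin_sum => //; lra.
  move=> K; rewrite (_ : (fun g => _) = (fun g => \sum_(k < K)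
      (- binc nu k.+1 * r ^+ k.+1)%:C * cexpi (g * (h * k.+1%:R)))); last first.
    apply/funext => g; rewrite /bin_sum big_ord_recl expr0 mulr1 opprD addrA subrr add0r.
    rewrite -sumrN; apply: eq_bigr => k _.
    rewrite lift0 scaled_cexpiX mulNr rmorphN rmorphM/= mulNr mulrA.
    by congr (- (_ * cexpi _)); ring.
  apply: (@pos_multiplier_sum _ (fun k g => (- binc nu k.+1 * r ^+ k.+1)%:C * cexpi (g * (h * k.+1%:R)))).
  move=> k _; apply: pos_multiplier_cexpi; case/andP: r01 => r0 _.
  by rewrite mulr_ge0 ?exprn_ge0 ?(ltW r0)// oppr_ge0 binc_le0 ?(ltW nu1).
have := pos_multiplier_cexpB 1 l0 pm.
rewrite (_ : (fun g => _) = (fun g => cexp (- (l%:C * cpow1m nu (g * h) r))))//.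
by apply/funext => g; congr cexp; rewrite rmorph1; ring.
Qed.

(* Dividing by [z] turns the only negative coefficient, that of degree one, into a constant. *)
Lemma pos_multiplier_cpow_gt1 (R : realType) (nu h r l : R) :
  1 < nu -> nu < 2 -> 0 < r < 1 -> 0 <= l ->
  pos_multiplier (fun g => cexp (l%:C * ((r^-1)%:C * cexpi (g * - h) * cpow1m nu (g * h) r))).
Proof.
move=> nu1 nu2 r01 l0; have r0 : 0 < r by case/andP: r01.
have pm : pos_multiplier (fun g => (r^-1)%:C * cexpi (g * - h) * cpow1m nu (g * h) r + nu%:C).
  (* Partial sums of order K + 1 always contain the term of degree one, which is the one to be
     compensated by nu. *)
  apply: (@pos_multiplier_cvg _ (fun K g => (r^-1)%:C * cexpi (g * - h) *
     bin_sum nu K.+1 (r%:C * cexpi (g * h)) + nu%:C)); last first.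
    move=> g; apply: cvgcD; last exact: cvgc_cst.
    apply: cvgcM; first exact: cvgc_cst.
    apply: (@cvgcS _ (fun n => bin_sum nu n (r%:C * cexpi (g * h)))).
    by apply: cvgc_bin_sum => //; exact: lt_trans nu1.
  move=> K; rewrite (_ : (fun g => _) = (fun g => (r^-1)%:C * cexpi (g * - h) + \sum_(k < K)
      (binc nu k.+2 * r ^+ k.+1)%:C * cexpi (g * (h * k.+1%:R)))); last first.
    apply/funext => g; set w := (r^-1)%:C * _; set z := r%:C * cexpi (g * h).
    have wz : w * z = 1.
      rewrite /w /z mulrACA -rmorphM/= mulVf ?gt_eqF// -cexpiD mulrN addNr.
      by rewrite /cexpi cos0 sin0 mulr1.
    have -> : bin_sum nu K.+1 z = 1 + (- nu%:C * z + \sum_(k < K) (binc nu k.+2)%:C * z ^+ k.+2).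
      rewrite /bin_sum 2!big_ord_recl expr0 mulr1 expr1.
      by rewrite /binc/= mul1r divr1 sub0r rmorphN.
    rewrite 2!mulrDr mulr1 mulrCA wz mulr1 addrA addrAC subrK; congr (_ + _).
    rewrite mulr_sumr; apply: eq_bigr => k _.
    rewrite exprS mulrCA (mulrA w) wz mul1r /z scaled_cexpiX rmorphM/= mulrA.
    by congr (_ * cexpi _); ring.
  apply: pos_multiplierD.
    by apply: pos_multiplier_cexpi; rewrite invr_ge0 ltW.
  apply: (@pos_multiplier_sum _ (fun k g => (binc nu k.+2 * r ^+ k.+1)%:C * cexpi (g * (h * k.+1%:R)))).
  move=> k _; apply: pos_multiplier_cexpi.
  by rewrite mulr_ge0 ?exprn_ge0 ?(ltW r0)// binc_ge0 ?(ltW nu1) ?(ltW nu2).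
have := pos_multiplier_cexpB nu l0 pm.
rewrite (_ : (fun g => _) = (fun g => cexp (l%:C * ((r^-1)%:C * cexpi (g * - h) * cpow1m nu (g * h) r))))//.
by apply/funext => g; congr cexp; rewrite addrK.
Qed.

(* Principal value of [(- i y)^nu]. *)
Definition npow (R : realType) (nu y : R) : R[i] :=
  (`|y| `^ nu)%:C * cexpi (- (nu * (pi / 2) * Num.sg y)).

Lemma cvg_div_pinfty (R : realType) (u v : nat -> R) (y : R) : 0 < y ->
  u n @[n --> \oo] --> y -> v n @[n --> \oo] --> 0 -> (forall n, 0 < v n) ->
  u n / v n @[n --> \oo] --> +oo.
Proof.
move=> y0 uy v0 vp; apply/cvgryPge => A; near=> n.
have h1 : y / 2 <= u n.
  by near: n; apply: (cvgr_ge _ uy); rewrite ltr_pdivrMr// mulr_natr mulr2n ltrDl.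
have A0 : 0 < `|A| + 1 by rewrite ltr_wpDl.
have h2 : v n <= y / 2 / (`|A| + 1).
  by near: n; apply: (cvgr_le _ v0); rewrite !divr_gt0.
rewrite ler_pdivlMr// (le_trans _ h1)//.
rewrite (@le_trans _ _ ((`|A| + 1) * v n))//.
  by rewrite ler_wpM2r ?(ltW (vp n))// (le_trans (ler_norm _))// lerDl.
by rewrite mulrC -ler_pdivlMr.
Unshelve. all: by end_near. Qed.

(* [1 - radius n = o(1 / n)], so that [n (1 - radius n * e^{i y / n})] tends to [- i y]. *)
Definition radius (R : realType) (n : nat) : R := n.+1%:R ^+ 2 / (1 + n.+1%:R ^+ 2).

Lemma radius_lt1 (R : realType) n : 0 < radius R n < 1.
Proof.
have N0 : 0 < n.+1%:R ^+ 2 :> R by rewrite exprn_gt0.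
by rewrite /radius divr_gt0 ?ltr_pdivrMr ?addr_gt0//= mul1r ltrDr.
Qed.

Lemma radius_gap (R : realType) n : 1 - radius R n = (1 + n.+1%:R ^+ 2)^-1.
Proof.
have N0 : 1 + n.+1%:R ^+ 2 != 0 :> R by rewrite gt_eqF// addr_gt0 ?exprn_gt0.
by rewrite /radius; field.
Qed.

Lemma cvg_radius_gap (R : realType) : n.+1%:R * (1 - radius R n) @[n --> \oo] --> 0.
Proof.
apply: (@squeeze_cvgr _ _ _ _ (cst 0) harmonic); [|exact: cvg_cst|exact: cvg_harmonic].
near=> n; rewrite /cst radius_gap mulr_ge0 ?invr_ge0//= ler_pdivrMr ?addr_gt0 ?exprn_gt0//.
by rewrite /harmonic/= mulrDr expr2 mulrA mulVf// mul1r mulr1 lerDr invr_ge0.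
Unshelve. all: by end_near. Qed.

Lemma cvg_radius (R : realType) : radius R n @[n --> \oo] --> (1 : R).
Proof.
rewrite (_ : radius R = (fun n => 1 - harmonic n * (n.+1%:R * (1 - radius R n)))); last first.
  by apply/funext => n; rewrite /harmonic/= mulrA mulVf// mul1r opprB addrC subrK.
rewrite -[X in _ --> X]subr0 -[X in _ --> _ - X](mulr0 (0 : R)).
apply: cvgB; first exact: cvg_cst.
by apply: cvgM; [exact: cvg_harmonic|exact: cvg_radius_gap].
Unshelve. all: by end_near. Qed.

Lemma cvg_scaled_sin (R : realType) (y : R) : n.+1%:R * sin (y / n.+1%:R) @[n --> \oo] --> y.
Proof.
have d : is_derive (0 : R) (1 : R) (fun t : R => sin (y * t)) y.
  by apply: is_derive_eq; rewrite /GRing.scale/= mulr0 cos0; ring.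
have := cvg_derive_harmonic d; rewrite mulr0 sin0.
by under eq_fun do rewrite subr0.
Qed.

Lemma cvg_scaled_cos (R : realType) (y : R) :
  n.+1%:R * (1 - cos (y / n.+1%:R)) @[n --> \oo] --> 0.
Proof.
have d : is_derive (0 : R) (1 : R) (fun t : R => - cos (y * t)) 0.
  by apply: is_derive_eq; rewrite /GRing.scale/= mulr0 sin0; ring.
have := cvg_derive_harmonic d; rewrite mulr0 cos0.
by under eq_fun do rewrite opprK addrC.
Qed.

Lemma sqdist1E (R : realType) (r x : R) :
  sqdist1 r x = (1 - r * cos x) ^+ 2 + (r * sin x) ^+ 2.
Proof. by rewrite exprMn sin2cos2 /sqdist1; ring. Qed.

Lemma cvg_cos_scale (R : realType) (y : R) : cos (y / n.+1%:R) @[n --> \oo] --> (1 : R).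
Proof.
rewrite -[X in _ --> X](@cos0 R); apply: continuous_cvg; first exact: continuous_cos.
rewrite -[X in _ --> X](mulr0 y); apply: cvgM; [exact: cvg_cst|exact: cvg_harmonic].
Qed.

Lemma cvg_scaled_rcos (R : realType) (y : R) :
  n.+1%:R * (1 - radius R n * cos (y / n.+1%:R)) @[n --> \oo] --> 0.
Proof.
rewrite (_ : (fun n => _) = (fun n => n.+1%:R * (1 - cos (y / n.+1%:R))
   + n.+1%:R * (1 - radius R n) * cos (y / n.+1%:R))); last by apply/funext => n; ring.
rewrite -[X in _ --> X](addr0 (0 : R)) -[X in _ --> _ + X](mul0r (1 : R)).
apply: cvgD; first exact: cvg_scaled_cos.
by apply: cvgM; [exact: cvg_radius_gap|exact: cvg_cos_scale].
Qed.

Lemma cvg_scaled_rsin (R : realType) (y : R) :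
  n.+1%:R * (radius R n * sin (y / n.+1%:R)) @[n --> \oo] --> y.
Proof.
rewrite (_ : (fun n => _) = (fun n => radius R n * (n.+1%:R * sin (y / n.+1%:R)))); last first.
  by apply/funext => n; rewrite mulrCA.
rewrite -[X in _ --> X]mul1r; apply: cvgM; [exact: cvg_radius|exact: cvg_scaled_sin].
Qed.

Lemma cvg_sqdist1 (R : realType) (y : R) :
  n.+1%:R ^+ 2 * sqdist1 (radius R n) (y / n.+1%:R) @[n --> \oo] --> y ^+ 2.
Proof.
rewrite (_ : (fun n => _) = (fun n => (n.+1%:R * (1 - radius R n * cos (y / n.+1%:R))) *
  (n.+1%:R * (1 - radius R n * cos (y / n.+1%:R)))
  + (n.+1%:R * (radius R n * sin (y / n.+1%:R))) * (n.+1%:R * (radius R n * sin (y / n.+1%:R))))); last first.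
  by apply/funext => n; rewrite sqdist1E; ring.
rewrite -[X in _ --> X]add0r -[X in _ --> X + _](mulr0 (0 : R)) expr2.
by apply: cvgD; apply: cvgM; (exact: cvg_scaled_rcos || exact: cvg_scaled_rsin).
Qed.

(** The arctangent is minus the argument of 1 - r e^(i y / (n+1)). For y > 0, after multiplication
    by n + 1, the numerator tends to y and the positive denominator to 0, so the quotient diverges;
    negative y follows by oddness. *)
Lemma cvg_atan_arg (R : realType) (y : R) : y != 0 ->
  atan (radius R n * sin (y / n.+1%:R) / (1 - radius R n * cos (y / n.+1%:R))) @[n --> \oo]
    --> pi / 2 * Num.sg y.
Proof.
have pos z : 0 < z -> atan (radius R n * sin (z / n.+1%:R) / (1 - radius R n * cos (z / n.+1%:R))) @[n --> \oo]
    --> pi / 2.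
  move=> z0; apply: (@cvg_comp _ _ _ _ (@atan R) _ (+oo : set_system R)); last exact: cvgy_atan.
  rewrite (_ : (fun n => _) = (fun n => (n.+1%:R * (radius R n * sin (z / n.+1%:R))) /
     (n.+1%:R * (1 - radius R n * cos (z / n.+1%:R))))); last first.
    by apply/funext => n; rewrite invfM mulrACA mulfV ?pnatr_eq0// mul1r.
  apply: (cvg_div_pinfty z0 (@cvg_scaled_rsin R z) (@cvg_scaled_rcos R z)) => n.
  rewrite mulr_gt0// rcos_lt1//; have /andP[r0 r1] := radius_lt1 R n.
  by rewrite ltW.
move=> y0; have [yp|yn] := ltP 0 y; first by rewrite gtr0_sg// mulr1; exact: pos.
have {}yn : 0 < - y by rewrite oppr_gt0 lt_neqAle y0.
rewrite ltr0_sg -?oppr_gt0// mulrN1.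
rewrite (_ : (fun n => _) = (fun n => - atan (radius R n * sin (- y / n.+1%:R) / (1 - radius R n * cos (- y / n.+1%:R))))).
  by apply: cvgN; exact: pos.
by apply/funext => n; rewrite mulNr sinN cosN mulrN mulNr atanN opprK.
Qed.

(** The factor (n+1)^nu is absorbed into the logarithm of the modulus, so that only limits inside a
    single exponential remain to be taken. *)
Lemma scaled_cpow1mE (R : realType) (nu y : R) n :
  (n.+1%:R `^ nu)%:C * cpow1m nu (y / n.+1%:R) (radius R n)
  = cexp ((nu * (ln (n.+1%:R ^+ 2 * sqdist1 (radius R n) (y / n.+1%:R)) / 2)) +i*
     (- (nu * atan (radius R n * sin (y / n.+1%:R) / (1 - radius R n * cos (y / n.+1%:R)))))).
Proof.
have N0 : 0 < n.+1%:R :> R by [].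
have D0 : 0 < sqdist1 (radius R n) (y / n.+1%:R).
  by apply: sqdist1_gt0; have /andP[r0 r1] := radius_lt1 R n; rewrite ltW.
rewrite /powR gt_eqF// -cexp_real -cexpD; congr cexp.
apply/eqP; rewrite eq_complex Re_addc Im_addc Re_mulc Im_mulc/=.
rewrite lnM ?posrE ?exprn_gt0// lnXn// -(mulr_natr _ 2).
apply/andP; split; apply/eqP; last by ring.
by field.
Qed.

Lemma cvgc_scaled_cpow1m (R : realType) (nu y : R) : 0 < nu ->
  cvgc (fun n => (n.+1%:R `^ nu)%:C * cpow1m nu (y / n.+1%:R) (radius R n)) (npow nu y).
Proof.
move=> nu0; under eq_fun do rewrite scaled_cpow1mE.
(* At y = 0 the logarithm diverges, so the limit 0 is read off the modulus, which is |(n+1) (1 -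
   radius n)|^nu. *)
have [->|y0] := eqVneq y 0.
  rewrite /npow sgr0 mulr0 oppr0 normr0 powR0 ?gt_eqF// mul0r.
  apply: cvgc_normc0.
  rewrite (_ : (fun n => _) = (fun n => `|n.+1%:R * (1 - radius R n)| `^ nu)); last first.
    apply/funext => n; rewrite subr0 normc_cexp /= mul0r.
    rewrite sqdist1E cos0 sin0 mulr0 expr0n addr0 mulr1 -exprMn.
    have g0 : 0 < n.+1%:R * (1 - radius R n).
      by rewrite mulr_gt0// subr_gt0; have /andP[_] := radius_lt1 R n.
    rewrite gtr0_norm// /powR gt_eqF// lnXn//; congr expR; rewrite -mulr_natr; by field.
  have E0 : `|0 : R| `^ nu = 0 by rewrite normr0 powR0 ?gt_eqF.
  rewrite -[X in _ --> X]E0.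
  exact: (cvg_comp _ _ (@cvg_radius_gap R) (@continuous_norm_powR R nu nu0 0)).
rewrite /npow.
have -> : (`|y| `^ nu)%:C * cexpi (- (nu * (pi / 2) * Num.sg y))
    = cexp ((nu * (ln (y ^+ 2) / 2)) +i* (- (nu * (pi / 2 * Num.sg y)))).
  rewrite cexpE /= /powR normr_eq0 (negbTE y0) mulrA; congr ((expR _)%:C * cexpi _); last by ring.
  rewrite -(real_normK (num_real y)) lnXn ?normr_gt0// -mulr_natr; by field.
apply: cvgc_cexp; split => /=.
  apply: cvgM; first exact: cvg_cst.
  apply: cvgM; last exact: cvg_cst.
  apply: continuous_cvg; last exact: cvg_sqdist1.
  by apply: continuous_ln; rewrite exprn_even_gt0.
by apply: cvgN; apply: cvgM; [exact: cvg_cst|exact: cvg_atan_arg].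
Qed.

Lemma npowE (R : realType) (nu y : R) : 0 < nu ->
  npow nu y = (`|y| `^ nu)%:C *
    (cos (nu * (pi / 2)) -i* (sin (nu * (pi / 2)) * Num.sg y)).
Proof.
move=> nu0; rewrite /npow; have [->|y0] := eqVneq y 0.
  by rewrite normr0 powR0 ?gt_eqF// !mul0r.
by congr (_ * _); rewrite /cexpi cosN sinN [_ * Num.sg y]mulrC (cos_sg _ y0) sin_sg [Num.sg y * _]mulrC.
Qed.

Lemma pos_multiplier_npow_lt1 (R : realType) (nu s p : R) : 0 < nu -> nu < 1 -> 0 <= p ->
  pos_multiplier (fun g => cexp (- (p%:C * npow nu (g * s)))).
Proof.
move=> nu0 nu1 p0.
apply: (@pos_multiplier_cvg _ (fun n g =>
  cexp (- ((p * n.+1%:R `^ nu)%:C * cpow1m nu (g * (s / n.+1%:R)) (radius R n))))).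
  move=> n; apply: pos_multiplier_cpow_lt1 => //; first exact: radius_lt1.
  by rewrite mulr_ge0 ?powR_ge0.
move=> g; apply: cvgc_cexp; apply: cvgcN.
rewrite (_ : (fun n => _) = (fun n => p%:C * ((n.+1%:R `^ nu)%:C *
  cpow1m nu (g * s / n.+1%:R) (radius R n)))); last first.
  by apply/funext => n; rewrite rmorphM/= -!mulrA.
by apply: cvgcM; [exact: cvgc_cst|exact: cvgc_scaled_cpow1m].
Qed.

Lemma cvgc_shift_factor (R : realType) (g s : R) :
  cvgc (fun n => ((radius R n)^-1)%:C * cexpi (g * - (s / n.+1%:R))) 1.
Proof.
have -> : (1 : R[i]) = (1^-1)%:C * cexpi 0 by rewrite invr1 /cexpi cos0 sin0 mulr1.
apply: cvgcM.
  by apply: cvgc_real; apply: cvgV; [exact: oner_neq0|exact: cvg_radius].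
have c0 : g * - (s / n.+1%:R) @[n --> \oo] --> (0 : R).
  rewrite -[X in _ --> X](mulr0 g); apply: cvgM; first exact: cvg_cst.
  rewrite -[X in _ --> X]oppr0; apply: cvgN; rewrite -[X in _ --> X](mulr0 s).
  by apply: cvgM; [exact: cvg_cst|exact: cvg_harmonic].
by split => /=; apply: continuous_cvg => //; [exact: continuous_cos|exact: continuous_sin].
Qed.

(** The division by z leaves no trace in the limit: z = radius n e^(i g s / (n+1)) tends to 1. *)
Lemma pos_multiplier_npow_gt1 (R : realType) (nu s p : R) : 1 < nu -> nu < 2 -> 0 <= p ->
  pos_multiplier (fun g => cexp (p%:C * npow nu (g * s))).
Proof.
move=> nu1 nu2 p0; have nu0 : 0 < nu by exact: lt_trans nu1.
apply: (@pos_multiplier_cvg _ (fun n g =>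
  cexp ((p * n.+1%:R `^ nu)%:C * (((radius R n)^-1)%:C * cexpi (g * - (s / n.+1%:R))
     * cpow1m nu (g * (s / n.+1%:R)) (radius R n))))).
  move=> n; apply: pos_multiplier_cpow_gt1 => //; first exact: radius_lt1.
  by rewrite mulr_ge0 ?powR_ge0.
move=> g; apply: cvgc_cexp.
rewrite (_ : (fun n => _) = (fun n => p%:C * (((radius R n)^-1)%:C * cexpi (g * - (s / n.+1%:R))
  * ((n.+1%:R `^ nu)%:C * cpow1m nu (g * s / n.+1%:R) (radius R n))))); last first.
  by apply/funext => n; rewrite rmorphM/= -!mulrA; congr (_ * _); ring.
apply: cvgcM; first exact: cvgc_cst.
rewrite -[X in cvgc _ X]mul1r.
by apply: cvgcM; [exact: cvgc_shift_factor|exact: cvgc_scaled_cpow1m].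
Qed.

Definition stable_exponent (R : realType) (a b nu g : R) : R[i] :=
  (a +i* (b * Num.sg g)) * (`|g| `^ nu)%:C.

(** The inequality on [b] says that the skewness is at most one in absolute value. It is what makes
    nonnegative the weights p and q with which the exponent decomposes along [npow nu g] and
    [npow nu (- g)], the two totally skewed exponents. *)
Lemma pos_multiplier_stable (R : realType) (a b nu : R) :
  0 < nu -> nu < 2 -> nu != 1 ->
  `|b| * `|cos (nu * (pi / 2))| <= a * sin (nu * (pi / 2)) ->
  pos_multiplier (fun g => cexp (- stable_exponent a b nu g)).
Proof.
move=> nu0 nu2 nu1 hab; set C := cos _ in hab; set S := sin _ in hab.
have pi0 : 0 < pi / 2 :> R by rewrite divr_gt0// pi_gt0.
have S0 : 0 < S.
  apply: sin_gt0_pi; rewrite mulr_gt0//=.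
  by rewrite (@lt_le_trans _ _ (2 * (pi / 2)))// ?ltr_pM2r// mulrC divfK.
have sgM (g : R) : Num.sg (g * -1) = - Num.sg g by rewrite mulrN1 sgrN.
have nM (g : R) : `|g * -1| = `|g| by rewrite mulrN1 normrN.
have [nul|nug] := ltP nu 1.
  have C0 : 0 < C.
    apply: cos_gt0_pihalf; apply/andP; split.
      by rewrite (@lt_trans _ _ 0) ?oppr_lt0// mulr_gt0.
    by rewrite -[ltRHS]mul1r ltr_pM2r.
  have hb : `|b| / S <= a / C.
    rewrite ler_pdivrMr// mulrAC ler_pdivlMr//.
    by rewrite (gtr0_norm C0) in hab.
  have hb1 : - (`|b| / S) <= b / S <= `|b| / S.
    by rewrite -mulNr !ler_pM2r ?invr_gt0// -ler_norml.
  (* The weights solve (p + q) C = a and (q - p) S = b, obtained from the real and imaginary parts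
     of p (C - i S) + q (C + i S) = a + i b. *)
  have p0 : 0 <= (a / C - b / S) / 2 by case/andP: hb1 => ? ?; lra.
  have q0 : 0 <= (a / C + b / S) / 2 by case/andP: hb1 => ? ?; lra.
  have := pos_multiplierM (pos_multiplier_npow_lt1 1 nu0 nul p0)
                          (pos_multiplier_npow_lt1 (-1) nu0 nul q0).
  rewrite (_ : (fun g => _ * _) = (fun g => cexp (- stable_exponent a b nu g)))//.
  apply/funext => g; rewrite -cexpD !npowE// sgM nM mulr1 -/C -/S; congr cexp.
  apply/eqP; rewrite eq_complex !(Re_addc, Im_addc, Re_oppc, Im_oppc, Re_mulc, Im_mulc)/=.
  by apply/andP; split; apply/eqP; field; rewrite !gt_eqF.
have {}nu1 : 1 < nu by rewrite lt_neqAle eq_sym nu1.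
have C0 : 0 < - C.
  rewrite /C -[nu * _](subrK pi) cosDpi opprK; apply: cos_gt0_pihalf.
  have -> : nu * (pi / 2) - pi = (nu - 2) * (pi / 2) by field.
  apply/andP; split; first by rewrite -[ltLHS]mulN1r ltr_pM2r//; lra.
  by rewrite -[ltRHS]mul1r ltr_pM2r//; lra.
have Cn0 : C != 0 by rewrite -oppr_eq0 gt_eqF.
have hb : `|b| / S <= - (a / C).
  rewrite -mulrN -invrN ler_pdivrMr// mulrAC ler_pdivlMr//.
  by rewrite -(normrN C) (gtr0_norm C0) in hab.
have hb1 : - (`|b| / S) <= b / S <= `|b| / S.
  by rewrite -mulNr !ler_pM2r ?invr_gt0// -ler_norml.
(* For nu > 1 the powers enter the exponential with a plus sign, so the equations become (p + q) C =
   - a and (q - p) S = - b; as C < 0, the sum p + q is again nonnegative. *)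
have p0 : 0 <= (- (a / C) + b / S) / 2 by case/andP: hb1 => ? ?; lra.
have q0 : 0 <= (- (a / C) - b / S) / 2 by case/andP: hb1 => ? ?; lra.
have := pos_multiplierM (pos_multiplier_npow_gt1 1 nu1 nu2 p0)
                        (pos_multiplier_npow_gt1 (-1) nu1 nu2 q0).
rewrite (_ : (fun g => _ * _) = (fun g => cexp (- stable_exponent a b nu g)))//.
apply/funext => g; rewrite -cexpD !npowE// sgM nM mulr1 -/C -/S; congr cexp.
apply/eqP; rewrite eq_complex !(Re_addc, Im_addc, Re_oppc, Im_oppc, Re_mulc, Im_mulc)/=.
by apply/andP; split; apply/eqP; field; rewrite ?Cn0 gt_eqF.
Qed.

(** The constant 1 is the transform of the unit mass at 0, whose smoothing is the Cauchy kernel. It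
    is the seed to which multipliers are applied. *)
Lemma transform_ge0_cst1 (R : realType) : transform_ge0 (fun=> 1 : R[i]).
Proof.
move=> e y e0; rewrite /abel_transform.
have -> : \int[@lebesgue_measure R]_(g in `[0, +oo[)
     (expR (- (e * g)) * complex.Re (1 * cexpi (- (g * y))))
   = \int[@lebesgue_measure R]_(g in `[0, +oo[) (expR (- (e * g)) * cos (y * g + 0)).
  by apply: eq_Rintegral => g _; rewrite mul1r /= cosN addr0 mulrC (mulrC g) mulrC.
rewrite Rintegral_expR_cos// cos0 sin0 mulr1 mulr0 subr0.
by rewrite divr_ge0 ?(ltW e0)// addr_ge0 ?sqr_ge0.
Qed.

(** The multiplier applied to the constant transform 1 gives nonnegative smoothings of the density,
    and their width [harmonic n] tends to 0. *)
Lemma stable_density_ge0 (R : realType) (a b nu : R) :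
  0 < a -> 0 < nu -> nu < 2 -> nu != 1 ->
  `|b| * `|cos (nu * (pi / 2))| <= a * sin (nu * (pi / 2)) ->
  forall x, 0 <= stable_density a b nu x.
Proof.
move=> a0 nu0 nu2 nu1 hab x.
have [_ _ _ pm] := pos_multiplier_stable nu0 nu2 nu1 hab.
have {}pm := pm _ (@admissible_cst R 1) (@transform_ge0_cst1 R).
rewrite mulr_ge0 ?invr_ge0 ?pi_ge0//.
pose f g := expR (- (a * g `^ nu)) * cos (g * x + b * g `^ nu).
have [_ c] := @dominated_convergence_Rintegral _ _ _ (@lebesgue_measure R) `[0, +oo[%classic
  (fun n g => expR (- (harmonic n * g)) * f g) f (fun g => expR (- (a * g `^ nu)))
  (measurable_itv _)
  (fun n => ltac:(apply: measurable_funTS; apply: measurable_funM;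
     [apply: measurableT_comp => //; apply: measurableT_comp => //; exact: measurable_funM
     |exact: measurable_density_integrand]))
  (fun g _ => ltac:(rewrite -[X in _ --> X]mul1r; apply: cvgM;
     [exact: cvg_expRN_harmonic|exact: cvg_cst]))
  (integrable0y_expR_powR a0 nu0)
  (fun n g => ltac:(rewrite /= in_itv/= andbT => g0; rewrite !normrM !(ger0_norm (expR_ge0 _));
     rewrite -[leRHS]mul1r ler_pM ?mulr_ge0 ?expR_ge0//;
       [by rewrite expR_le1 oppr_le0 mulr_ge0// ltW// harmonic_gt0
       |by rewrite ler_piMr ?expR_ge0// cos_max])).
rewrite -(cvg_lim _ c)//; apply: limr_ge; first exact: cvgP c.
apply: nearW => n; have := pm (harmonic n) x (harmonic_gt0 n).
rewrite /abel_transform (_ : Rintegral _ _ _ = \int[@lebesgue_measure R]_(g in `[0, +oo[)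
  (expR (- (harmonic n * g)) * f g))//.
apply: eq_Rintegral => g /set_mem gI.
have g0 : 0 <= g by move: gI; rewrite /= in_itv/= andbT.
congr (_ * _).
have E : - stable_exponent a b nu g = (- (a * g `^ nu)) -i* (b * g `^ nu).
  rewrite /stable_exponent (ger0_norm g0); apply/eqP.
  rewrite eq_complex !(Re_oppc, Im_oppc, Re_mulc, Im_mulc)/= !mulr0 subr0 add0r eqxx/=.
  move: g0; rewrite le_eqVlt => /predU1P[<-|g0]; last by rewrite gtr0_sg// mulr1.
  have z : (0 : R) `^ nu = 0 by rewrite powR0 ?gt_eqF.
  by rewrite z !mulr0.
rewrite mulr1 E cexpE -mulrA -cexpiD Re_mulc /= mul0r subr0.
by rewrite -opprD cosN addrC.
Qed.

(** * Integrability for exponents at least one *)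

(** The difference between [F] and the running integral of [P] has derivative d - P >= 0, so it is
    nondecreasing by the mean value theorem. *)
Lemma Rintegral_le_primitive (R : realType) (P F d : R -> R) (a b : R) : a < b ->
  (forall t, a <= t -> {for t, continuous P}) ->
  (forall t, a <= t -> is_derive t (1 : R) F (d t)) ->
  (forall t, a <= t -> P t <= d t) ->
  \int[@lebesgue_measure R]_(t in `[a, b]) P t <= F b - F a.
Proof.
move=> ab cP dF Pd.
have iP u : a < u -> (@lebesgue_measure R).-integrable `[a, u] (EFin \o P).
  move=> au; apply: continuous_compact_integrable; first exact: segment_compact.
  apply: continuous_in_subspaceT => t; rewrite inE/= in_itv/= => /andP[at0 _]; exact: cP.
pose I u := \int[@lebesgue_measure R]_(t in `[a, u]) P t.
have dI u : a < u -> derivable I u 1 /\ derive1 I u = P u.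
  move=> au; apply: (@continuous_FTC1_closed _ P a u (u + 1)).
  - by rewrite ltrDl.
  - by apply: iP; rewrite ltr_wpDr.
  - by [].
  - exact/cP/ltW.
have Ia : I a = 0 by rewrite /I set_itv1 Rintegral_set1.
have dK u : a < u -> is_derive u (1 : R) (fun t => F t - I t) (d u - P u).
  move=> au; have [dIu Iu] := dI u au.
  have dFu := dF u (ltW au).
  have dI' : is_derive u (1 : R) I (P u) by apply: DeriveDef; [exact: dIu|rewrite -derive1E].
  exact: is_deriveB.
have cK : {within `[a, b], continuous (fun t => F t - I t)}.
  have cI := parameterized_integral_continuous (ltW ab) (iP b ab).
  have cF : {within `[a, b], continuous F}.
    apply: derivable_within_continuous => t; rewrite in_itv/= => /andP[at0 _].
    by have := dF t at0 => -[].
  by move=> t; apply: continuousB; [exact: cF|exact: cI].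
have [||c cI E] := @MVT _ (fun t => F t - I t) (fun t => d t - P t) a b ab.
- by move=> t; rewrite in_itv/= => /andP[at0 _]; exact: dK.
- exact: cK.
have : 0 <= (F b - I b) - (F a - I a).
  rewrite E mulr_ge0// ?subr_ge0 ?(ltW ab)//; apply: Pd.
  by move: cI; rewrite in_itv/= => /andP[/ltW].
by rewrite Ia -/(I b); lra.
Qed.

(** Integration by parts in the form of a comparison of derivatives: [F] gathers the boundary terms,
    and the remainder P - F' is never integrated but only bounded by the derivative of [G]. *)
Lemma le_normr_Rintegral_primitive (R : realType) (P F G d e : R -> R) (a b : R) : a < b ->
  (forall t, a <= t -> {for t, continuous P}) ->
  (forall t, a <= t -> is_derive t (1 : R) F (d t)) ->
  (forall t, a <= t -> is_derive t (1 : R) G (e t)) ->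
  (forall t, a <= t -> `|P t - d t| <= e t) ->
  `|\int[@lebesgue_measure R]_(t in `[a, b]) P t - (F b - F a)| <= G b - G a.
Proof.
move=> ab cP dF dG Pde.
have h1 : \int[@lebesgue_measure R]_(t in `[a, b]) P t <= (F b + G b) - (F a + G a).
  apply: (@Rintegral_le_primitive _ P (fun t => F t + G t) (fun t => d t + e t)) => // t at0.
    by have := dF t at0; have := dG t at0 => ? ?; exact: is_deriveD.
  by have := Pde t at0; rewrite ler_norml; lra.
have h2 : \int[@lebesgue_measure R]_(t in `[a, b]) (- P t) <= (- F b + G b) - (- F a + G a).
  apply: (@Rintegral_le_primitive _ (fun t => - P t) (fun t => - F t + G t) (fun t => - d t + e t)) => // t at0.
  - by apply: cvgN; exact: cP.
  - by have := dF t at0; have := dG t at0 => ? ?; apply: is_deriveD.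
  - by have := Pde t at0; rewrite ler_norml; lra.
have E : \int[@lebesgue_measure R]_(t in `[a, b]) (- P t)
    = - \int[@lebesgue_measure R]_(t in `[a, b]) P t.
  under eq_Rintegral do rewrite -mulN1r.
  rewrite RintegralZl ?mulN1r//; apply: continuous_compact_integrable; first exact: segment_compact.
  apply: continuous_in_subspaceT => t; rewrite inE/= in_itv/= => /andP[at0 _]; exact: cP.
by rewrite E in h2; rewrite ler_norml; lra.
Qed.

Lemma expR_poly1_bound (R : realType) (a : R) : 0 < a ->
  exists2 C : R, 0 < C & forall y, 0 <= y -> (1 + y) * expR (- (a * y)) <= C.
Proof.
move=> a0; have [C C0 HC] := @expR_poly_bound R a 0 a0.
exists (1 + C); first by rewrite addr_gt0.
move=> y y0; have := HC y y0; rewrite expr1 => H.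
have e0 := expR_gt0 (a * y).
have e1 : 1 <= expR (a * y) by rewrite -expR0 ler_expR mulr_ge0// ltW.
by rewrite expRN ler_pdivrMr// mulrDl mul1r lerD.
Qed.

Lemma continuous_powR_gt0 (R : realType) (nu : R) (t : R) : 0 < t ->
  {for t, continuous (fun s : R => s `^ nu)}.
Proof.
move=> t0; apply: differentiable_continuous; apply/derivable1_diffP.
by apply: derivable_powR; rewrite in_itv/= t0.
Qed.

Lemma continuous_density_integrand (R : realType) (a b nu x t : R) : 0 < t ->
  {for t, continuous (fun g : R => expR (- (a * g `^ nu)) * cos (g * x + b * g `^ nu))}.
Proof.
move=> t0; have cp := @continuous_powR_gt0 R nu t t0.
apply: cvgM.
  apply: continuous_comp; last exact: continuous_expR.
  by apply: cvgN; apply: cvgM; [exact: cvg_cst|exact: cp].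
apply: continuous_comp; last exact: continuous_cos.
apply: cvgD; first by apply: cvgM => //; exact: cvg_cst.
by apply: cvgM; [exact: cvg_cst|exact: cp].
Qed.

Lemma powR_subr1_le (R : realType) (nu t : R) : 1 <= nu -> 0 < t -> t `^ (nu - 1) <= 1 + t `^ nu.
Proof.
move=> nu1 t0; have [t1|t1] := leP t 1.
  apply: (@le_trans _ _ 1); last by rewrite lerDl powR_ge0.
  have one : 1 `^ (nu - 1) = 1 :> R by rewrite powR1.
  by rewrite -[leRHS]one ge0_ler_powR ?nnegrE ?subr_ge0// ltW.
apply: (@le_trans _ _ (t `^ nu)); last by rewrite lerDr.
by rewrite ler_powR ?(ltW t1)// lerBlDr lerDl.
Qed.

(* Two integrations by parts; the bound is uniform in the endpoints because
   the second derivative of the transform is dominated by the derivative of a bounded function. *)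
Lemma le_normr_density_integral (R : realType) (a b nu : R) : 0 < a -> 1 <= nu ->
  exists2 C : R, 0 <= C & forall x s t : R, x != 0 -> 0 < s -> s <= 1 -> s < t ->
  `|\int[@lebesgue_measure R]_(g in `[s, t])
      (expR (- (a * g `^ nu)) * cos (g * x + b * g `^ nu))|
  <= `|sin (s * x + b * s `^ nu)| / `|x| + expR (- (a * t `^ nu)) / `|x| + C / x ^+ 2.
Proof.
move=> a0 nu1.
pose K := a + `|b|.
have K0 : 0 < K by rewrite ltr_pwDl.
have [C1 C10 HC1] := expR_poly1_bound (divr_gt0 a0 (ltr0n R 2)).
pose E (g : R) := expR (- (a * g `^ nu)).
pose th x (g : R) := g * x + b * g `^ nu.
pose y1 (g : R) := nu * g `^ (nu - 1).
pose y2 (g : R) := nu * ((nu - 1) * g `^ (nu - 1 - 1)).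
(* [F] gathers the boundary terms of two integrations by parts. Its second term is chosen to cancel
   the part of order 1/x in the derivative of the first, and the rest [e] is of order 1/x^2. *)
pose F x g := E g * sin (th x g) / x - y1 g * E g * (a * cos (th x g) + b * sin (th x g)) / x ^+ 2.
pose e x g := E g / x ^+ 2 * (y2 g * (a * cos (th x g) + b * sin (th x g))
  + y1 g ^+ 2 * ((b ^+ 2 - a ^+ 2) * cos (th x g) - 2 * a * b * sin (th x g))).
have E01 (g : R) : 0 <= E g <= 1.
  by rewrite expR_ge0/= expR_le1 oppr_le0 mulr_ge0 ?powR_ge0// ltW.
(* For 1 < nu < 2 the factor g^(nu-2) in [y2] is unbounded at 0; since E is at most 4 C1^2 / (1 +
   g^(nu-1))^2, its term is dominated by the derivative of the bounded function - 1 / (1 +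
   g^(nu-1)). In the term with y1^2, one factor y1 e^(-a g^nu / 2) is bounded and the other is the
   derivative of - (2 / a) e^(-a g^nu / 2). *)
pose A1 := K * nu * (4 * C1 ^+ 2).
pose A2 := K ^+ 2 * nu * C1.
pose G x (g : R) := (A1 * (- (1 + g `^ (nu - 1))^-1) + A2 * (- (2 / a) * expR (- (a / 2 * g `^ nu)))) / x ^+ 2.
pose G' x (g : R) := (A1 * ((nu - 1) * g `^ (nu - 1 - 1) / (1 + g `^ (nu - 1)) ^+ 2)
   + A2 * (y1 g * expR (- (a / 2 * g `^ nu)))) / x ^+ 2.
have A10 : 0 <= A1 by rewrite !mulr_ge0 ?(ltW K0) ?(ltW C10)// (le_trans ler01).
have A20 : 0 <= A2 by rewrite !mulr_ge0 ?(ltW K0) ?(ltW C10)// (le_trans ler01).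
have cs (g x : R) : `|a * cos (th x g) + b * sin (th x g)| <= K.
  rewrite (le_trans (ler_normD _ _))// !normrM (gtr0_norm a0) lerD// ?ler_piMr ?cos_max ?sin_max//.
  exact: ltW.
have cs2 (g x : R) : `|(b ^+ 2 - a ^+ 2) * cos (th x g) - 2 * a * b * sin (th x g)| <= K ^+ 2.
  rewrite (_ : _ - _ = b * (b * cos (th x g) - a * sin (th x g)) - a * (a * cos (th x g) + b * sin (th x g))); last by ring.
  rewrite (le_trans (ler_normB _ _))// !normrM (gtr0_norm a0).
  rewrite (_ : K ^+ 2 = `|b| * K + a * K); last by rewrite /K; ring.
  rewrite lerD// ler_wpM2l// ?(ltW a0)//.
  rewrite (le_trans (ler_normB _ _))// !normrM (gtr0_norm a0) /K addrC lerD// ?ler_piMr ?cos_max ?sin_max//.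
  exact: ltW.
have dF (x g : R) : x != 0 -> 0 < g -> is_derive g (1 : R) (F x) (E g * cos (th x g) - e x g).
  move=> x0 g0; have p1 := is_derive1_powR nu g0; have p2 := is_derive1_powR (nu - 1) g0.
  rewrite /F /E /th /y1.
  apply: is_derive_eq; rewrite /GRing.scale/= /e /E /th /y1 /y2; field.
  exact: x0.
have dG (x g : R) : x != 0 -> 0 < g -> is_derive g (1 : R) (G x) (G' x g).
  move=> x0 g0; have p1 := is_derive1_powR nu g0; have p2 := is_derive1_powR (nu - 1) g0.
  have n0 : 1 + g `^ (nu - 1) != 0 by rewrite gt_eqF// ltr_wpDr ?powR_ge0.
  have p3 : is_derive g (1 : R) (fun t : R => (1 + t `^ (nu - 1))^-1)
     (- ((nu - 1) * g `^ (nu - 1 - 1)) / (1 + g `^ (nu - 1)) ^+ 2).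
    by apply: is_derive_eq; rewrite /GRing.scale/=; field.
  rewrite /G; apply: is_derive_eq; rewrite /GRing.scale/= /G' /y1; field.
  by rewrite x0 n0 gt_eqF.
have eG (x g : R) : x != 0 -> 0 < g -> `|e x g| <= G' x g.
  move=> x0 g0; have x20 : 0 < x ^+ 2 by rewrite exprn_even_gt0.
  have [E0 _] := andP (E01 g).
  rewrite /e /G' normrM normrM (ger0_norm E0) normfV (gtr0_norm x20) mulrAC ler_wpM2r ?invr_ge0 ?(ltW x20)//.
  rewrite (le_trans (ler_wpM2l E0 (ler_normD _ _)))// mulrDr (normrM (y2 g)) (normrM (y1 g ^+ 2)).
  have y10 : 0 <= y1 g by rewrite mulr_ge0 ?powR_ge0// (le_trans ler01).
  have y20 : 0 <= y2 g by rewrite !mulr_ge0 ?powR_ge0 ?subr_ge0// (le_trans ler01).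
  have yge0 := powR_ge0 g nu.
  have EE : E g = expR (- (a / 2 * g `^ nu)) * expR (- (a / 2 * g `^ nu)).
    by rewrite -expRD /E; congr expR; field.
  have HE := HC1 _ yge0; set e2 := expR (- (a / 2 * g `^ nu)) in EE HE *.
  have e20 : 0 <= e2 by exact: expR_ge0.
  have q1 := powR_subr1_le nu1 g0; have q0 := powR_ge0 g (nu - 1).
  have q2 : (1 + g `^ (nu - 1)) * e2 <= 2 * C1.
    rewrite (@le_trans _ _ (2 * ((1 + g `^ nu) * e2)))//; last by rewrite ler_wpM2l.
    by rewrite mulrA ler_wpM2r//; lra.
  rewrite lerD//.
    rewrite (ger0_norm y20) mulrCA.
    have p0 : 0 < (1 + g `^ (nu - 1)) ^+ 2 by rewrite exprn_gt0// ltr_wpDr.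
    have q3 : E g <= 4 * C1 ^+ 2 / (1 + g `^ (nu - 1)) ^+ 2.
      rewrite ler_pdivlMr// EE.
      have -> : 4 * C1 ^+ 2 = (2 * C1) ^+ 2 by ring.
      rewrite (_ : e2 * e2 * _ = ((1 + g `^ (nu - 1)) * e2) ^+ 2); last by ring.
      by rewrite lerXn2r ?nnegrE ?mulr_ge0 ?addr_ge0 ?(ltW C10).
    rewrite (_ : A1 * _ = y2 g * (4 * C1 ^+ 2 / (1 + g `^ (nu - 1)) ^+ 2 * K)); last first.
      by rewrite /A1 /y2; ring.
    by rewrite ler_wpM2l// ler_pM.
  rewrite normrX (ger0_norm y10).
  have q3 : y1 g * e2 <= nu * C1.
    rewrite /y1 -mulrA ler_wpM2l ?(le_trans ler01)// (le_trans _ HE)// ler_wpM2r//.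
  rewrite EE (_ : e2 * e2 * _ = y1 g * e2 * `|(b ^+ 2 - a ^+ 2) * cos (th x g) - 2 * a * b * sin (th x g)| * (y1 g * e2)); last by ring.
  rewrite (_ : A2 * _ = nu * C1 * K ^+ 2 * (y1 g * e2)); last by rewrite /A2; ring.
  apply: ler_wpM2r; first exact: mulr_ge0.
  by apply: ler_pM => //; exact: mulr_ge0.
pose C := K * nu + K * (nu * C1) + A1 + A2 * (2 / a).
have nu0 : 0 <= nu by exact: le_trans nu1.
have c1 : 0 <= K * nu by apply: mulr_ge0 => //; exact: ltW.
have c2 : 0 <= K * (nu * C1) by apply: mulr_ge0; [exact: ltW|apply: mulr_ge0 => //; exact: ltW].
have c3 : 0 <= A2 * (2 / a) by apply: mulr_ge0 => //; apply: divr_ge0 => //; exact: ltW.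
exists C; first by do 3 (apply: addr_ge0 => //).
move=> x s t x0 s0 s1 st.
have x20 : 0 < x ^+ 2 by rewrite exprn_even_gt0.
have t0 : 0 < t by exact: lt_trans st.
have H := @le_normr_Rintegral_primitive R (fun g => E g * cos (th x g)) (F x) (G x)
  (fun g => E g * cos (th x g) - e x g) (G' x) s t st
  (fun g sg => @continuous_density_integrand R a b nu x g (lt_le_trans s0 sg))
  (fun g sg => dF x g x0 (lt_le_trans s0 sg))
  (fun g sg => dG x g x0 (lt_le_trans s0 sg)).
have {}H := H (fun g sg => ltac:(rewrite opprB addrC subrK; exact: eG x0 (lt_le_trans s0 sg))).
have bF (g : R) : 0 < g -> `|F x g| <= E g * `|sin (th x g)| / `|x| + y1 g * E g * K / x ^+ 2.
  move=> g0; have [E0 _] := andP (E01 g).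
  have y10 : 0 <= y1 g by rewrite mulr_ge0 ?powR_ge0.
  have e1 : `|E g * sin (th x g) / x| = E g * `|sin (th x g)| / `|x|.
    by rewrite normrM normfV normrM (ger0_norm E0).
  have e2 : `|y1 g * E g * (a * cos (th x g) + b * sin (th x g)) / x ^+ 2|
     = y1 g * E g * `|a * cos (th x g) + b * sin (th x g)| / x ^+ 2.
    by rewrite normrM normfV (gtr0_norm x20) (normrM (y1 g * E g)) (ger0_norm (mulr_ge0 y10 E0)).
  rewrite /F (le_trans (ler_normB _ _))// e1 e2 lerD2l ler_wpM2r ?invr_ge0 ?(ltW x20)//.
  apply: ler_wpM2l; [exact: mulr_ge0|exact: cs].
have nx0 : 0 < `|x| by rewrite normr_gt0.
have bs : `|F x s| <= `|sin (th x s)| / `|x| + K * nu / x ^+ 2.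
  rewrite (le_trans (bF s s0))// lerD//.
    by rewrite ler_wpM2r ?invr_ge0 ?(ltW nx0)// ler_piMl//; case/andP: (E01 s).
  rewrite ler_wpM2r ?invr_ge0 ?(ltW x20)// mulrC ler_wpM2l ?(ltW K0)//.
  have h : s `^ (nu - 1) <= 1.
    have one : 1 `^ (nu - 1) = 1 :> R by rewrite powR1.
    by rewrite -[leRHS]one ge0_ler_powR ?nnegrE ?subr_ge0 ?ler01 ?(ltW s0).
  have [E0 E1] := andP (E01 s).
  rewrite -[leRHS]mulr1 ler_pM ?mulr_ge0 ?powR_ge0// /y1 ler_piMr//.
have bt : `|F x t| <= E t / `|x| + K * (nu * C1) / x ^+ 2.
  rewrite (le_trans (bF t t0))// lerD//.
    rewrite ler_wpM2r ?invr_ge0 ?(ltW nx0)// ler_piMr ?sin_max//; by case/andP: (E01 t).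
  rewrite ler_wpM2r ?invr_ge0 ?(ltW x20)// mulrC ler_wpM2l ?(ltW K0)// /y1 -mulrA ler_wpM2l//.
  rewrite (le_trans _ (HC1 _ (powR_ge0 t nu)))// ler_pM ?powR_ge0 ?expR_ge0 ?powR_subr1_le//.
  by rewrite ler_expR lerN2 ler_wpM2r ?powR_ge0// ler_pdivrMr// ler_peMr ?ler1n// ltW.
have bG : G x t - G x s <= (A1 + A2 * (2 / a)) / x ^+ 2.
  rewrite /G -mulrBl ler_wpM2r ?invr_ge0 ?(ltW x20)//.
  have := powR_ge0 t (nu - 1); have := powR_ge0 s (nu - 1) => ps pt.
  have i1 : 0 <= (1 + t `^ (nu - 1))^-1 by rewrite invr_ge0 addr_ge0.
  have i2 : (1 + s `^ (nu - 1))^-1 <= 1 by rewrite invf_le1 ?lerDl// ltr_wpDr.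
  have i3 := expR_ge0 (- (a / 2 * t `^ nu)).
  have i4 : expR (- (a / 2 * s `^ nu)) <= 1.
    by rewrite expR_le1 oppr_le0 mulr_ge0 ?powR_ge0// divr_ge0// ltW.
  have a2 : 0 < 2 / a by rewrite divr_gt0.
  rewrite (_ : _ - _ = A1 * ((1 + s `^ (nu - 1))^-1 - (1 + t `^ (nu - 1))^-1)
     + A2 * (2 / a * (expR (- (a / 2 * s `^ nu)) - expR (- (a / 2 * t `^ nu))))); last by ring.
  rewrite lerD//; first by rewrite ler_piMr// lerBlDr (le_trans i2)// lerDl.
  by rewrite ler_wpM2l// ler_piMr ?(ltW a2)// lerBlDr (le_trans i4)// lerDl.
set I := Rintegral _ _ _ in H *.
have : `|I| <= `|F x s| + `|F x t| + (G x t - G x s).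
  have -> : I = (I - (F x t - F x s)) + (F x t - F x s) by ring.
  rewrite (le_trans (ler_normD _ _))// addrC lerD// (le_trans (ler_normB _ _))// addrC//.
move=> /le_trans; apply.
rewrite (_ : C / x ^+ 2 = K * nu / x ^+ 2 + K * (nu * C1) / x ^+ 2 + (A1 + A2 * (2 / a)) / x ^+ 2); last first.
  by rewrite /C; ring.
apply: le_trans (lerD (lerD bs bt) bG) _; rewrite addrACA !addrA; exact: lexx.
Qed.


Lemma cvg_Rintegral_exhaustion d (T : measurableType d) (R : realType)
    (m : {measure set T -> \bar R}) (D : set T) (D_ : nat -> set T) (f : T -> R) :
  measurable D -> (forall n, measurable (D_ n)) -> (forall n, D_ n `<=` D) ->
  (forall x, D x -> \forall n \near \oo, D_ n x) -> m.-integrable D (EFin \o f) ->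
  \int[m]_(x in D_ n) f x @[n --> \oo] --> \int[m]_(x in D) f x.
Proof.
move=> mD mD_ sub nD fi.
rewrite (_ : (fun n => _) = (fun n => \int[m]_(x in D) (f \_ (D_ n)) x)); last first.
  apply/funext => n; rewrite -Rintegral_mkcondr; congr (Rintegral _ _ _).
  exact/esym/setIidr/sub.
have mf : measurable_fun D f by apply/measurable_EFinP; exact: measurable_int fi.
apply: (proj2 (@dominated_convergence_Rintegral _ _ _ m D
    (fun n => f \_ (D_ n)) f (fun x => `|f x|) _ _ _ _ _)) => //.
- move=> n; apply/(measurable_restrict f) => //.
  by apply: measurable_funS mf => // x [].
- move=> x Dx; apply: cvg_near_cst; near=> n; rewrite patchE ifT// inE.
  by near: n; exact: nD.
- exact: integrable_norm.
- by move=> n x _; rewrite /= patchE; case: ifP => // _; rewrite normr0.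
Unshelve. all: by end_near.
Qed.

(** These intervals avoid 0, where the integrations by parts break down, and satisfy 1 / (n+1) <= 1
    < n + 2, as the uniform estimate requires. *)
Lemma cvg_Rintegral_itvV (R : realType) (f : R -> R) :
  (@lebesgue_measure R).-integrable `[0, +oo[ (EFin \o f) ->
  \int[@lebesgue_measure R]_(g in `[n.+1%:R^-1, n.+2%:R]) f g @[n --> \oo] -->
  \int[@lebesgue_measure R]_(g in `[0, +oo[) f g.
Proof.
move=> fi.
have fi' : (@lebesgue_measure R).-integrable `]0, +oo[ (EFin \o f).
  by apply: integrableS fi => //; apply: subset_itvr; rewrite bnd_simp.
rewrite -(Rintegral_itv_obnd_cbnd fi'); apply: cvg_Rintegral_exhaustion => // [n|] x /=.
  rewrite !in_itv/= andbT => /andP[+ _]; apply: lt_le_trans.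
  by rewrite invr_gt0.
rewrite in_itv/= andbT => x0; near=> n; rewrite /= in_itv/=; apply/andP; split.
  rewrite -[leRHS]invrK lef_pV2 ?posrE ?invr_gt0// (@le_trans _ _ n%:R) ?ler_nat//.
  by near: n; exact: nbhs_infty_ger.
rewrite (@le_trans _ _ n%:R)//; first by near: n; exact: nbhs_infty_ger.
by rewrite ler_nat (leq_trans (leqnSn _)).
Unshelve. all: by end_near.
Qed.

(** Of the three terms of the uniform estimate, the one at the lower end vanishes because the sine
    does so at 0, the one at the upper end by exponential decay, and C / x^2 remains. *)
Lemma stable_density_le_invsqr (R : realType) (a b nu : R) : 0 < a -> 1 <= nu ->
  exists2 C : R, 0 <= C & forall x, x != 0 -> `|stable_density a b nu x| <= C / x ^+ 2.
Proof.
move=> a0 nu1; have nu0 : 0 < nu by exact: lt_le_trans nu1.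
have [C C0 H] := le_normr_density_integral b a0 nu1.
exists (pi^-1 * C); first by rewrite mulr_ge0 ?invr_ge0 ?pi_ge0.
move=> x x0; rewrite normrM ger0_norm ?invr_ge0 ?pi_ge0// -mulrA ler_wpM2l ?invr_ge0 ?pi_ge0//.
have c := cvg_Rintegral_itvV (integrable_density_integrand b x a0 nu0).
have inv0 : (n.+1%:R^-1 : R) @[n --> \oo] --> (0 : R) by exact: cvg_harmonic.
have c2 : (`|sin (n.+1%:R^-1 * x + b * n.+1%:R^-1 `^ nu)| / `|x| + expR (- (a * n.+2%:R `^ nu)) / `|x| + C / x ^+ 2)
   @[n --> \oo] --> (`|sin (0 * x + b * 0 `^ nu)| / `|x| + 0 / `|x| + C / x ^+ 2).
  apply: cvgD; last exact: cvg_cst.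
  apply: cvgD.
    have cc : continuous (fun g : R => `|sin (g * x + b * `|g| `^ nu)| / `|x|).
      have cS : continuous (fun g : R => sin (g * x + b * `|g| `^ nu)).
        move=> g; apply: continuous_comp; last exact: continuous_sin.
        apply: cvgD; first by apply: cvgM; [exact: cvg_id|exact: cvg_cst].
        by apply: cvgM; [exact: cvg_cst|exact: continuous_norm_powR].
      by move=> g; apply: cvgM; [exact: cvg_norm (cS g)|exact: cvg_cst].
    have := cvg_comp _ _ inv0 (cc 0); rewrite normr0; apply: cvg_trans.
    apply: near_eq_cvg; near=> n; rewrite /= (@ger0_norm _ n.+1%:R^-1)//.
  apply: cvgM; last exact: cvg_cst.
  have h2 : expR (- (a * n.+2%:R)) @[n --> \oo] --> (0 : R).
    apply: (@cvg_comp _ _ _ (fun n : nat => n.+2%:R) (fun x : R => expR (- (a * x))) _ (+oo : set_system R)).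
      apply/cvgryPge => A; near=> n; rewrite (@le_trans _ _ n%:R)//; last by rewrite ler_nat (leq_trans (leqnSn _)).
      by near: n; exact: nbhs_infty_ger.
    exact: cvg_expRN_scale.
  apply: squeeze_cvgr h2; last exact: (@cvg_cst _ 0).
  near=> n; rewrite expR_ge0/= ler_expR lerN2 ler_wpM2l ?(ltW a0)//.
  by rewrite -[leLHS]powRr1// ler_powR// ler1n.
rewrite powR0 ?gt_eqF// mul0r mulr0 addr0 sin0 normr0 !mul0r !add0r in c2.
rewrite -(cvg_lim _ c2)// -(cvg_lim _ (cvg_norm c))//.
apply: ler_lim.
- by apply/cvg_ex; eexists; exact: cvg_norm c.
- by apply/cvg_ex; eexists; exact: c2.
near=> n; apply: H => //; first by rewrite invf_le1// ler1n.
by rewrite (@le_lt_trans _ _ 1)// ?invf_le1 ?ler1n// ltr1n.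
Unshelve. all: by end_near.
Qed.

Lemma integrable_stable_density_ge1 (R : realType) (a b nu : R) : 0 < a -> 1 <= nu ->
  (@lebesgue_measure R).-integrable setT (EFin \o stable_density a b nu).
Proof.
move=> a0 nu1; have nu0 : 0 < nu by exact: lt_le_trans nu1.
have [B HB] := stable_density_bounded b a0 nu0.
have B0 : 0 <= B by exact: le_trans (normr_ge0 _) (HB 0).
have [C C0 HC] := stable_density_le_invsqr b a0 nu1.
apply: (@le_integrable_EFin _ _ _ (@lebesgue_measure R) _ _ (fun x => (B + C) * (1 + x ^+ 2)^-1)) => //.
- exact: measurable_stable_density.
- by apply: integrable_scale => //; exact: integrableT_oneDsqrV.
move=> x _ /=; rewrite ler_pdivlMr ?ltr_wpDr ?sqr_ge0// mulrDr mulr1.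
apply: lerD; first exact: HB.
have [->|x0] := eqVneq x 0; first by rewrite expr0n/= mulr0.
by rewrite -ler_pdivlMr ?exprn_even_gt0//; exact: HC.
Qed.

(** * Laws with a density and Poisson kernels *)

(** The law of [X] is absolutely continuous, and its Radon-Nikodym derivative agrees almost
    everywhere with [f] cut off to [D]. This gives the transfer formula for signed [F] directly. *)
Lemma Rintegral_density d (T : measurableType d) (R : realType) (P : probability T R)
    (X : {RV P >-> R}) (D : set R) (f F : R -> R) :
  measurable D -> has_density X D f -> measurable_fun setT F ->
  P.-integrable setT (EFin \o (F \o X)) ->
  \int[@lebesgue_measure R]_(s in D) (F s * f s) = \int[P]_w F (X w).
Proof.
move=> mD [mf f0 Xf] mF iF.
pose mu : {sigma_finite_measure set (measurableTypeR R) -> \bar R} := @lebesgue_measure R.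
(* [R] and [measurableTypeR R], the domain of [lebesgue_measure], have the same measurable sets
   but different displays. *)
have mX0 : measurable_fun setT X by exact: measurable_funPT.
have mX : @measurable_fun _ _ T (measurableTypeR R) setT X by move=> mT Y mY; exact: (mX0 mT Y mY).
pose X' : {mfun T >-> measurableTypeR R} :=
  HB.pack (X : T -> measurableTypeR R) (isMeasurableFun.Build _ _ T (measurableTypeR R) X mX).
pose nu : probability (measurableTypeR R) R := distribution P X'.
have mfD : measurable_fun setT (f \_ D) by apply/(measurable_restrict f); rewrite ?setTI.
have nuE (A : set R) : measurable A -> nu A = (\int[mu]_(x in A) ((f \_ D) x)%:E)%E.
  move=> mA; rewrite [LHS]Xf// integral_mkcondr; apply: eq_integral => x _.
  by rewrite restrict_EFin.
have numu : nu `<< mu.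
  apply/null_content_dominatesP => A mA A0; rewrite nuE//.
  by apply: null_set_integral => //; apply/measurable_EFinP; exact: measurable_funTS.
have fD0 x : 0 <= (f \_ D) x by rewrite patchE; case: ifPn => // /set_mem/f0.
have ifD : mu.-integrable setT (EFin \o f \_ D).
  apply/integrableP; split; first exact/measurable_EFinP.
  under eq_integral do rewrite /= ger0_norm//.
  by rewrite -nuE// probability_setT ltry.
have ae : ae_eq mu setT (EFin \o f \_ D) (Radon_Nikodym (charge_of_finite_measure nu) mu).
  apply: integral_ae_eq => //.
  move=> A _ mA; rewrite -Radon_Nikodym_integral//.
  by rewrite -nuE.
rewrite Rintegral_mkcond.
rewrite /Rintegral; congr fine.
have inu : nu.-integrable setT (EFin \o F).
  apply/integrableP; split; first exact/measurable_EFinP.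
  rewrite ge0_integral_distribution//; last exact/measurableT_comp/measurable_EFinP.
  by case/integrableP : iF.
rewrite -(@integral_distribution _ _ _ _ _ P X' (EFin \o F))//; last exact/measurable_EFinP.
rewrite -(@Radon_Nikodym_change_of_variables _ _ _ nu mu)//.
apply: ae_eq_integral => //.
- by apply/measurable_EFinP; apply/(measurable_restrict (fun s => F s * f s)); rewrite ?setTI//; apply: measurable_funM => //; exact: measurable_funTS.
- by apply: emeasurable_funM => //; exact/measurable_EFinP.
- apply: filterS ae => x /= /(_ I) <- _.
  by rewrite !patchE; case: ifPn => _; rewrite ?EFinM// mule0.
Qed.

Lemma Rintegral_swap_cos d (T : measurableType d) (R : realType) (P : probability T R)
    (X : {RV P >-> R}) (E : set T) (D : set R) (k p c : R -> R) :
  measurable E -> measurable D ->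
  measurable_fun setT k -> measurable_fun setT p -> measurable_fun setT c ->
  (@lebesgue_measure R).-integrable D (EFin \o k) ->
  P.-integrable E (EFin \o (fun w => \int[@lebesgue_measure R]_(g in D) (k g * cos (p g * X w + c g)))) /\
  \int[P]_(w in E) \int[@lebesgue_measure R]_(g in D) (k g * cos (p g * X w + c g))
  = \int[@lebesgue_measure R]_(g in D) (k g * \int[P]_(w in E) cos (p g * X w + c g)).
Proof.
move=> mE mD mk mp mc ik.
have mX : measurable_fun setT X by exact: measurable_funPT.
pose f w (g : R) := k g * cos (p g * X w + c g).
have mf : measurable_fun setT (fun z : T * R => f z.1 z.2).
  apply: measurable_funM; first exact: measurableT_comp mk measurable_snd.
  apply: measurableT_comp; first exact: measurable_cos.
  apply: measurable_funD; last exact: measurableT_comp mc measurable_snd.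
  apply: measurable_funM; first exact: measurableT_comp mp measurable_snd.
  exact: measurableT_comp mX measurable_fst.
have i1 : P.-integrable E (EFin \o (fun=> 1)).
  by apply: finite_measure_integrable_cst.
have [H1 H2] := @Rintegral_swap _ _ T (measurableTypeR R) R P (@lebesgue_measure R)
   E D f (fun=> 1) (fun g => `|k g|) mE mD mf i1 (integrable_norm ik)
   (fun w g _ _ => ltac:(rewrite mul1r normrM ler_piMr ?cos_max//)).
split=> //; rewrite H2; apply: eq_Rintegral => g _; rewrite /f RintegralZl//.
apply: le_integrable_EFin i1 _ => //.
  apply: measurable_funTS; apply: measurableT_comp; first exact: measurable_cos.
  by apply: measurable_funD => //; apply: measurable_funM.
by move=> w _; exact: cos_max.
Qed.

(** The kernel is the cosine transform of e^(-e g), so by Fubini its mean under the law of [X]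
    depends on the characteristic function alone. *)
Lemma Rintegral_poisson_kernel d (T : measurableType d) (R : realType) (P : probability T R)
    (X : {RV P >-> R}) (e y : R) : 0 < e ->
  P.-integrable setT (EFin \o (fun w => e / (e ^+ 2 + (X w - y) ^+ 2))) /\
  \int[P]_w (e / (e ^+ 2 + (X w - y) ^+ 2))
  = \int[@lebesgue_measure R]_(g in `[0, +oo[)
      (expR (- (e * g)) * \int[P]_w cos (g * X w - g * y)).
Proof.
move=> e0.
have me : measurable_fun setT (fun g : R => expR (- (e * g))).
  by apply: measurableT_comp => //; apply: measurableT_comp => //; exact: measurable_funM.
have mc : measurable_fun setT (fun g : R => - (g * y)).
  by apply: measurableT_comp => //; exact: measurable_funM.
have mD : measurable (`[0, +oo[ : set R) by [].
have [H1 H2] := @Rintegral_swap_cos _ T R P X setT `[0, +oo[ (fun g => expR (- (e * g))) id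
  (fun g => - (g * y)) measurableT mD me (@measurable_id _ _ _) mc (integrable0y_expRN e0).
have h w : \int[@lebesgue_measure R]_(g in `[0, +oo[)
     (expR (- (e * g)) * cos (g * X w + - (g * y))) = e / (e ^+ 2 + (X w - y) ^+ 2).
  have := @Rintegral_expR_cos R e (X w - y) 0 e0; rewrite cos0 sin0 mulr1 mulr0 subr0 => <-.
  by apply: eq_Rintegral => g _; rewrite addr0; congr (_ * cos _); ring.
split; last by rewrite -H2; apply: eq_Rintegral => w _; rewrite h.
by apply: eq_integrable H1 => // w _; rewrite /= h.
Qed.

Lemma Rintegral_cos_char_fun d (T : measurableType d) (R : realType) (P : probability T R)
    (X : {RV P >-> R}) (g c : R) :
  \int[P]_w cos (g * X w + c)
  = complex.Re (char_fun P X g) * cos c - complex.Im (char_fun P X g) * sin c.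
Proof.
have mX : measurable_fun setT X by exact: measurable_funPT.
have i1 : P.-integrable setT (EFin \o (fun=> 1)) by exact: finite_measure_integrable_cst.
have mg : measurable_fun setT (fun w => g * X w) by exact: measurable_funM.
have ic : P.-integrable setT (EFin \o (fun w => cos (g * X w))).
  apply: le_integrable_EFin i1 _ => //; last by move=> w _; exact: cos_max.
  by apply: measurableT_comp mg; exact: measurable_cos.
have is' : P.-integrable setT (EFin \o (fun w => sin (g * X w))).
  apply: le_integrable_EFin i1 _ => //; last by move=> w _; exact: sin_max.
  by apply: measurableT_comp mg; apply: continuous_measurable_fun; exact: continuous_sin.
have -> : complex.Re (char_fun P X g) = \int[P]_w cos (g * X w).
  by rewrite /char_fun /Cintegral/=; apply: eq_Rintegral => w _; rewrite /cexp/= ; simpc; rewrite /= expR0 !mul1r.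
have -> : complex.Im (char_fun P X g) = \int[P]_w sin (g * X w).
  by rewrite /char_fun /Cintegral/=; apply: eq_Rintegral => w _; rewrite /cexp/= ; simpc; rewrite /= expR0 !mul1r.
under eq_Rintegral do rewrite cosD.
rewrite RintegralB//; first by rewrite !RintegralZr.
- by under eq_fun do rewrite mulrC; exact: integrable_scale.
- by under eq_fun do rewrite mulrC; exact: integrable_scale.
Qed.

(** * Negative moments of the stable subordinator *)

Lemma stable_subordinator_cos d (T : measurableType d) (R : realType) (P : probability T R)
    (theta : R) (S : R -> {RV P >-> R}) (t g c : R) :
  0 < theta -> stable_subordinator theta S -> 0 < t -> 0 <= g ->
  \int[P]_w cos (g * S t w + c)
  = expR (- (t * cos (pi * theta / 2) * g `^ theta))
    * cos (c + t * sin (pi * theta / 2) * g `^ theta).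
Proof.
move=> th0 [_ _ hS] t0 g0; rewrite Rintegral_cos_char_fun hS// ger0_norm//.
have [->|gn0] := eqVneq g 0.
  rewrite powR0 ?gt_eqF// !mulr0 oppr0 mul0r cexp0 oppr0 expR0 addr0 !mul1r/=; ring.
have -> : Num.sg g = 1 by rewrite gtr0_sg// lt0r gn0.
set k := theta * pi / 2 * 1.
have -> : pi * theta / 2 = k by rewrite /k mulr1 (mulrC pi).
have -> : cexp (- 'i%C * k%:C) = cos k -i* sin k.
  by rewrite /cexp mulNr; simpc; rewrite /= expR0 !mul1r cosN sinN.
set q := t * g `^ theta.
have -> : cexp (- q%:C * (cos k -i* sin k)) = (expR (- (q * cos k)))%:C * (cos (q * sin k) +i* sin (q * sin k)).
  by rewrite /cexp !Re_mulc !Im_mulc /= oppr0 !mul0r subr0 addr0 mulrNN mulNr.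
rewrite (_ : t * cos k * _ = q * cos k); last by rewrite /q; ring.
rewrite (_ : t * sin k * _ = q * sin k); last by rewrite /q; ring.
simpc; rewrite /= cosD; ring.
Qed.

Lemma Rintegral_ge_probability d (T : measurableType d) (R : realType) (P : probability T R)
    (f : T -> R) (A : set T) (c : R) : measurable A ->
  P.-integrable setT (EFin \o f) -> (forall w, 0 <= f w) -> (forall w, A w -> c <= f w) ->
  c * fine (P A) <= \int[P]_w f w.
Proof.
move=> mA fi f0 cf.
have i1 : P.-integrable A (EFin \o (fun=> c)) by exact: finite_measure_integrable_cst.
rewrite -Rintegral_cst//.
have fA : P.-integrable A (EFin \o f) by exact: integrableS fi.
apply: (@le_trans _ _ (\int[P]_(w in A) f w)); first exact: le_Rintegral.
rewrite /Rintegral fine_le//; first exact: integrable_fin_num.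
  exact: integrable_fin_num.
apply: ge0_subset_integral => //; first by case/integrableP : fi.
by move=> w _; rewrite lee_fin.
Qed.

(** On the event, the kernel of width x centred at 0 is at least 1 / (2x). Its mean is bounded by
    the integral of the modulus of the characteristic function. *)
Lemma small_ball_stable d (T : measurableType d) (R : realType) (P : probability T R)
    (theta : R) (S : R -> {RV P >-> R}) (t x : R) :
  0 < theta -> theta < 1 -> stable_subordinator theta S -> 0 < t -> 0 < x ->
  fine (P [set w | 0 <= S t w <= x]) <=
  2 * x * \int[@lebesgue_measure R]_(g in `[0, +oo[) expR (- (t * cos (pi * theta / 2) * g `^ theta)).
Proof.
move=> th0 th1 hS t0 x0.
have a0 : 0 < t * cos (pi * theta / 2).
  rewrite mulr_gt0// cos_gt0_pihalf//; have := pi_gt0 R => p0; apply/andP; split; nra.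
set A := [set w | _].
have mS : measurable_fun setT (S t) by exact: measurable_funPT.
have mA : measurable A.
  rewrite (_ : A = S t @^-1` `[0, x]); last by apply/seteqP; split=> w; rewrite /A /= in_itv.
  by rewrite -[X in measurable X]setTI; exact: mS.
have [H1 H2] := @Rintegral_poisson_kernel _ T R P (S t) x 0 x0.
have H3 : (2 * x)^-1 * fine (P A) <= \int[P]_w (x / (x ^+ 2 + (S t w - 0) ^+ 2)).
  apply: Rintegral_ge_probability => //.
    by move=> w; rewrite divr_ge0 ?(ltW x0)// addr_ge0// sqr_ge0.
  move=> w /andP[w0 wx]; rewrite subr0.
  have q : 0 < x ^+ 2 + S t w ^+ 2 by rewrite ltr_wpDr ?sqr_ge0// exprn_gt0.
  rewrite -[leLHS]mul1r ler_pdivrMr ?mulr_gt0// mulrAC ler_pdivlMr// mul1r; nra.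
rewrite -ler_pdivrMl ?mulr_gt0//; apply: (le_trans H3); rewrite H2.
set a := t * cos _ in a0 *; pose b := t * sin (pi * theta / 2).
have -> : \int[@lebesgue_measure R]_(g in `[0, +oo[) (expR (- (x * g)) * \int[P]_w cos (g * S t w - g * 0))
  = \int[@lebesgue_measure R]_(g in `[0, +oo[) (expR (- (x * g)) * (expR (- (a * g `^ theta)) * cos (g * 0 + b * g `^ theta))).
  apply: eq_Rintegral => g; rewrite inE /= in_itv/= andbT => g0.
  by rewrite (stable_subordinator_cos (- (g * 0)) th0 hS t0 g0) mulr0 oppr0.
have bnd (g : R) : 0 <= g -> `|expR (- (x * g)) * (expR (- (a * g `^ theta)) * cos (g * 0 + b * g `^ theta))|
    <= expR (- (a * g `^ theta)).
  move=> g0; rewrite !normrM !(ger0_norm (expR_ge0 _)) mulrCA ler_piMr ?expR_ge0//.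
  by rewrite mulr_ile1 ?expR_ge0 ?cos_max// expR_le1 oppr_le0 mulr_ge0// ltW.
apply: le_Rintegral => //.
- apply: le_integrable_EFin (integrable0y_expR_powR a0 th0) _ => //.
    apply: measurable_funTS; apply: measurable_funM; last exact: measurable_density_integrand.
    by apply: measurableT_comp => //; apply: measurableT_comp => //; exact: measurable_funM.
  by move=> g; rewrite /= in_itv/= andbT; exact: bnd.
- exact: integrable0y_expR_powR.
by move=> g; rewrite /= in_itv/= andbT => g0; exact: le_trans (ler_norm _) (bnd g g0).
Qed.

Lemma le_measure_ae d (T : measurableType d) (R : realType) (m : {measure set T -> \bar R})
    (A B : set T) : measurable A -> measurable B ->
  {ae m, forall w, A w -> B w} -> (m A <= m B)%E.
Proof.
move=> mA mB [N [mN N0 sub]].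
rewrite (le_trans (@le_measure _ _ _ m A (B `|` N) _ _ _)) ?inE//.
- exact: measurableU.
- move=> w Aw; have [Bw|nBw] := pselect (B w); [by left|right].
  by apply: sub => /= /(_ Aw).
- by apply: (le_trans (measureU2 _ mB mN)); rewrite [X in (_ + X)%E]N0 adde0.
Qed.

Lemma stable_subordinator_le_pow d (T : measurableType d) (R : realType) (P : probability T R)
    (theta : R) (S : R -> {RV P >-> R}) (t : R) (n : nat) :
  0 < theta -> theta < 1 -> stable_subordinator theta S -> 0 < t ->
  exists2 C : R, 0 <= C & forall x, 0 < x -> fine (P [set w | S t w <= x]) <= (C * x) ^+ n.+1.
Proof.
move=> th0 th1 hS t0.
pose u := t / n.+1%:R.
have u0 : 0 < u by rewrite divr_gt0.
pose C := 2 * \int[@lebesgue_measure R]_(g in `[0, +oo[) expR (- (u * cos (pi * theta / 2) * g `^ theta)).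
exists C; first by rewrite mulr_ge0//; apply: Rintegral_ge0 => g _; exact: expR_ge0.
move=> x x0.
have [[S0 st ind] mono _] := hS.
have mP (A : set R) s : measurable A -> measurable (S s @^-1` A).
  by move=> mA; rewrite -[X in measurable X]setTI; exact: (measurable_funPT (S s)).
have mle s : measurable [set w | S s w <= x].
  have := @mP `]-oo, x]%classic s; rewrite (_ : _ @^-1` _ = [set w | S s w <= x]); first exact.
  by apply/seteqP; split=> w /=; rewrite in_itv.
have q1 : fine (P [set w | S u w <= x]) <= C * x.
  have := small_ball_stable th0 th1 hS u0 x0; rewrite mulrAC -/C; apply: le_trans.
  have mI : measurable [set w | 0 <= S u w <= x].
    have := @mP `[0, x]%classic u; rewrite (_ : _ @^-1` _ = [set w | 0 <= S u w <= x]); first exact.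
    by apply/seteqP; split=> w /=; rewrite in_itv.
  apply: fine_le; [exact: fin_num_measure|exact: fin_num_measure|].
  (* Almost surely [S] starts at 0 and is nondecreasing, so [S u] is nonnegative and the lower bound
     in the event costs nothing. *)
  apply: le_measure_ae => //; apply: filterS2 S0 mono => w w0 wm /= wx.
  by rewrite wx andbT -w0 wm// ltW.
pose tt (i : nat) := i%:R * u.
have mA (i : nat) : measurable (`]-oo, x]%classic : set R) by [].
have tt0 : 0 <= tt 0%N by rewrite /tt mul0r.
have ttS i : tt i.+1 = tt i + u by rewrite /tt -natr1 mulrDl mul1r.
have tti i : 0 <= tt i by rewrite mulr_ge0// ltW.
have H := ind n.+1 tt (fun=> `]-oo, x]%classic) tt0 (fun i => ltac:(by rewrite ttS lerDl ltW)) mA.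
have {}H : P [set w | forall i : 'I_n.+1, S (tt i.+1) w - S (tt i) w <= x]
   = ((fine (P [set w | S u w <= x])) ^+ n.+1)%:E.
  rewrite (_ : [set w | _] = [set w | forall i : 'I_n.+1, `]-oo, x]%classic (S (tt i.+1) w - S (tt i) w)]); last first.
    by apply/seteqP; split=> w /= h i; have := h i; rewrite in_itv.
  rewrite H -[n.+1 in RHS]card_ord -prodr_const -prodEFin; apply: eq_bigr => i _.
  rewrite ttS st ?(ltW u0)// fineK ?fin_num_measure//; congr (P _).
apply: (@le_trans _ _ (fine (P [set w | forall i : 'I_n.+1, S (tt i.+1) w - S (tt i) w <= x]))); last first.
  by rewrite H/= lerXn2r ?nnegrE ?fine_ge0// (le_trans _ q1)// fine_ge0.
have mI : measurable [set w | forall i : 'I_n.+1, S (tt i.+1) w - S (tt i) w <= x].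
  rewrite (_ : [set w | _] = \bigcap_(i < n.+1) [set w | S (tt i.+1) w - S (tt i) w <= x]); last first.
    apply/seteqP; split=> w /= h; first by move=> i /= ni; exact: (h (Ordinal ni)).
    by move=> i; exact: (h i (ltn_ord i)).
  apply: bigcap_measurable => [|i _]; first by exists 0%N.
  rewrite (_ : [set w | _] = (S (tt i.+1) \- S (tt i)) @^-1` `]-oo, x]); last first.
    by apply/seteqP; split=> w /=; rewrite in_itv.
  rewrite -[X in measurable X]setTI.
  by apply: (@measurable_funB _ _ _ setT (S (tt i.+1)) (S (tt i))) => //; exact: measurable_funPT.
apply: fine_le; [exact: fin_num_measure|exact: fin_num_measure|].
apply: le_measure_ae => //; apply: filterS2 S0 mono => w w0 wm /= wx i.
have tn : tt i.+1 <= t.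
  by rewrite /tt /u mulrCA ler_piMr ?(ltW t0)// ler_pdivrMr// mul1r ler_nat.
have h1 : 0 <= S (tt i) w by rewrite -w0 wm.
have h2 : S (tt i.+1) w <= S t w by rewrite wm.
by rewrite lerBlDr (le_trans h2)// (le_trans wx)// lerDl.
Qed.

(** The mean of a nonnegative variable is the integral of its tail, and a large value of S^(-p)
    means a small value of S, whose probability is bounded by an arbitrarily high power. *)
Lemma integrable_stable_subordinator_powRN d (T : measurableType d) (R : realType)
    (P : probability T R) (theta : R) (S : R -> {RV P >-> R}) (t p : R) :
  0 < theta -> theta < 1 -> stable_subordinator theta S -> 0 < t -> 0 < p ->
  P.-integrable setT (EFin \o (fun w => S t w `^ (- p))).
Proof.
move=> th0 th1 hS t0 p0.
(* With n + 1 >= 2p, the tail bound (C r^(-1/p))^(n+1) is at most C^(n+1) / r^2 for r >= 1, which is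
   integrable. *)
pose n := Num.truncn (2 * p).
have np : 2 * p <= n.+1%:R by rewrite ltW// truncnS_gt.
have [C C0 HC] := stable_subordinator_le_pow n th0 th1 hS t0.
have mY : measurable_fun setT (fun w => S t w `^ (- p)).
  by apply: (measurableT_comp (measurable_powR _)); exact: measurable_funPT.
pose Y : {RV P >-> R} := HB.pack (fun w => S t w `^ (- p)) (isMeasurableFun.Build _ _ T R _ mY).
have Y0 w : 0 <= Y w by exact: powR_ge0.
have tail (r : R) : 1 <= r -> (ccdf Y r <= (C ^+ n.+1 / r ^+ 2)%:E)%E.
  move=> r1; have r0 : 0 < r by exact: lt_le_trans r1.
  have x0 : 0 < r `^ (- p^-1) by exact: powR_gt0.
  have mS : measurable [set w | S t w <= r `^ (- p^-1)].
    rewrite (_ : [set w | _] = S t @^-1` `]-oo, r `^ (- p^-1)]%classic); last first.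
      by apply/seteqP; split=> w /=; rewrite in_itv.
    by rewrite -[X in measurable X]setTI; exact: (measurable_funPT (S t)).
  apply: (@le_trans _ _ (P [set w | S t w <= r `^ (- p^-1)])).
    change (P ((fun w => (S t w `^ (- p))%R) @^-1` `]r, +oo[%classic) <= P [set w | (S t w <= r `^ (- p^-1))%R])%E.
    apply: le_measure; rewrite ?inE//.
      by rewrite -[X in measurable X]setTI; exact: (mY measurableT).
    move=> w /=; rewrite in_itv/= andbT => rY; rewrite leNgt; apply/negP => xS.
    move: rY; apply/negP; rewrite -leNgt.
    have S0 : 0 < S t w by exact: lt_trans xS.
    rewrite powRN -[leRHS]invrK lef_pV2 ?posrE ?powR_gt0 ?invr_gt0//.
    have -> : r^-1 = (r `^ (- p^-1)) `^ p.
      by rewrite -powRrM mulNr mulVf ?gt_eqF// powR_inv1// ltW.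
    by rewrite ge0_ler_powR ?nnegrE ?(ltW p0) ?(ltW x0) ?(ltW S0) ?(ltW xS).
  rewrite -[leLHS]fineK ?fin_num_measure// lee_fin (le_trans (HC _ x0))//.
  rewrite exprMn ler_wpM2l ?exprn_ge0//.
  have -> : r `^ (- p^-1) ^+ n.+1 = (r `^ (n.+1%:R / p))^-1.
    by rewrite -[LHS]powR_mulrn ?powR_ge0// -powRrM mulNr powRN mulrC.
  rewrite lef_pV2 ?posrE ?powR_gt0 ?exprn_gt0//.
  by rewrite -[leLHS]powR_mulrn ?(ltW r0)// ler_powR// ler_pdivlMr.
apply/integrableP; split; first exact/measurable_EFinP.
have -> : (\int[P]_w `|(EFin \o (fun w => (S t w `^ (- p))%R)) w| = 'E_P[Y])%E.
  by rewrite expectation_def; apply: eq_integral => w _; rewrite /= ger0_norm ?powR_ge0.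
rewrite ge0_expectation_ccdf//.
(* K / (1 + r^2) dominates both the trivial bound 1 for r < 1, where 1 + r^2 <= 2, and the tail
   bound for r >= 1, where 1 + r^2 <= 2 r^2. *)
pose K := 2 + 2 * C ^+ n.+1.
have i2 : (@lebesgue_measure R).-integrable `[0, +oo[ (EFin \o (fun r => K * (1 + r ^+ 2)^-1)).
  by apply: integrable_scale => //; apply: integrableS (@integrableT_oneDsqrV R).
case/integrableP : (i2) => m2; apply: le_lt_trans.
have K0 : 0 <= K by rewrite addr_ge0// mulr_ge0// exprn_ge0.
apply: ge0_le_integral => //.
- by apply: measurable_funTS; exact: ccdf_measurable.
- by apply: measurableT_comp.
move=> r; rewrite /= in_itv/= andbT => r0.
have q0 : 0 < 1 + r ^+ 2 by rewrite ltr_wpDr ?sqr_ge0.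
rewrite ger0_norm ?mulr_ge0 ?invr_ge0 ?(ltW q0)//.
have [r1|r1] := leP 1 r.
  rewrite (le_trans (tail r r1))// lee_fin.
  have rr : 0 < r ^+ 2 by rewrite exprn_gt0// (lt_le_trans _ r1).
  rewrite ler_pdivrMr// mulrAC ler_pdivlMr// /K.
  have : 0 <= C ^+ n.+1 by rewrite exprn_ge0.
  have : 1 <= r ^+ 2 by rewrite -[leLHS](expr1n _ 2) lerXn2r// nnegrE.
  nra.
rewrite (@le_trans _ _ 1%E)//; first exact: probability_le1.
rewrite lee_fin ler_pdivlMr// mul1r /K.
have : 0 <= C ^+ n.+1 by rewrite exprn_ge0.
nra.
Qed.

(** * The subordinated density is a stable density *)

Lemma measurable_phase (R : realType) (alpha x s : R) :
  measurable_fun setT (fun g : R => cos (g * x + s * g `^ alpha)).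
Proof.
apply: measurableT_comp; first exact: measurable_cos.
apply: measurable_funD; first exact: measurable_funM.
by apply: measurable_funM => //; exact: measurable_powR.
Qed.

Lemma integrable_itv_cst (R : realType) (c a b : R) :
  (@lebesgue_measure R).-integrable `[a, b] (EFin \o (fun=> c)).
Proof.
apply: continuous_compact_integrable; first exact: segment_compact.
by apply: continuous_subspaceT => x; exact: cvg_cst.
Qed.

Lemma integrable_phase (R : realType) (alpha x s a b : R) :
  (@lebesgue_measure R).-integrable `[a, b] (EFin \o (fun g : R => cos (g * x + s * g `^ alpha))).
Proof.
apply: le_integrable_EFin (integrable_itv_cst 1 a b) _ => //.
  by apply: measurable_funTS; exact: measurable_phase.
by move=> g _; exact: cos_max.
Qed.

(** The derivative [p1] of the phase is nondecreasing, and the last hypothesis keeps it above half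
    of alpha s u^(alpha-1). Integration by parts with sin(phase) / p1 leaves boundary terms of size
    1 / p1 and a remainder bounded by the variation of 1 / p1, which telescopes; together they are
    at most 2 / p1(u). *)
Lemma van_der_corput (R : realType) (alpha s x u v : R) :
  1 < alpha -> 0 < s -> 0 < u -> u < v -> 2 * (`|x| + 1) <= alpha * s * u `^ (alpha - 1) ->
  `|\int[@lebesgue_measure R]_(g in `[u, v]) cos (g * x + s * g `^ alpha)|
  <= 4 / (alpha * s * u `^ (alpha - 1)).
Proof.
move=> al1 s0 u0 uv hu.
have al0 : 0 < alpha by exact: lt_trans al1.
pose p1 (g : R) := x + s * (alpha * g `^ (alpha - 1)).
pose p2 (g : R) := s * (alpha * ((alpha - 1) * g `^ (alpha - 1 - 1))).
pose ph (g : R) := g * x + s * g `^ alpha.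
have q1 g : u <= g -> alpha * s * u `^ (alpha - 1) / 2 <= p1 g.
  move=> ug; have : u `^ (alpha - 1) <= g `^ (alpha - 1).
    by rewrite ge0_ler_powR ?nnegrE ?subr_ge0 ?(ltW al1) ?(ltW u0) ?(le_trans (ltW u0)).
  rewrite -(ler_pM2l (mulr_gt0 al0 s0)) => h.
  have := ler_norm (- x); rewrite normrN /p1 mulrCA mulrA => hx.
  move: hu h hx; set A := _ * u `^ _; set B := _ * g `^ _; lra.
have U0 : 0 < alpha * s * u `^ (alpha - 1) by rewrite !mulr_gt0// powR_gt0.
have p10 g : u <= g -> 0 < p1 g.
  by move=> /q1; apply: lt_le_trans; rewrite divr_gt0.
pose F g := sin (ph g) * (p1 g)^-1.
pose d g := cos (ph g) - sin (ph g) * p2 g / p1 g ^+ 2.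
have dp g : u <= g -> is_derive g (1 : R) (fun g => (p1 g)^-1) (- p2 g / p1 g ^+ 2).
  move=> ug; have g0 : 0 < g by exact: lt_le_trans ug.
  have d1 := is_derive1_powR (alpha - 1) g0.
  have n0 : x + s * (alpha * g `^ (alpha - 1)) != 0 by rewrite gt_eqF//; exact: p10.
  by rewrite /p1 /p2; apply: is_derive_eq; rewrite /GRing.scale/=; field.
have H := @le_normr_Rintegral_primitive R (fun g => cos (ph g)) F (fun g => - (p1 g)^-1) d
  (fun g => p2 g / p1 g ^+ 2) u v uv.
have {}H : `|\int[@lebesgue_measure R]_(g in `[u, v]) cos (ph g) - (F v - F u)| <= - (p1 v)^-1 - - (p1 u)^-1.
  apply: H => g ug.
  - have g0 : 0 < g by exact: lt_le_trans ug.
    apply: continuous_comp; last exact: continuous_cos.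
    apply: cvgD; first by apply: cvgM => //; exact: cvg_cst.
    by apply: cvgM; [exact: cvg_cst|exact: continuous_powR_gt0].
  - have g0 : 0 < g by exact: lt_le_trans ug.
    have d1 := is_derive1_powR alpha g0; have d2 := dp g ug.
    have n0 : p1 g != 0 by rewrite gt_eqF// p10.
    rewrite /F /ph; apply: is_derive_eq; rewrite /GRing.scale/= /d /ph.
    have -> : g * 0 + x * 1 + s * (alpha * g `^ (alpha - 1)) = p1 g by rewrite mulr0 add0r mulr1.
    by field.
  - have d2 := dp g ug.
    by apply: is_derive_eq; rewrite mulNr opprK.
  - rewrite /d opprB addrC subrK (normrM (sin _ * _)) (normrM (sin _)).
    have p20 : 0 <= p2 g by rewrite /p2 !mulr_ge0 ?powR_ge0 ?subr_ge0 ?ltW.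
    rewrite (ger0_norm p20) normfV (gtr0_norm (exprn_gt0 2 (p10 g ug))) -mulrA ler_piMl ?sin_max//.
    by rewrite divr_ge0// exprn_ge0// ltW// p10.
have bF g : u <= g -> `|F g| <= (p1 g)^-1.
  move=> ug; rewrite normrM normfV (gtr0_norm (p10 g ug)) ler_piMl ?sin_max//.
  by rewrite invr_ge0 ltW// p10.
apply: (@le_trans _ _ (2 * (p1 u)^-1)).
  have := bF u (lexx u); have := bF v (ltW uv); move: H.
  move: (\int[_]_(_ in _) _) (F u) (F v) (p1 u)^-1 (p1 v)^-1 => I fu fv iu iv.
  by rewrite !ler_norml => /andP[? ?] /andP[? ?] /andP[? ?]; apply/andP; split; lra.
have -> : 4 / (alpha * s * u `^ (alpha - 1)) = 2 * (alpha * s * u `^ (alpha - 1) / 2)^-1.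
  by field; rewrite !gt_eqF// powR_gt0.
by rewrite ler_wpM2l// lef_pV2 ?posrE ?divr_gt0 ?p10//; exact: q1.
Qed.

Lemma Rintegral_phase_diff (R : realType) (alpha s x A B : R) : 0 <= A -> A <= B ->
  \int[@lebesgue_measure R]_(g in `[0, B]) cos (g * x + s * g `^ alpha)
  = \int[@lebesgue_measure R]_(g in `[0, A]) cos (g * x + s * g `^ alpha)
  + \int[@lebesgue_measure R]_(g in `[A, B]) cos (g * x + s * g `^ alpha).
Proof.
move=> A0 AB.
have := @Rintegral_itvB R (fun g => cos (g * x + s * g `^ alpha)) (BLeft 0) (BRight B) A
  (integrable_phase alpha x s 0 B).
rewrite !bnd_simp => /(_ A0 AB) /eqP; rewrite subr_eq addrC => /eqP ->.
rewrite Rintegral_itv_obnd_cbnd//.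
by apply: integrableS (integrable_phase alpha x s A B) => //; apply: subset_itvr; rewrite bnd_simp.
Qed.

(** The point (c / (alpha s))^(1 / (alpha-1)) is the frequency at which the derivative of s g^alpha
    equals c; beyond it the oscillatory estimate takes over. *)
Lemma phase_radius (R : realType) (alpha s c : R) : 1 < alpha -> 0 < s -> 0 <= c ->
  alpha * s * ((c / (alpha * s)) `^ (alpha - 1)^-1) `^ (alpha - 1) = c.
Proof.
move=> al1 s0 c0; have al0 : 0 < alpha by exact: lt_trans al1.
rewrite -powRrM mulVf ?gt_eqF ?subr_gt0// powRr1 ?divr_ge0 ?mulr_ge0 ?(ltW al0) ?(ltW s0)//.
by field; rewrite !gt_eqF.
Qed.

(** Up to the threshold frequency G, proportional to s^(-1/(alpha-1)), the integral is bounded by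
    the length of the interval. Beyond G the oscillatory estimate with c = 2 (|x| + 1) gives 4 / c
    <= 2. *)
Lemma normr_Rintegral_phase_le (R : realType) (alpha x : R) : 1 < alpha ->
  exists2 K : R, 0 <= K & forall s A, 0 < s -> 0 <= A ->
  `|\int[@lebesgue_measure R]_(g in `[0, A]) cos (g * x + s * g `^ alpha)|
  <= K * s `^ (- (alpha - 1)^-1) + 2.
Proof.
move=> al1; have al0 : 0 < alpha by exact: lt_trans al1.
pose c : R := 2 * (`|x| + 1).
have c0 : 0 < c by rewrite mulr_gt0// ltr_wpDl.
exists ((c / alpha) `^ (alpha - 1)^-1); first exact: powR_ge0.
move=> s A s0 A0.
pose G := (c / (alpha * s)) `^ (alpha - 1)^-1.
have -> : (c / alpha) `^ (alpha - 1)^-1 * s `^ (- (alpha - 1)^-1) = G.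
  rewrite /G invfM mulrA [in RHS]powRM ?divr_ge0 ?invr_ge0 ?ltW//; congr (_ * _).
  have -> : s^-1 = s `^ (-1) by rewrite powR_inv1 ?ltW.
  by rewrite -powRrM mulN1r.
have G0 : 0 < G by rewrite powR_gt0// divr_gt0// mulr_gt0.
have triv B : 0 <= B ->
    `|\int[@lebesgue_measure R]_(g in `[0, B]) cos (g * x + s * g `^ alpha)| <= B.
  move=> B0; apply: (le_trans (le_normr_Rintegral _ (integrable_phase alpha x s 0 B))) => //.
  apply: (@le_trans _ _ (\int[@lebesgue_measure R]_(g in `[0, B]) 1)).
    apply: le_Rintegral => //.
    - by apply: integrable_norm; exact: integrable_phase.
    - exact: integrable_itv_cst.
    - by move=> g _; exact: cos_max.
  rewrite Rintegral_cst//= lebesgue_measure_itv/= lte_fin; case: ltP => _; rewrite /= ?mul1r ?subr0 ?mulr0//.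
have [AG|GA] := leP A G.
  by rewrite (le_trans (triv A A0))// (le_trans AG)// lerDl.
rewrite (Rintegral_phase_diff _ _ _ (ltW G0) (ltW GA)) (le_trans (ler_normD _ _))//.
apply: lerD; first exact: triv (ltW G0).
have hG : alpha * s * G `^ (alpha - 1) = c by apply: phase_radius => //; exact: ltW.
apply: le_trans (van_der_corput al1 s0 G0 GA _) _; first by rewrite hG.
rewrite hG ler_pdivrMr// /c; have := normr_ge0 x; lra.
Qed.

Lemma is_cvg_Rintegral_phase (R : realType) (alpha x s : R) : 1 < alpha -> 0 < s ->
  cvg (\int[@lebesgue_measure R]_(g in `[0, A]) cos (g * x + s * g `^ alpha) @[A --> +oo%R]).
Proof.
move=> al1 s0; have al0 : 0 < alpha by exact: lt_trans al1.
apply/cauchy_cvgP/cauchy_exP => e e0.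
(* The first summand meets the hypothesis of the oscillatory estimate, and the second makes its
   bound 4 / c smaller than e. *)
pose c : R := 2 * (`|x| + 1) + 8 / e.
have c1 : 0 < 8 / e by rewrite divr_gt0.
have c2 : 0 < 2 * (`|x| + 1) by rewrite mulr_gt0// ltr_wpDl.
have c0 : 0 < c by rewrite addr_gt0.
pose G := (c / (alpha * s)) `^ (alpha - 1)^-1.
have G0 : 0 < G by rewrite powR_gt0// divr_gt0// mulr_gt0.
have hG : alpha * s * G `^ (alpha - 1) = c by apply: phase_radius => //; exact: ltW.
exists (\int[@lebesgue_measure R]_(g in `[0, G]) cos (g * x + s * g `^ alpha)).
rewrite /fmap/=; near=> A.
have GA : G < A by near: A; apply: nbhs_pinfty_gt; exact: num_real.
rewrite /ball/= (Rintegral_phase_diff _ _ _ (ltW G0) (ltW GA)) opprD addrA subrr sub0r normrN.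
apply: le_lt_trans (van_der_corput al1 s0 G0 GA _) _; first by rewrite hG lerDl ltW.
rewrite hG ltr_pdivrMr// /c mulrDr (mulrCA e 8) divff ?gt_eqF// mulr1 ltr_wpDl// ?ltr_nat//.
by rewrite mulr_ge0// ltW.
Unshelve. all: by end_near.
Qed.

Lemma cvg_pseudo_density (R : realType) (alpha x s : R) : 1 < alpha -> 0 < s ->
  pi^-1 * \int[@lebesgue_measure R]_(g in `[0, n%:R]) cos (g * x + s * g `^ alpha) @[n --> \oo]
  --> pseudo_density alpha x s.
Proof.
move=> al1 s0; apply: cvgM; first exact: cvg_cst.
apply: (@cvg_comp _ _ _ (fun n : nat => n%:R)
  (fun A => \int[@lebesgue_measure R]_(g in `[0, A]) cos (g * x + s * g `^ alpha)) _ (+oo : set_system R)).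
  exact: cvgr_idn.
exact: is_cvg_Rintegral_phase.
Qed.

(** Fubini yields measurability of the inner integral once the integrand is integrable in s over the
    whole line. The weight 1 / (1 + s^2) ensures this and is divided out afterwards. *)
Lemma measurable_Rintegral_phase (R : realType) (alpha x A : R) :
  measurable_fun setT (fun s : R =>
    \int[@lebesgue_measure R]_(g in `[0, A]) cos (g * x + s * g `^ alpha)).
Proof.
pose f (s g : R) := (1 + s ^+ 2)^-1 * cos (g * x + s * g `^ alpha).
have c0 (s : R) : 0 < 1 + s ^+ 2 by rewrite ltr_wpDr ?sqr_ge0.
have mi : measurable_fun setT (fun s : R => (1 + s ^+ 2)^-1).
  by apply: continuous_measurable_fun; exact: continuous_oneDsqrV.
have mf : measurable_fun setT (fun z : R * R => f z.1 z.2).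
  apply: measurable_funM; first exact: measurableT_comp mi measurable_fst.
  apply: measurableT_comp; first exact: measurable_cos.
  apply: measurable_funD.
    by apply: measurable_funM => //; exact: measurable_snd.
  apply: measurable_funM; first exact: measurable_fst.
  exact: (measurableT_comp (measurable_powR alpha) measurable_snd).
have mA : measurable (`[0, A] : set R) by [].
have [H _] := @Rintegral_swap _ _ (measurableTypeR R) (measurableTypeR R) R (@lebesgue_measure R)
  (@lebesgue_measure R) setT `[0, A] f (fun s => (1 + s ^+ 2)^-1) (fun=> 1) measurableT mA mf
  (@integrableT_oneDsqrV R) (integrable_itv_cst 1 0 A)
  (fun s g _ _ => ltac:(rewrite mulr1 normrM ger0_norm ?invr_ge0 ?(ltW (c0 s))// ler_piMr ?cos_max ?invr_ge0 ?(ltW (c0 s))//)).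
have mH : measurable_fun setT (fun s : R => (1 + s ^+ 2) * \int[@lebesgue_measure R]_(g in `[0, A]) f s g).
  apply: measurable_funM; first by apply: measurable_funD => //; exact: measurable_funX.
  by apply/measurable_EFinP; exact: measurable_int H.
apply: eq_measurable_fun mH => s _ /=; rewrite /f RintegralZl//; last exact: integrable_phase.
by rewrite mulrA divff ?mul1r// gt_eqF.
Qed.

Lemma Rintegral_full_probability d (T : measurableType d) (R : realType) (P : probability T R)
    (E : set T) (f : T -> R) : measurable E -> P (~` E) = 0%E ->
  P.-integrable setT (EFin \o f) -> \int[P]_(w in E) f w = \int[P]_w f w.
Proof.
move=> mE E0 fi; rewrite /Rintegral; congr fine.
rewrite [RHS](negligible_integral (measurableC mE))//; congr integral.
by rewrite setTD setCK.
Qed.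

Lemma subordinated_density_stable (R : realType) (alpha theta : R)
    (d : measure_display) (T : measurableType d) (P : probability T R)
    (S : R -> {RV P >-> R}) (h : R -> R -> R) (x t : R) :
  1 < alpha -> 0 < theta -> theta < 1 -> stable_subordinator theta S ->
  has_density (S t) `]0, +oo[ (fun s => h s t) -> 0 < t ->
  subordinated_density (pseudo_density alpha) h x t
  = stable_density (t * cos (pi * theta / 2)) (t * sin (pi * theta / 2)) (alpha * theta) x.
Proof.
move=> al1 th0 th1 hS hh t0; have al0 : 0 < alpha by exact: lt_trans al1.
set a := t * cos _; set b := t * sin _; set nu := alpha * theta.
have nu0 : 0 < nu by rewrite mulr_gt0.
have a0 : 0 < a.
  rewrite mulr_gt0// cos_gt0_pihalf//; have := pi_gt0 R => p0; apply/andP; split; nra.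
pose D : set R := `]0, +oo[%classic.
have mD : measurable D by exact: measurable_itv.
have mS : measurable_fun setT (S t) by exact: measurable_funPT.
pose E := S t @^-1` D.
have mE : measurable E by rewrite -[X in measurable X]setTI; exact: (mS measurableT D mD).
have PE : P (~` E) = 0%E.
  have [_ _ hd] := hh.
  have := hd (~` D) (measurableC mD); rewrite setICl integral_set0; exact.
pose U n s := pi^-1 * \int[@lebesgue_measure R]_(g in `[0, n%:R]) cos (g * x + s * g `^ alpha).
(* The improper integral is known to converge for s > 0. Cutting off outside [D] makes the
   convergence hold at every s, and [S t] lies in [D] almost surely by [PE]. *)
pose F := pseudo_density alpha x \_ D.
have mU n : measurable_fun setT (U n \_ D).
  apply/(measurable_restrict (U n)) => //; rewrite ?setTI.
  by apply: measurable_funTS; apply: measurable_funM => //; exact: measurable_Rintegral_phase.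
have cF s : (U n \_ D) s @[n --> \oo] --> F s.
  rewrite /F patchE; case: ifPn => sD.
    rewrite (_ : (fun n => _) = (fun n => U n s)); last by apply/funext => n; rewrite patchE sD.
    by apply: cvg_pseudo_density => //; move: sD; rewrite inE /D/= in_itv/= andbT.
  rewrite (_ : (fun n => _) = (fun n => point)); last by apply/funext => n; rewrite patchE (negbTE sD).
  exact: cvg_cst.
have mF : measurable_fun setT F by apply: measurable_fun_cvg mU _ => s _; exact: cF.
have [K K0 HK] := normr_Rintegral_phase_le x al1.
pose p := (alpha - 1)^-1.
have p0 : 0 < p by rewrite invr_gt0 subr_gt0.
have i1 : P.-integrable setT (EFin \o (fun=> 2)) by exact: finite_measure_integrable_cst.
pose B w := pi^-1 * (K * S t w `^ (- p) + 2).
have iB : P.-integrable setT (EFin \o B).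
  apply: integrable_scale => //; apply: integrable_add => //; apply: integrable_scale => //.
  exact: integrable_stable_subordinator_powRN hS t0 p0.
have UB n w : `|(U n \_ D) (S t w)| <= B w.
  have B0 : 0 <= B w by rewrite mulr_ge0 ?invr_ge0 ?pi_ge0// addr_ge0// mulr_ge0// powR_ge0.
  rewrite patchE; case: ifPn => [|_]; last by rewrite normr0.
  rewrite inE /D/= in_itv/= andbT => s0; rewrite normrM ger0_norm ?invr_ge0 ?pi_ge0//.
  by rewrite ler_wpM2l ?invr_ge0 ?pi_ge0// HK.
have [iF cI] := @dominated_convergence_Rintegral _ T R P setT (fun n w => (U n \_ D) (S t w))
  (fun w => F (S t w)) B measurableT (fun n => measurableT_comp (mU n) mS)
  (fun w _ => cF (S t w)) iB (fun n w _ => UB n w).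
rewrite /subordinated_density.
have -> : \int[@lebesgue_measure R]_(s in `]0, +oo[) (pseudo_density alpha x s * h s t)
   = \int[@lebesgue_measure R]_(s in D) (F s * h s t).
  by apply: eq_Rintegral => s sD; rewrite /F patchE sD.
rewrite (Rintegral_density mD hh mF iF).
(* Under the expectation the roles are exchanged: g^alpha is the frequency paired with [S t] and g x
   is a mere phase. The characteristic function at g^alpha produces the exponent alpha theta. *)
have UI n : \int[P]_w (U n \_ D) (S t w) = pi^-1 * \int[@lebesgue_measure R]_(g in `[0, n%:R])
    (expR (- (a * g `^ nu)) * cos (g * x + b * g `^ nu)).
  have -> : \int[P]_w (U n \_ D) (S t w) = \int[P]_(w in E) U n (S t w).
    rewrite [RHS]Rintegral_mkcond; apply: eq_Rintegral => w _.
    by rewrite !patchE /E; congr (if _ then _ else _); rewrite !inE.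
  have mn : measurable (`[0, n%:R] : set R) by [].
  have [H1 H2] := @Rintegral_swap_cos _ T R P (S t) E `[0, n%:R] (fun=> 1) (fun g => g `^ alpha)
    (fun g => g * x) mE mn (measurable_cst _) (measurable_powR alpha) (measurable_funM (@measurable_id _ _ _) (measurable_cst x))
    (integrable_itv_cst 1 0 n%:R).
  have e1 w : \int[@lebesgue_measure R]_(g in `[0, n%:R]) (1 * cos (g `^ alpha * S t w + g * x))
     = \int[@lebesgue_measure R]_(g in `[0, n%:R]) cos (g * x + S t w * g `^ alpha).
    by apply: eq_Rintegral => g _; rewrite mul1r addrC (mulrC (S t w)).
  rewrite /U RintegralZl//; last by apply: eq_integrable H1 => // w _; rewrite /= e1.
  congr (_ * _); transitivity (\int[P]_(w in E) \int[@lebesgue_measure R]_(g in `[0, n%:R]) (1 * cos (g `^ alpha * S t w + g * x))).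
    by apply: eq_Rintegral => w _; rewrite e1.
  rewrite H2; apply: eq_Rintegral => g; rewrite inE/= in_itv/= => /andP[g0 _].
  rewrite mul1r Rintegral_full_probability//.
    by rewrite (stable_subordinator_cos (g * x) th0 hS t0 (powR_ge0 _ _)) -powRrM.
  have i2 : P.-integrable setT (EFin \o (fun=> 1)) by exact: finite_measure_integrable_cst.
  apply: le_integrable_EFin i2 _ => //; last by move=> w _; exact: cos_max.
  apply: measurableT_comp; first exact: measurable_cos.
  by apply: measurable_funD => //; exact: measurable_funM.
have := cI; rewrite (_ : (fun n => _) = (fun n => pi^-1 * \int[@lebesgue_measure R]_(g in `[0, n%:R])
    (expR (- (a * g `^ nu)) * cos (g * x + b * g `^ nu)))); last by apply/funext.
move=> /cvg_lim <-//; apply/cvg_lim => //.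
apply: cvgM; first exact: cvg_cst.
apply: cvg_Rintegral_exhaustion => //.
- by move=> n; apply: subset_itvl; rewrite bnd_simp.
- move=> g; rewrite /= in_itv/= andbT => g0; near=> n; rewrite in_itv/= g0/=.
  by near: n; exact: nbhs_infty_ger.
- exact: integrable_density_integrand.
Unshelve. all: by end_near.
Qed.

(** * Laws with a stable characteristic function *)

(** Half-open intervals are stable under intersection and generate the Borel sets, and the intervals
    ]-k, k] exhaust the line, so two finite measures that agree on them coincide. *)
Lemma eq_density_ocitv d (T : measurableType d) (R : realType) (P : probability T R)
    (X : {RV P >-> R}) (f : R -> R) :
  (@lebesgue_measure R).-integrable setT (EFin \o f) -> (forall x, 0 <= f x) ->
  (forall u v, u < v -> P (X @^-1` `]u, v]%classic) = (\int[@lebesgue_measure R]_(x in `]u, v]) f x)%:E) ->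
  forall A, measurable A -> distribution P X A = (\int[@lebesgue_measure R]_(x in A) (f x)%:E)%E.
Proof.
move=> fi f0 Xuv A mA.
have mX0 : measurable_fun setT X by exact: measurable_funPT.
have mX : @measurable_fun _ _ T (measurableTypeR R) setT X by move=> mT Y mY; exact: (mX0 mT Y mY).
pose X' : {mfun T >-> measurableTypeR R} :=
  HB.pack (X : T -> measurableTypeR R) (isMeasurableFun.Build _ _ T (measurableTypeR R) X mX).
have ifi u v : (@lebesgue_measure R).-integrable `]u, v] (EFin \o f) by exact: integrableS fi.
have pos (E : set (measurableTypeR R)) : (0 <= induced_charge fi E)%E.
  by apply: integral_ge0 => x _; rewrite lee_fin.
apply: (@measure_unique _ R (measurableTypeR R) (@ocitv R) (fun k : nat => `](- k%:R), k%:R]%classic)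
  erefl (@ocitvI R) _ _ (distribution P X') (measure_of_charge (induced_charge fi) pos)) => //.
- by move=> k; exists (- k%:R, k%:R).
- apply/seteqP; split=> // x _.
  exists (Num.truncn `|x|).+1 => //=; rewrite in_itv/=.
  have xn : `|x| < (Num.truncn `|x|).+1%:R by exact: truncnS_gt.
  by apply/andP; split; [rewrite ltrNl (le_lt_trans _ xn)// -normrN ler_norm|rewrite ltW// (le_lt_trans _ xn)// ler_norm].
- move=> B [[u v] _ <-] /=; have [uv|vu] := ltP u v; last first.
    by rewrite set_itv_ge ?bnd_simp -?leNgt// measure0 /measure_of_charge /induced_charge integral_set0.
  have := Xuv u v uv; rewrite /measure_of_charge /induced_charge /Rintegral fineK//.
  by apply: integrable_fin_num => //; exact: ifi.
- move=> k; apply: le_lt_trans (ltry 1); exact: probability_le1.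
Qed.

Lemma Rintegral_poisson_itv (R : realType) (e k u v : R) : 0 < e -> u < v ->
  \int[@lebesgue_measure R]_(y in `[u, v]) (e / (e ^+ 2 + (k - y) ^+ 2))
  = atan ((v - k) / e) - atan ((u - k) / e).
Proof.
move=> e0 uv; have en0 : e != 0 by rewrite gt_eqF.
have q0 (y : R) : 0 < e ^+ 2 + (k - y) ^+ 2 by rewrite ltr_wpDr ?sqr_ge0// exprn_gt0.
(* With zero error functions the comparison of derivatives becomes an equality. *)
have H := @le_normr_Rintegral_primitive R (fun y => e / (e ^+ 2 + (k - y) ^+ 2))
  (fun y => atan ((y - k) / e)) (fun=> 0) (fun y => e / (e ^+ 2 + (k - y) ^+ 2)) (fun=> 0) u v uv.
apply/eqP; rewrite -subr_eq0 -normr_le0 -[leRHS](subrr 0); apply: H => y _.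
- apply: cvgM; first exact: cvg_cst.
  apply: cvgV; first by rewrite gt_eqF.
  apply: cvgD; first exact: cvg_cst.
  by apply: cvgM; apply: cvgB => //; exact: cvg_cst.
- apply: is_derive_eq; rewrite /GRing.scale/=; field.
  rewrite en0/= !gt_eqF// ?ltr_wpDr ?sqr_ge0//.
- by rewrite subrr normr0.
Qed.

Lemma cvg_harmonic_sqr (R : realType) : (harmonic n : R) ^+ 2 @[n --> \oo] --> (0 : R).
Proof.
by rewrite -[X in _ --> X](mulr0 0); apply: cvgM; exact: cvg_harmonic.
Qed.

(** At c = 0 the quotient is 1 / harmonic n, which still tends to infinity. The shift thus gives the
    limit pi / 2 at 0 as well, instead of the value 0 of an unshifted kernel. *)
Lemma cvg_atan_shift (R : realType) (c : R) :
  atan ((c + harmonic n) / harmonic n ^+ 2) @[n --> \oo]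
  --> (if 0 <= c then pi / 2 else - (pi / 2) : R).
Proof.
have h0 n : 0 < harmonic n :> R by exact: harmonic_gt0.
have hV n : (harmonic n : R)^-1 = n.+1%:R by rewrite invrK.
have n1 : (n.+1%:R : R) @[n --> \oo] --> +oo%R.
  apply/cvgryPge => A; near=> n; rewrite (@le_trans _ _ n%:R) ?ler_nat//.
  by near: n; exact: nbhs_infty_ger.
have [c0|c0] := leP 0 c.
  apply: (@cvg_comp _ _ _ (fun n => (c + harmonic n) / harmonic n ^+ 2) (@atan R) _ (+oo : set_system R)).
    apply: ger_cvgy n1; near=> n.
    rewrite -hV ler_pdivlMr ?exprn_gt0// expr2 mulrA mulVf ?gt_eqF// mul1r.
    by rewrite lerDr.
  exact: cvgy_atan.
have [d d0 cd] : exists2 d, 0 < d & c = - d by exists (- c); rewrite ?oppr_gt0 ?opprK.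
rewrite cd (_ : (fun n => _) = (fun n => - atan ((d - harmonic n) / harmonic n ^+ 2))); last first.
  by apply/funext => n; rewrite -atanN -mulNr opprB addrC.
apply: cvgN.
apply: (@cvg_comp _ _ _ (fun n => (d - harmonic n) / harmonic n ^+ 2) (@atan R) _ (+oo : set_system R)).
  apply: ger_cvgy n1; near=> n.
  rewrite -hV ler_pdivlMr ?exprn_gt0// expr2 mulrA mulVf ?gt_eqF// mul1r.
  rewrite lerBrDr.
  have : harmonic n < d / 2 by near: n; apply: cvgr_lt (cvg_harmonic) _ _; rewrite divr_gt0.
  lra.
exact: cvgy_atan.
Unshelve. all: by end_near.
Qed.

(** The integral over centres in [u, v] of the mean kernel is computed twice: through the transform
    it tends to pi times the integral of the density, and through the arctangent primitive it tends
    to pi times the probability of ]u, v]. *)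
Lemma probability_itv_stable_density d (T : measurableType d) (R : realType)
    (P : probability T R) (X : {RV P >-> R}) (a b nu u v : R) : 0 < a -> 0 < nu ->
  (forall g c, 0 <= g -> \int[P]_w cos (g * X w + c)
     = expR (- (a * g `^ nu)) * cos (c - b * g `^ nu)) ->
  u < v ->
  P (X @^-1` `]u, v]%classic) = (\int[@lebesgue_measure R]_(x in `]u, v]) stable_density a b nu x)%:E.
Proof.
move=> a0 nu0 hX uv.
have mX : measurable_fun setT X by exact: measurable_funPT.
(* Width [harmonic n ^+ 2] and centres shifted by [harmonic n], which is much larger: then the
   smoothed indicators of the interval converge at its end points too, to that of [`]u, v]]. *)
pose E (n : nat) : R := harmonic n ^+ 2.
have E0 n : 0 < E n by rewrite exprn_gt0 ?harmonic_gt0.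
pose I g := expR (- (a * g `^ nu)).
pose M := \int[@lebesgue_measure R]_(g in `[0, +oo[) I g.
pose k n y g := expR (- (E n * g)) * (expR (- (a * g `^ nu)) * cos (g * (y + harmonic n) + b * g `^ nu)).
pose J n y := \int[@lebesgue_measure R]_(g in `[0, +oo[) k n y g.
have iI : (@lebesgue_measure R).-integrable `[0, +oo[ (EFin \o I) by exact: integrable0y_expR_powR.
have kI n y g : 0 <= g -> `|k n y g| <= I g.
  move=> g0; rewrite !normrM !(ger0_norm (expR_ge0 _)) mulrCA ler_piMr ?expR_ge0//.
  by rewrite mulr_ile1 ?expR_ge0 ?cos_max// expR_le1 oppr_le0 mulr_ge0// ltW.
have mE n : measurable_fun setT (fun g : R => expR (- (E n * g))).
  by apply: measurableT_comp => //; apply: measurableT_comp => //; exact: measurable_funM.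
have mk n y : measurable_fun setT (k n y).
  by apply: measurable_funM => //; exact: measurable_density_integrand.
have JP n y : J n y = \int[P]_w (E n / (E n ^+ 2 + (X w - (y + harmonic n)) ^+ 2)).
  rewrite (proj2 (@Rintegral_poisson_kernel _ T R P X (E n) (y + harmonic n) (E0 n))).
  apply: eq_Rintegral => g; rewrite inE/= in_itv/= andbT => g0.
  by rewrite hX// /k -opprD cosN.
have JM n y : `|J n y| <= M.
  have ik : (@lebesgue_measure R).-integrable `[0, +oo[ (EFin \o k n y).
    apply: le_integrable_EFin iI _ => //; first by apply: measurable_funTS; exact: mk.
    by move=> g; rewrite /= in_itv/= andbT; exact: kI.
  apply: (le_trans (le_normr_Rintegral _ ik)) => //.
  apply: le_Rintegral => //; first exact: integrable_norm.
  by move=> g; rewrite /= in_itv/= andbT; exact: kI.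
have cJ y : J n y @[n --> \oo] --> pi * stable_density a b nu y.
  rewrite /stable_density mulrA mulfV ?gt_eqF ?pi_gt0// mul1r.
  apply: (proj2 (@dominated_convergence_Rintegral _ _ _ (@lebesgue_measure R) `[0, +oo[
    (fun n => k n y) _ I _ _ _ _ _)) => //.
  - by move=> n; apply: measurable_funTS; exact: mk.
  - move=> g _; rewrite -[X in _ --> X]mul1r; apply: cvgM.
      rewrite -[X in _ --> X](@expR0 R); apply: continuous_cvg; first exact: continuous_expR.
      rewrite -[X in _ --> X](@oppr0 R) -[X in _ --> - X](mul0r g); apply: cvgN.
      by apply: cvgM; [exact: cvg_harmonic_sqr|exact: cvg_cst].
    apply: cvgM; first exact: cvg_cst.
    apply: continuous_cvg; first exact: continuous_cos.
    apply: cvgD; last exact: cvg_cst.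
    apply: cvgM; first exact: cvg_cst.
    rewrite -[X in _ --> X]addr0; apply: cvgD; [exact: cvg_cst|exact: cvg_harmonic].
  - by move=> n g; rewrite /= in_itv/= andbT; exact: kI.
pose A n w := atan ((v - X w + harmonic n) / E n) - atan ((u - X w + harmonic n) / E n).
have JA n : (@lebesgue_measure R).-integrable `[u, v] (EFin \o J n) /\
    \int[@lebesgue_measure R]_(y in `[u, v]) J n y = \int[P]_w A n w.
  pose f (y : R) w := E n / (E n ^+ 2 + (X w - (y + harmonic n)) ^+ 2).
  have q0 y w : 0 < E n ^+ 2 + (X w - (y + harmonic n)) ^+ 2.
    by rewrite ltr_wpDr ?sqr_ge0// exprn_gt0.
  have mf : measurable_fun setT (fun z : R * T => f z.1 z.2).
    have m1 : measurable_fun setT (fun r : R => E n / (E n ^+ 2 + r ^+ 2)).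
      apply: continuous_measurable_fun => r; apply: cvgM; first exact: cvg_cst.
      apply: cvgV; first by rewrite gt_eqF// ltr_wpDr ?sqr_ge0// exprn_gt0.
      by apply: cvgD; [exact: cvg_cst|apply: cvgM].
    apply: (measurableT_comp m1); apply: measurable_funB.
      exact: measurableT_comp mX measurable_snd.
    by apply: measurable_funD => //; exact: measurable_fst.
  have fb y w : `|f y w| <= 1 * (E n)^-1.
    rewrite mul1r /f ger0_norm; last by rewrite divr_ge0 ?(ltW (E0 n)) ?(ltW (q0 y w)).
    rewrite ler_pdivrMr// mulrDr expr2 mulKf ?gt_eqF// lerDl mulr_ge0 ?sqr_ge0//.
    by rewrite invr_ge0 ltW.
  have muv : measurable (`[u, v] : set R) by [].
  have i2 : P.-integrable setT (EFin \o (fun=> (E n)^-1)) by exact: finite_measure_integrable_cst.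
  have [H1 H2] := @Rintegral_swap _ _ (measurableTypeR R) T R (@lebesgue_measure R) P `[u, v] setT
    f (fun=> 1) (fun=> (E n)^-1) muv measurableT mf (integrable_itv_cst 1 u v) i2
    (fun y w _ _ => fb y w).
  split; first by apply: eq_integrable H1 => // y _; rewrite /= JP.
  transitivity (\int[@lebesgue_measure R]_(y in `[u, v]) \int[P]_w f y w).
    by apply: eq_Rintegral => y _; rewrite JP.
  rewrite H2; apply: eq_Rintegral => w _.
  have := @Rintegral_poisson_itv R (E n) (X w - harmonic n) u v (E0 n) uv.
  rewrite /A !opprB !addrA !(addrAC _ (harmonic n)) => <-.
  by apply: eq_Rintegral => y _; rewrite /f opprD addrA addrAC.
have c1 : \int[@lebesgue_measure R]_(y in `[u, v]) J n y @[n --> \oo]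
   --> \int[@lebesgue_measure R]_(y in `[u, v]) (pi * stable_density a b nu y).
  apply: (proj2 (@dominated_convergence_Rintegral _ _ _ (@lebesgue_measure R) `[u, v] J _ (fun=> M) _ _ _ _ _)) => //.
  - by move=> n; have [H _] := JA n; apply/measurable_EFinP; exact: measurable_int H.
  - exact: integrable_itv_cst.
pose B w := if X w \in `]u, v] then pi : R else 0.
have c2 : \int[P]_w A n w @[n --> \oo] --> \int[P]_w B w.
  apply: (proj2 (@dominated_convergence_Rintegral _ T R P setT A B (fun=> pi) _ _ _ _ _)) => //.
  - move=> n; apply: measurable_funB; apply: (measurableT_comp (continuous_measurable_fun (@continuous_atan R))).
      by apply: measurable_funM => //; apply: measurable_funD => //; exact: measurable_funB.
    by apply: measurable_funM => //; apply: measurable_funD => //; exact: measurable_funB.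
  - move=> w _; have := cvgB (@cvg_atan_shift R (v - X w)) (@cvg_atan_shift R (u - X w)) => /(_ _).
    rewrite !subr_ge0 /B in_itv/=; have [xu|ux] := leP (X w) u.
      by rewrite (le_trans xu (ltW uv)) subrr.
    by case: leP => _; rewrite opprK -?splitr ?addNr//.
  - exact: finite_measure_integrable_cst.
  - move=> n w _; rewrite /A ler_norml.
    have := atan_ltpi2 ((v - X w + harmonic n) / E n); have := atan_gtNpi2 ((v - X w + harmonic n) / E n).
    have := atan_ltpi2 ((u - X w + harmonic n) / E n); have := atan_gtNpi2 ((u - X w + harmonic n) / E n).
    by move=> *; apply/andP; split; lra.
have c3 : \int[@lebesgue_measure R]_(y in `[u, v]) (pi * stable_density a b nu y) = \int[P]_w B w.
  apply: (@cvg_unique _ _ _ _ _ _ _ c2) => //.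
  by rewrite (_ : (fun n => _) = (fun n => \int[@lebesgue_measure R]_(y in `[u, v]) J n y))//; apply/funext => n; case: (JA n).
have iW : (@lebesgue_measure R).-integrable `[u, v] (EFin \o stable_density a b nu).
  apply: continuous_compact_integrable; first exact: segment_compact.
  by apply: continuous_subspaceT; exact: continuous_stable_density.
move: c3; rewrite RintegralZl//.
have -> : \int[P]_w B w = pi * fine (P (X @^-1` `]u, v]%classic)).
  have mI : measurable (X @^-1` `]u, v]%classic).
    by rewrite -[X in measurable X]setTI; exact: mX.
  rewrite -Rintegral_cst// [RHS]Rintegral_mkcond; apply: eq_Rintegral => w _.
  by rewrite patchE /B; congr (if _ then _ else _); apply/idP/idP; rewrite inE.
move=> /(mulfI (lt0r_neq0 (pi_gt0 R))) h.
rewrite -[LHS]fineK ?fin_num_measure//; last first.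
  by rewrite -[X in measurable X]setTI; exact: mX.
rewrite -h Rintegral_itv_obnd_cbnd//.
by apply: integrableS iW => //; apply: subset_itvr; rewrite bnd_simp.
Qed.

(** * Characteristic exponents *)

Lemma Re_cexp (R : realType) (z : R[i]) :
  complex.Re (cexp z) = expR (complex.Re z) * cos (complex.Im z).
Proof. by rewrite /cexp Re_mulc /= mul0r subr0. Qed.

Lemma Im_cexp (R : realType) (z : R[i]) :
  complex.Im (cexp z) = expR (complex.Re z) * sin (complex.Im z).
Proof. by rewrite /cexp Im_mulc /= mul0r addr0. Qed.

Lemma eqc (R : realType) (z w : R[i]) :
  complex.Re z = complex.Re w -> complex.Im z = complex.Im w -> z = w.
Proof. by move=> h1 h2; apply/eqP; rewrite eq_complex h1 h2 !eqxx. Qed.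

Lemma has_fourier_stable_density (R : realType) (a b nu : R) (phi : R -> R[i]) :
  0 < a -> 0 < nu ->
  (@lebesgue_measure R).-integrable setT (EFin \o stable_density a b nu) ->
  (forall g, phi g = cexp ((- (a * `|g| `^ nu)) -i* (b * (Num.sg g * `|g| `^ nu)))) ->
  has_fourier (stable_density a b nu) phi.
Proof.
move=> a0 nu0 iW phiE; split=> // g; rewrite phiE.
have e1 x : cexp ('i%C * (g * x)%:C) * (stable_density a b nu x)%:C
   = (stable_density a b nu x * cos (g * x + 0)) +i* (stable_density a b nu x * cos (g * x + - (pi / 2))).
  apply: eqc.
    by rewrite Re_mulc Re_cexp Re_mulc Im_mulc /= addr0; simpc; rewrite expR0; ring.
  rewrite Im_mulc Re_cexp Im_cexp Re_mulc Im_mulc /=; simpc; rewrite expR0 cosB cos_pihalf sin_pihalf; ring.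
rewrite /Cintegral; apply: eqc.
  change (\int[@lebesgue_measure R]_x complex.Re (cexp ('i%C * (g * x)%:C) * (stable_density a b nu x)%:C)
    = complex.Re (cexp (- (a * `|g| `^ nu) -i* (b * (Num.sg g * `|g| `^ nu))))).
  under eq_Rintegral do rewrite e1.
  rewrite (Rintegral_stable_density_cos 0 g a0 nu0 iW) Re_cexp /= /stable_transform.
  by rewrite sub0r.
change (\int[@lebesgue_measure R]_x complex.Im (cexp ('i%C * (g * x)%:C) * (stable_density a b nu x)%:C)
  = complex.Im (cexp (- (a * `|g| `^ nu) -i* (b * (Num.sg g * `|g| `^ nu))))).
under eq_Rintegral do rewrite e1.
rewrite (Rintegral_stable_density_cos (- (pi / 2)) g a0 nu0 iW) Im_cexp /= /stable_transform.
by rewrite -opprD cosN cosD cos_pihalf sin_pihalf mul0r mul1r sub0r sinN.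
Qed.

Lemma pihalf_range (R : realType) (theta : R) : 0 < theta -> theta < 1 -> 0 < pi * theta / 2 < pi / 2.
Proof. by move=> h0 h1; have := pi_gt0 R => p0; apply/andP; split; nra. Qed.

Lemma cos_pihalf_gt0 (R : realType) (theta : R) : 0 < theta -> theta < 1 -> 0 < cos (pi * theta / 2).
Proof.
by move=> h0 h1; have /andP[? ?] := pihalf_range h0 h1; apply: cos_gt0_pihalf; apply/andP; split; lra.
Qed.

Lemma sin_pihalf_gt0 (R : realType) (theta : R) : 0 < theta -> theta < 1 -> 0 < sin (pi * theta / 2).
Proof.
by move=> h0 h1; have /andP[? ?] := pihalf_range h0 h1; apply: sin_gt0_pihalf; apply/andP; split; lra.
Qed.

Lemma subordinated_exponent (R : realType) (theta t g q : R) : 0 < theta -> theta < 1 ->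
  cexp (- (t * q * cos (pi * theta / 2))%:C * (1 + 'i%C * (tan (pi * theta / 2) * Num.sg g)%:C))
  = cexp ((- (t * cos (pi * theta / 2) * q)) -i* (t * sin (pi * theta / 2) * (Num.sg g * q))).
Proof.
move=> h0 h1; have k0 := cos_pihalf_gt0 h0 h1; congr cexp; apply: eqc.
  by rewrite Re_mulc /=; ring.
by rewrite Im_mulc /= /tan; field; rewrite gt_eqF.
Qed.

(** Here sigma^nu = cos(pi theta / 2) and beta tan(pi nu / 2) = - tan(pi theta / 2). The
    cancellation is legitimate because neither the sine nor the cosine of pi nu / 2 vanishes for nu
    in ]0, 2[ other than 1. *)
Lemma stable_char_exponent (R : realType) (alpha theta t g : R) :
  1 < alpha -> 0 < theta -> theta < 1 -> alpha * theta < 2 -> alpha * theta != 1 ->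
  stable_char (alpha * theta) (cos (pi * theta / 2) `^ (alpha * theta)^-1)
    (- (tan (pi * theta / 2) / tan (pi * alpha * theta / 2))) 0 t g
  = cexp ((- (t * cos (pi * theta / 2) * `|g| `^ (alpha * theta)))
      -i* (t * sin (pi * theta / 2) * (Num.sg g * `|g| `^ (alpha * theta)))).
Proof.
move=> al1 th0 th1 nu2 nu1; have k0 := cos_pihalf_gt0 th0 th1.
have nu0 : 0 < alpha * theta by rewrite mulr_gt0// (lt_trans _ al1).
rewrite /stable_char -powRrM mulVf ?gt_eqF// powRr1 ?ltW// -(mulrA pi alpha theta).
have p0 := pi_gt0 R.
have s0 : 0 < sin (pi * (alpha * theta) / 2).
  by apply: sin_gt0_pi; apply/andP; split; nra.
have c0 : cos (pi * (alpha * theta) / 2) != 0.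
  have [n1|n1] := ltP (alpha * theta) 1.
    by rewrite gt_eqF// cos_gt0_pihalf//; apply/andP; split; nra.
  have n2 : 1 < alpha * theta by rewrite lt_neqAle eq_sym nu1.
  rewrite -(subrK pi (pi * (alpha * theta) / 2)) cosDpi oppr_eq0 gt_eqF//.
  by apply: cos_gt0_pihalf; apply/andP; split; nra.
rewrite mul0r mul0r (_ : 'i%C * 0%:C = 0) ?add0r; last by rewrite mulr0.
congr cexp; apply: eqc.
  by rewrite Re_oppc Re_mulc /=; ring.
rewrite Im_oppc Im_mulc /= /tan; field.
by rewrite c0 !gt_eqF.
Qed.

Theorem mainTheorem4 (R : realType) (alpha theta : R)
    (halpha : 1 < alpha) (htheta0 : 0 < theta) (htheta1 : theta < 1)
    (d : measure_display) (Omega : measurableType d) (P : probability Omega R)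
    (S : R -> {RV P >-> R}) (hS : stable_subordinator theta S)
    (h : R -> R -> R)
    (hh : forall t : R, 0 < t ->
            has_density (S t) `]0, +oo[ (fun s => h s t)) :
  let w := subordinated_density (pseudo_density alpha) h in
  (forall t : R, 0 < t ->
     has_fourier (fun x => w x t) (fun g : R =>
       cexp (- (t * `|g| `^ (alpha * theta) * cos (pi * theta / 2))%:C
               * (1 + 'i%C * (tan (pi * theta / 2) * Num.sg g)%:C)))) /\
  (let nu := alpha * theta in
   let beta := - (tan (pi * theta / 2) / tan (pi * alpha * theta / 2)) in
   let sigma := cos (pi * theta / 2) `^ nu^-1 in
   let mu := 0 in
   0 < nu -> nu < 2 -> nu != 1 -> -1 <= beta -> beta <= 1 ->
   forall t : R, 0 < t ->
     [/\ is_pdf (fun x => w x t),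
         has_fourier (fun x => w x t) (stable_char nu sigma beta mu t) &
         forall (d' : measure_display) (Omega' : measurableType d')
                (P' : probability Omega' R) (Z : R -> {RV P' >-> R}),
           stable_process nu sigma beta mu Z ->
           has_density (Z t) setT (fun x => w x t)]).
Proof.
move=> w.
have nu0 : 0 < alpha * theta by rewrite mulr_gt0// (lt_trans _ halpha).
have k0 := cos_pihalf_gt0 htheta0 htheta1.
have s0 := sin_pihalf_gt0 htheta0 htheta1.
have p0 := pi_gt0 R.
pose W t := stable_density (t * cos (pi * theta / 2)) (t * sin (pi * theta / 2)) (alpha * theta).
have wE t : 0 < t -> (fun x => w x t) = W t.
  by move=> t0; apply/funext => x; exact: subordinated_density_stable hS (hh t t0) t0.
have iW t : 0 < t -> (@lebesgue_measure R).-integrable setT (EFin \o W t).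
  move=> t0; have [nu1|nu1] := leP 1 (alpha * theta).
    by apply: integrable_stable_density_ge1 => //; exact: mulr_gt0.
  (* The condition for positivity becomes sin((nu - theta) pi / 2) >= 0, which holds since theta <=
     nu < 1. *)
  apply: integrable_stable_density_ge0 => //; first exact: mulr_gt0.
  apply: stable_density_ge0 => //.
  - exact: mulr_gt0.
  - by rewrite (lt_trans nu1)// ltr1n.
  - by rewrite lt_eqF.
  have c1 : 0 < cos (alpha * theta * (pi / 2)).
    by apply: cos_gt0_pihalf; apply/andP; split; nra.
  rewrite (gtr0_norm c1) (gtr0_norm (mulr_gt0 t0 s0)) -[t * sin _ * _]mulrA -[t * cos _ * _]mulrA.
  rewrite ler_pM2l// -subr_ge0.
  have -> : cos (pi * theta / 2) * sin (alpha * theta * (pi / 2)) - sin (pi * theta / 2) * cos (alpha * theta * (pi / 2))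
     = sin (alpha * theta * (pi / 2) - pi * theta / 2) by rewrite sinB; ring.
  have q0 : 0 <= pi / 2 :> R by rewrite divr_ge0// ltW.
  have th : theta <= alpha * theta by rewrite ler_peMl// ltW.
  have -> : alpha * theta * (pi / 2) - pi * theta / 2 = (alpha * theta - theta) * (pi / 2) by field.
  apply: sin_ge0_pi; apply/andP; split; first by rewrite mulr_ge0 ?subr_ge0.
  have : (alpha * theta - theta) * (pi / 2) <= 1 * (pi / 2).
    by rewrite ler_wpM2r//; lra.
  lra.
split=> [t t0|nu beta sigma mu _ nu2 nu1 b1 b2 t t0].
  rewrite wE//; apply: has_fourier_stable_density => //; [exact: mulr_gt0|exact: iW|].
  by move=> g; rewrite subordinated_exponent.
have a0 : 0 < t * cos (pi * theta / 2) by exact: mulr_gt0.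
have W0 x : 0 <= W t x.
  apply: stable_density_ge0 => //.
  rewrite (gtr0_norm (mulr_gt0 t0 s0)) -[t * sin _ * _]mulrA -[t * cos _ * _]mulrA ler_pM2l//.
  have e2 : alpha * theta * (pi / 2) = pi * alpha * theta / 2 by ring.
  have sn : 0 < sin (pi * alpha * theta / 2).
    by apply: sin_gt0_pi; rewrite -e2 /nu in nu2 *; apply/andP; split; nra.
  have : `|beta| <= 1 by rewrite ler_norml b1.
  rewrite e2 /beta normrN normrM normfV /tan !normrM !normfV.
  rewrite (gtr0_norm s0) (gtr0_norm k0) (gtr0_norm sn) invfM invrK.
  have -> : sin (pi * theta / 2) / cos (pi * theta / 2) * ((sin (pi * alpha * theta / 2))^-1 * `|cos (pi * alpha * theta / 2)|)
     = sin (pi * theta / 2) * `|cos (pi * alpha * theta / 2)| / (cos (pi * theta / 2) * sin (pi * alpha * theta / 2)).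
    by field; rewrite !gt_eqF.
  by rewrite ler_pdivrMr ?mulr_gt0// mul1r.
have mW : measurable_fun setT (W t) by exact: measurable_stable_density.
have hphi : forall g, stable_char nu sigma beta mu t g
   = cexp ((- (t * cos (pi * theta / 2) * `|g| `^ nu)) -i* (t * sin (pi * theta / 2) * (Num.sg g * `|g| `^ nu))).
  by move=> g; exact: stable_char_exponent.
rewrite wE//; split.
- split=> //.
  (* The total mass is the value of the transform at frequency 0 and phase 0. *)
  rewrite -[LHS]fineK; last by apply: integrable_fin_num => //; exact: iW.
  congr EFin; have := @Rintegral_stable_density_cos R _ (t * sin (pi * theta / 2)) (alpha * theta) 0 0 a0 nu0 (iW t t0).
  rewrite /stable_transform normr0 sgr0 powR0 ?gt_eqF// !mulr0 oppr0 addr0 expR0 cos0 mulr1 => <-.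
  by apply: eq_Rintegral => x _; rewrite mul0r addr0 cos0 mulr1.
- by apply: has_fourier_stable_density => //; exact: iW.
move=> d' Omega' P' Z [_ hZ]; split=> // A mA; rewrite setIT.
apply: eq_density_ocitv => //; first exact: iW.
move=> u v uv; apply: probability_itv_stable_density => // g c g0.
rewrite Rintegral_cos_char_fun hZ// hphi Re_cexp Im_cexp /= ger0_norm//.
have -> : Num.sg g * g `^ (alpha * theta) = g `^ (alpha * theta).
  have [->|gn0] := eqVneq g 0; first by rewrite powR0 ?mulr0// gt_eqF.
  by rewrite gtr0_sg ?mul1r// lt0r gn0.
rewrite cosN sinN cosB; ring.
Qed.
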